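(* Let $\lambda=(k,k,\ldots,k)$ be a uniform partition of $n$ other than $(1,1,\ldots,1)$, and let $G\le\mathcal{S}_n$ be $\lambda$-homogeneous. Then one of the following holds: (1) $G$ is $\lambda$-transitive; (2) $n=6$, $\lambda=(3,3)$, and either $G=\mathrm{PSL}(2,5)$ or $G=\mathrm{AGL}(1,5)$ fixing a point; (3) $n=10$, $\lambda=(5,5)$, and $G$ is $\mathrm{PSL}(2,8)$ or $\mathrm{P\Gamma L}(2,8)$, in both cases fixing a point (acting on the other $9$ points); (4) $G$ fixes a point and acts as the alternating or the symmetric group on the remaining points.
   Context: $\Omega=\{1,\ldots,n\}$. A partition of $n$ is a non-increasing sequence of positive integers with sum $n$; it is uniform if all parts are equal. An ordered partition $(A_1,A_2,\ldots)$ of $\Omega$ has type $\lambda$ if $|A_i|=\lambda_i$. $G$ is $\lambda$-transitive if for any two ordered partitions $(A_i)$, $(B_i)$ of type $\lambda$ there is $g\in G$ with $A_ig=B_i$ for all $i$; $G$ is $\lambda$-homogeneous if for any two such ordered partitions there is $g\in G$ mapping the set of parts $\{A_1,A_2,\ldots\}$ onto the set of parts $\{B_1,B_2,\ldots\}$. The named groups are in their standard actions of degree $6$, $5$, $9$ respectively. *)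

(* Defs.v *)
From mathcomp Require Import all_boot all_fingroup all_solvable.
Set Implicit Arguments. Unset Strict Implicit. Unset Printing Implicit Defensive.

Definition ordered_partition_of_type (n k m : nat) (A : 'I_m -> {set 'I_n}) : Prop :=
  (forall i, #|A i| = k) /\
  (forall i j, i != j -> [disjoint A i & A j]) /\
  (\bigcup_(i < m) A i = [set: 'I_n]).

Definition lambda_transitive (n k m : nat) (G : {set {perm 'I_n}}) : Prop :=
  forall A B : 'I_m -> {set 'I_n},
    ordered_partition_of_type k A -> ordered_partition_of_type k B ->
    exists2 g, g \in G & forall i, g @: A i = B i.

Definition lambda_homogeneous (n k m : nat) (G : {set {perm 'I_n}}) : Prop :=
  forall A B : 'I_m -> {set 'I_n},
    ordered_partition_of_type k A -> ordered_partition_of_type k B ->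
    exists2 g, g \in G & [set g @: A i | i : 'I_m] = [set B i | i : 'I_m].

Definition perm_isomorphic (d n : nat) (H : {set {perm 'I_d}}) (G : {set {perm 'I_n}}) : Prop :=
  exists f : 'I_d -> 'I_n, bijective f /\
    (forall g : {perm 'I_n}, g \in G <-> exists2 h, h \in H & forall x, g (f x) = f (h x)).

Definition seqperm (d : nat) (s : seq nat) : {perm 'I_d.+1} :=
  @insubd _ _ {perm 'I_d.+1} (1%g : {perm 'I_d.+1})
    ([ffun x : 'I_d.+1 => (inord (nth 0 s x) : 'I_d.+1)] : {ffun 'I_d.+1 -> 'I_d.+1}).

(* ---- PSL(2,5) on the projective line over F_5: points 0..4 = F_5, 5 = infinity *)
Definition psl25_t : {perm 'I_6} := seqperm 5 [:: 1; 2; 3; 4; 0; 5].   (* x -> x+1 *)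
Definition psl25_s : {perm 'I_6} := seqperm 5 [:: 5; 4; 2; 3; 1; 0].   (* x -> -1/x *)
Definition PSL25 : {set {perm 'I_6}} := (<<[set psl25_t; psl25_s]>>)%g.

(* ---- AGL(1,5) on F_5 = {0..4}, fixing the point 5 *)
Definition agl15_a : {perm 'I_6} := seqperm 5 [:: 1; 2; 3; 4; 0; 5].   (* x -> x+1 *)
Definition agl15_m : {perm 'I_6} := seqperm 5 [:: 0; 2; 4; 1; 3; 5].   (* x -> 2x *)
Definition AGL15_fix : {set {perm 'I_6}} := (<<[set agl15_a; agl15_m]>>)%g.

(* ---- PSL(2,8), PGammaL(2,8) on the projective line over F_8 (points 0..7 =
   F_2[w]/(w^3+w+1), element b0+2*b1+4*b2 = b0+b1 w+b2 w^2; 8 = infinity),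
   fixing the point 9 *)
Definition psl28_t : {perm 'I_10} := seqperm 9 [:: 1; 0; 3; 2; 5; 4; 7; 6; 8; 9]. (* x -> x+1 *)
Definition psl28_w : {perm 'I_10} := seqperm 9 [:: 0; 2; 4; 6; 3; 1; 7; 5; 8; 9]. (* x -> w x *)
Definition psl28_s : {perm 'I_10} := seqperm 9 [:: 8; 1; 5; 6; 7; 2; 3; 4; 0; 9]. (* x -> 1/x *)
Definition pgl28_f : {perm 'I_10} := seqperm 9 [:: 0; 1; 4; 5; 6; 7; 2; 3; 8; 9]. (* x -> x^2 *)
Definition PSL28_fix : {set {perm 'I_10}} := (<<[set psl28_t; psl28_w; psl28_s]>>)%g.
Definition PGammaL28_fix : {set {perm 'I_10}} :=
  (<<[set psl28_t; psl28_w; psl28_s; pgl28_f]>>)%g.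

(* sanity: each table above is a permutation of 0..d, so seqperm is the intended
   permutation (not the default 1) *)
Lemma seqperm_tables_ok :
  [&& perm_eq [:: 1; 2; 3; 4; 0; 5] (iota 0 6),
      perm_eq [:: 5; 4; 2; 3; 1; 0] (iota 0 6),
      perm_eq [:: 1; 2; 3; 4; 0; 5] (iota 0 6),
      perm_eq [:: 0; 2; 4; 1; 3; 5] (iota 0 6),
      perm_eq [:: 1; 0; 3; 2; 5; 4; 7; 6; 8; 9] (iota 0 10),
      perm_eq [:: 0; 2; 4; 6; 3; 1; 7; 5; 8; 9] (iota 0 10),
      perm_eq [:: 8; 1; 5; 6; 7; 2; 3; 4; 0; 9] (iota 0 10)
    & perm_eq [:: 0; 1; 4; 5; 6; 7; 2; 3; 8; 9] (iota 0 10)].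
Proof. by []. Qed.

(* Main.v *)
(* A homogeneous group acts transitively on the k-partitions, so it is transitive on
   all points or fixes one point and is transitive on the rest. A prime p
   exceeding the number and the size of the parts divides its order, since no
   p-element of the symmetric group fixes a partition. If moreover p is more than
   half the degree, an element of order p is a p-cycle, and Jordan's theorem
   gives the alternating group as soon as p is at most the degree minus 3. Such
   primes exist from degree 16 on by a sharpening of Bertrand's postulate; the
   degrees 5, 6, 7 and 9 where they fail are settled by finite searches starting
   from the p-cycle, and degree 13 by the Livingstone-Wagner theorem. *)

Require Import Defs.
From mathcomp Require Import all_boot all_fingroup all_solvable.
From mathcomp Require Import zify.
Set Implicit Arguments. Unset Strict Implicit. Unset Printing Implicit Defensive.

(** * Bertrand's postulate *)

(** The margin in the prime bound comes from the fixed point. With [t] half of [n], a prime [p] with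
    [t < p <= 2t - 4] exceeds both [k] and [m] and satisfies [p + 3 <= n - 1], so it serves the
    transitive action and the action on [n - 1] points alike.

    In small degrees only a few elements of [G] are known explicitly. A search lists every
    permutation compatible with what transitivity prescribes for one more element, and forms short
    words in that candidate and the known elements, until it meets either an element that forces the
    alternating group (a 3-cycle, or one whose order has a usable prime factor) or a generator of an
    exceptional group. In degrees 6 and 9 the exceptional group found inside [G] is multiply
    transitive, so every element of [G] is, up to a factor in it, one that fixes two or three given
    points; these are listed in turn. The computations run on lists of numbers, obtained by
    labelling the points along a cycle of prime length. *)

Lemma prime_dvd_fact p n : prime p -> (p %| n`!) = (p <= n).
Proof.
move=> pp; have p1 := prime_gt1 pp; elim: n => [|n IHn]; first by rewrite fact0 dvdn1; lia.
rewrite factS Euclid_dvdM // IHn [RHS]leq_eqVlt ltnS.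
have [->|pn] := eqVneq p n.+1; first by rewrite dvdnn.
have [le|lt] := leqP p n; first by rewrite orbT.
by rewrite orbF gtnNdvd // ltn_neqAle eq_sym pn.
Qed.

Definition primorial n := \prod_(0 <= p < n.+1 | prime p) p.

Lemma prod_primes_dvd a b N : (forall p, prime p -> a <= p < b -> p %| N) ->
  \prod_(a <= p < b | prime p) p %| N.
Proof.
have [leab|ltba] := leqP a b; last by rewrite big_geq ?dvd1n // ltnW.
elim: b leab => [|b IHb]; first by rewrite leqn0 => /eqP->; rewrite big_geq.
rewrite leq_eqVlt => /orP[/eqP<- _|]; first by rewrite big_geq.
rewrite ltnS => leab pN.
rewrite big_mkcond big_nat_recr //= -big_mkcond /=; case: ifP => [pb|_]; last first.
  rewrite muln1; apply: IHb => // p pp /andP[lep ltp].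
  by apply: pN; rewrite // lep ltnW.
rewrite Gauss_dvd; first (apply/andP; split; last by apply: pN => //; rewrite leab ltnSn).
  apply: IHb => // p pp /andP[lep ltp].
  by apply: pN; rewrite // lep ltnW.
rewrite coprime_sym prime_coprime //; rewrite big_nat_cond.
elim/big_ind: _ => [|x y nx ny|p /andP[/andP[_ ltp] pp]].
- by rewrite dvdn1 gtn_eqF ?prime_gt1.
- by rewrite Euclid_dvdM // negb_or nx.
by rewrite gtnNdvd ?prime_gt0.
Qed.

Lemma sum_bin n : \sum_(i < n.+1) 'C(n, i) = 2 ^ n.
Proof. by rewrite -[2]/(1 + 1) expnDn; apply: eq_bigr => i _; rewrite !exp1n !muln1. Qed.

(** The two middle coefficients of row [2m + 1] are equal and together at most the row sum
    [2 ^ (2m + 1)]. *)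
Lemma bin_odd_leq m : 'C(m.*2.+1, m) <= 4 ^ m.
Proof.
rewrite -(leq_pmul2l (isT : 0 < 2)) -[4]/(2 ^ 2) -expnM -expnS mul2n [2 * m]mul2n.
rewrite -(sum_bin m.*2.+1) -addnn.
have E : 'C(m.*2.+1, m) = 'C(m.*2.+1, m.+1).
  by rewrite -bin_sub; [congr ('C(_, _)); lia | lia].
rewrite {2}E.
have h0 : m < m.*2.+2 by lia.
have h1 : m.+1 < m.*2.+2 by lia.
rewrite (bigD1 (Ordinal h0)) //= leq_add2l (bigD1 (Ordinal h1)) /= ?leq_addr //.
by rewrite -val_eqE /= gtn_eqF.
Qed.

(** Erdős's induction: an even [n > 2] brings no new prime, and for [n = 2m + 1] the primes from
    [m + 2] to [n] all divide a binomial coefficient that is at most [4 ^ m]. *)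
Lemma primorial_leq n : primorial n <= 4 ^ n.
Proof.
elim/ltn_ind: n => n IHn; have [n2|n3] := leqP n 2.
  by move: n2 {IHn}; case: n => [|[|[|//]]] _; rewrite /primorial unlock.
have [on|en] := boolP (odd n); last first.
  have -> : primorial n = primorial n.-1.
    rewrite /primorial prednK; last exact: ltn_trans n3.
    rewrite [LHS]big_mkcond big_nat_recr //= -big_mkcond /=; case: ifP => [pn|]; last by rewrite muln1.
    by have [n2|] := even_prime pn; [rewrite n2 in n3 | rewrite (negPf en)].
  apply: leq_trans (IHn _ _) _; [lia|].
  by rewrite leq_exp2l // leq_pred.
have -> : n = (n./2).*2.+1 by rewrite -[LHS]odd_double_half on.
set m := n./2; have m1 : 0 < m by rewrite /m; lia.
rewrite /primorial (@big_cat_nat _ _ _ m.+2) //=; [|lia].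
have -> : 4 ^ m.*2.+1 = 4 ^ m.+1 * 4 ^ m by rewrite -expnD; congr (_ ^ _); lia.
apply: leq_mul.
  by apply: (IHn m.+1); rewrite /m in m1 *; lia.
apply: leq_trans (bin_odd_leq m); apply: dvdn_leq; first by rewrite bin_gt0; lia.
apply: prod_primes_dvd => p pp /andP[lep ltp].
have : p %| (m.*2.+1)`! by rewrite prime_dvd_fact.
have -> : (m.*2.+1)`! = 'C(m.*2.+1, m) * (m`! * (m.+1)`!).
  by rewrite -(@bin_fact m.*2.+1 m); [congr (_ * (_ * _`!)); lia | lia].
rewrite !Euclid_dvdM // !prime_dvd_fact // => /orP[//|le].
have {}le : p <= m.+1 by case/or3P: le => [/leqW|/(dvdn_leq (ltn0Sn m))|/leqW].
by rewrite leqNgt lep in le.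
Qed.

Lemma central_bin_rec t : t.+1 * 'C(t.+1.*2, t.+1) = 2 * (t.*2.+1) * 'C(t.*2, t).
Proof.
have h1 : 'C(t.*2, t) * (t`! * t`!) = (t.*2)`!.
  by rewrite -(@bin_fact t.*2 t); [congr (_ * (_ * _`!)); lia | lia].
have : 'C(t.+1.*2, t.+1) * ((t.+1)`! * (t.+1)`!) = (t.+1.*2)`!.
  by rewrite -(@bin_fact t.+1.*2 t.+1); [congr (_ * (_ * _`!)); lia | lia].
rewrite doubleS !factS -h1 => E; apply/eqP.
have f0 : 0 < t.+1 * (t`! * t`!) by rewrite !muln_gt0 fact_gt0.
rewrite -(eqn_pmul2r f0); apply/eqP; move: E; set a := t`!; set C1 := 'C(_, _); set C2 := 'C(_, _).
rewrite -!muln2; nia.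
Qed.

(** The recurrence multiplies the coefficient by [2(2t + 1) / (t + 1)], slightly less than 4; the
    factor [2t] absorbs the loss. *)
Lemma central_bin_geq t : 0 < t -> 4 ^ t <= t.*2 * 'C(t.*2, t).
Proof.
elim: t => // -[|t] IHt _; first by [].
have := IHt isT; have := central_bin_rec t.+1; rewrite (expnS 4 t.+1).
set C1 := 'C(_, _); set C2 := 'C(_, _); set e := 4 ^ _.
rewrite -!muln2; nia.
Qed.

(** Legendre's formula for [(2t)!] and [t!]. The sum for [t!] is extended to [2t] by zero terms, so
    that the two can be subtracted termwise. *)
Lemma logn_central_bin p t : prime p -> logn p 'C(t.*2, t) =
  \sum_(1 <= k < t.*2.+1) (t.*2 %/ p ^ k - (t %/ p ^ k).*2).
Proof.
move=> pp.
have h1 : 'C(t.*2, t) * (t`! * t`!) = (t.*2)`!.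
  by rewrite -(@bin_fact t.*2 t); [congr (_ * (_ * _`!)); lia | lia].
have C0 : 0 < 'C(t.*2, t) by rewrite bin_gt0; lia.
have := congr1 (logn p) h1; rewrite !lognM ?muln_gt0 ?fact_gt0 // !logn_fact //.
have -> : \sum_(1 <= k < t.+1) t %/ p ^ k = \sum_(1 <= k < t.*2.+1) t %/ p ^ k.
  rewrite [RHS](@big_cat_nat _ _ _ t.+1) //=; [|lia].
  rewrite [X in _ + X]big_nat_cond [X in _ + X]big1 ?addn0 // => k /andP[/andP[ltk _] _].
  by rewrite divn_small // (leq_trans ltk) // ltnW // ltn_expl ?prime_gt1.
rewrite addnn -[X in _ + X = _ -> _]muln2 big_distrl /= => E.
apply/eqP; rewrite -(eqn_add2r (\sum_(1 <= k < t.*2.+1) t %/ p ^ k * 2)) E -big_split /=.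
apply/eqP/eq_bigr => k _; rewrite -[(t %/ p ^ k).*2]muln2 subnK //.
by rewrite -[t.*2]muln2 leq_divRL ?expn_gt0 ?prime_gt0 // mulnAC leq_mul2r leq_trunc_div orbT.
Qed.

(** Each term of the preceding sum is 0 or 1, and the terms with [p ^ k > 2t] vanish, so the
    exponent is at most the logarithm of [2t] to base [p]. *)
Lemma expn_logn_central_bin p t : 0 < t -> prime p -> p ^ logn p 'C(t.*2, t) <= t.*2.
Proof.
move=> t0 pp; have t20 : 0 < t.*2 by lia.
apply: leq_trans (trunc_logP (prime_gt1 pp) t20); rewrite leq_exp2l ?prime_gt1 //.
rewrite logn_central_bin //.
set l := trunc_log p t.*2.
have ll : l < t.*2.+1.
  by rewrite ltnS /l; apply: ltnW; apply: leq_trans (trunc_logP (prime_gt1 pp) t20); apply: ltn_expl; rewrite prime_gt1.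
rewrite (@big_cat_nat _ _ _ l.+1) //=.
rewrite [X in _ + X]big_nat_cond [X in _ + X]big1 ?addn0 => [|k /andP[/andP[ltk _] _]].
  apply: leq_trans (_ : \sum_(1 <= k < l.+1) 1 <= _); last by rewrite sum_nat_const_nat muln1 subn1.
  apply: leq_sum => k _; rewrite leq_subLR -!muln2.
  have p0 : 0 < p ^ k by rewrite expn_gt0 prime_gt0.
  by rewrite -ltnS ltn_divLR //; have := ltn_ceil t p0; nia.
rewrite divn_small ?sub0n //; apply: leq_trans (trunc_log_ltn t.*2 (prime_gt1 pp)) _.
by rewrite leq_exp2l ?prime_gt1.
Qed.

(** The quotients of [2t] and [t] by [p] are 2 and 1 and cancel; as [p >= 3], already [p ^ 2]
    exceeds [2t]. *)
Lemma logn_central_bin_mid p t : prime p -> 2 < p -> p <= t -> t.*2 < 3 * p -> logn p 'C(t.*2, t) = 0.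
Proof.
move=> pp p2 lept lt3; rewrite logn_central_bin // big_nat_cond big1 // => k /andP[/andP[k1 _] _].
case: k k1 => [//|[|k]] _.
  rewrite expn1; have -> : t %/ p = 1.
    by apply/eqP; rewrite eqn_leq -ltnS ltn_divLR ?leq_divRL ?prime_gt0 //; lia.
  apply/eqP; rewrite subn_eq0 -ltnS ltn_divLR ?prime_gt0 //.
rewrite divn_small ?sub0n //; apply: leq_trans lt3 _.
have : 0 < p ^ k by rewrite expn_gt0 prime_gt0.
by rewrite !expnS; set e := p ^ k; nia.
Qed.

Lemma nat_sqrt n : exists s, s ^ 2 <= n < s.+1 ^ 2.
Proof.
elim: n => [|n [s /andP[le lt]]]; first by exists 0.
have [lt'|ge] := ltnP n.+1 (s.+1 ^ 2); first by exists s; rewrite lt' (leq_trans le).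
by exists s.+1; rewrite ge /= (leq_ltn_trans lt) // ltn_exp2r.
Qed.

Lemma prod_leq_expn a b (F : nat -> nat) c : 0 < c ->
  (forall p, a <= p < b -> F p <= c) -> \prod_(a <= p < b) F p <= c ^ (b - a).
Proof.
move=> c0 Fc; rewrite -prod_nat_const_nat big_nat_cond [X in _ <= X]big_nat_cond.
by apply: leq_prod => p; rewrite andbT; apply: Fc.
Qed.

(* The primes [2t - 1] and [2t - 3] are allowed, which only costs a factor
   polynomial in [t] compared with Erdős's estimate. *)
Lemma central_bin_leq t s : 4 < t -> s ^ 2 <= t.*2 < s.+1 ^ 2 ->
  (forall p, prime p -> t < p -> p + 4 <= t.*2 -> False) ->
  'C(t.*2, t) <= t.*2 ^ (s + 5) * 4 ^ (t.*2 %/ 3).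
Proof.
move=> t4 /andP[s1 s2] nop; set C := 'C(_, _); set q := t.*2 %/ 3.
have t0 : 0 < t by lia.
have C0 : 0 < C by rewrite bin_gt0; lia.
have lneq p : t.*2 < p -> logn p C = 0.
  move=> ltp; rewrite lognE; case: ifP => // /and3P[pp _ pC].
  have : p %| (t.*2)`! by rewrite -(@bin_fact t.*2 t) ?dvdn_mulr //; lia.
  by rewrite prime_dvd_fact // leqNgt ltp.
have lncomp p : ~~ prime p -> logn p C = 0 by rewrite lognE => /negPf->.
pose F p := p ^ logn p C.
have F2t p : F p <= t.*2.
  have [pp|np] := boolP (prime p); first exact: expn_logn_central_bin.
  by rewrite /F lncomp //; lia.
(* The factorisation of [C] and the product wanted have different upper limits; both are extended to
   the larger one by factors 1. *)
have -> : C = \prod_(0 <= p < t.*2.+1) F p.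
  rewrite -[LHS](partnT C0) /partn big_mkcond /=.
  have le1 : C.+1 <= maxn C.+1 t.*2.+1 by rewrite leq_maxl.
  have le2 : t.*2.+1 <= maxn C.+1 t.*2.+1 by rewrite leq_maxr.
  transitivity (\prod_(0 <= p < maxn C.+1 t.*2.+1) F p).
    rewrite [RHS](@big_cat_nat _ _ _ C.+1) //= [X in _ * X]big_nat_cond [X in _ * X]big1 ?muln1 //.
    move=> p /andP[/andP[ltp _] _]; rewrite /F lognE; case: ifP => // /and3P[_ _ /(dvdn_leq C0)].
    by rewrite leqNgt ltp.
  rewrite (@big_cat_nat _ _ _ t.*2.+1) //= [X in _ * X]big_nat_cond [X in _ * X]big1 ?muln1 //.
  by move=> p /andP[/andP[ltp _] _]; rewrite /F lneq.
have sq : s <= t.*2.+1 by nia.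
have sqrt_small p : prime p -> s < p -> logn p C <= 1.
  move=> pp ltp; rewrite -ltnS -(ltn_exp2l _ _ (prime_gt1 pp)).
  apply: leq_ltn_trans (expn_logn_central_bin t0 pp) _; apply: leq_trans s2 _.
  by rewrite leq_exp2r.
(* The range is cut at [s], [t] and [2t - 4]. Up to [s] every prime power is at most [2t]. From
   there to [t] exponents are at most 1 and vanish beyond a third of [2t], which leaves a primorial.
   Up to [2t - 4] there is no prime, and the last four factors are at most [2t] each; hence the
   exponent [(s + 1) + 4]. *)
have A1 : \prod_(0 <= p < s.+1) F p <= t.*2 ^ s.+1.
  by rewrite -{2}[s.+1]subn0; apply: prod_leq_expn; [lia|].
have s3 : 2 < s by nia.
have A4 : \prod_((t.*2 - 4).+1 <= p < t.*2.+1) F p <= t.*2 ^ 4.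
  have -> : t.*2 ^ 4 = t.*2 ^ (t.*2.+1 - (t.*2 - 4).+1) by congr (_ ^ _); lia.
  by apply: prod_leq_expn; [lia|].
have A3 : \prod_(t.+1 <= p < (t.*2 - 4).+1) F p = 1.
  rewrite big_nat_cond big1 // => p /andP[/andP[ltp lep] _].
  have [pp|np] := boolP (prime p); last by rewrite /F lncomp.
  by case: (nop p pp ltp); lia.
have q3 : q * 3 <= t.*2 < q.+1 * 3 by rewrite leq_trunc_div ltn_ceil.
have A2 : \prod_(s.+1 <= p < t.+1) F p <= 4 ^ q.
  apply: leq_trans (primorial_leq q); rewrite /primorial.
  have [lts|les] := leqP q s.
    rewrite big_nat_cond big1; last first.
      move=> p /andP[/andP[ltp lep] _].
      have [pp|np] := boolP (prime p); last by rewrite /F lncomp.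
      by rewrite /F logn_central_bin_mid //; lia.
    by apply: prodn_cond_gt0 => p /prime_gt0.
  rewrite (@big_cat_nat _ _ _ q.+1) //=; [|lia|lia].
  rewrite [X in _ * X <= _]big_nat_cond [X in _ * X <= _]big1 ?muln1; last first.
    move=> p /andP[/andP[ltp lep] _].
    have [pp|np] := boolP (prime p); last by rewrite /F lncomp.
    by rewrite /F logn_central_bin_mid //; lia.
  rewrite [X in _ <= X](@big_cat_nat _ _ _ s.+1) //=; [|lia].
  apply: leq_trans (leq_pmull _ _); last first.
    by rewrite big_mkcond; apply/prodn_gt0 => p; case: ifP => // /prime_gt0.
  rewrite [X in _ <= X]big_mkcond /= big_nat_cond [X in _ <= X]big_nat_cond.
  apply: leq_prod => p /andP[/andP[ltp _] _]; case: ifP => [pp|/negbT np].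
    by rewrite /F -[X in _ <= X]expn1 leq_exp2l ?prime_gt1 // sqrt_small.
  by rewrite /F lncomp.
have [lest|] := leqP s t; last by nia.
rewrite (@big_cat_nat _ _ _ s.+1) //=.
rewrite [X in _ * X <= _](@big_cat_nat _ _ _ t.+1) //=; [|lia].
rewrite [X in _ * (_ * X) <= _](@big_cat_nat _ _ _ (t.*2 - 4).+1) //=; [|lia|lia].
rewrite A3 mul1n.
have -> : s + 5 = s.+1 + 4 by lia.
  by rewrite expnD -mulnA [X in _ <= _ * X]mulnC leq_mul // leq_mul.
by lia.
Qed.

(** The bound 1985 is the least [t] with [2t >= 63 ^ 2], so that the root [s] satisfies
    [s + 1 >= 2 ^ 6]. *)
Lemma prime_between_large t : 1985 <= t -> exists2 p, prime p & t < p <= t.*2 - 4.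
Proof.
move=> t_big; have [s /andP[s1 s2]] := nat_sqrt t.*2.
have [/hasP[p _ /andP[pp pt]]|/hasPn nop] :=
  boolP (has (fun p => prime p && (t < p <= t.*2 - 4)) (iota 0 t.*2)); first by exists p.
have := @central_bin_leq t s _ _ _; rewrite s1 s2 => /(_ _ isT) Cle.
have {}Cle : 'C(t.*2, t) <= t.*2 ^ (s + 5) * 4 ^ (t.*2 %/ 3).
  apply: Cle; first lia.
  move=> p pp ltp lep; have := nop p; rewrite mem_iota pp ltp => /(_ _).
  have -> : p <= t.*2 - 4 by lia.
  by move=> /(_ _)/negP; apply; lia.
have := leq_trans (@central_bin_geq t _) (leq_mul (leqnn t.*2) Cle).
rewrite mulnA -expnS => /(_ _) big; have {}big := big (leq_trans (isT : 0 < 1985) t_big).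
set L := trunc_log 2 s.+1.
have /andP[L1 L2] : 2 ^ L <= s.+1 < 2 ^ L.+1 by rewrite trunc_log_ltn // trunc_logP.
have t2L : t.*2 <= 2 ^ (L.+1 * 2).
  by rewrite expnM ltnW // (leq_trans s2) // leq_exp2r // ltnW.
set q := t.*2 %/ 3 in big; have q3 : q * 3 <= t.*2 by rewrite leq_trunc_div.
have : 2 ^ (2 * t) <= 2 ^ (L.+1 * 2 * (s + 5).+1 + 2 * q).
  rewrite [in X in X <= _]expnM; apply: leq_trans big _.
  by rewrite expnD expnM [2 ^ (2 * q)]expnM leq_mul2r leq_exp2r // t2L orbT.
rewrite leq_exp2l // => ineq.
have L6 : 6 <= L.
  have s63 : 64 <= s.+1 by nia.
  by rewrite /L; apply: trunc_log_max => //; rewrite -[2 ^ 6]/64.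
(* With [3q <= 2t], the inequality of exponents gives [2t <= 6(L + 1)(s + 6) <= (s - 12)(s + 6) < s
   ^ 2], contrary to [s ^ 2 <= 2t]. *)
have L2b : 6 * L.+1 + 12 <= s.
  rewrite -ltnS; apply: leq_trans L1.
  elim: {L2 t2L ineq} L L6 => // L IHL; rewrite leq_eqVlt => /orP[/eqP<- //|].
  rewrite ltnS => /IHL; rewrite expnS; lia.
by nia.
Qed.

(** Each prime of the chain is at most [2r - 4], where [r] is its predecessor, so it serves every
    [t] from [r] on that is below it; 11 serves from 8 on. *)
Lemma prime_between t : 8 <= t -> exists2 p, prime p & t < p <= t.*2 - 4.
Proof.
move=> t8; have [|lt] := leqP 1985 t; first exact: prime_between_large.
have [h|h] := ltnP t 11; first by exists 11 => //; lia.
have [h1|h1] := ltnP t 13; first by exists 13 => //; lia.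
have [h2|h2] := ltnP t 19; first by exists 19 => //; lia.
have [h3|h3] := ltnP t 29; first by exists 29 => //; lia.
have [h4|h4] := ltnP t 47; first by exists 47 => //; lia.
have [h5|h5] := ltnP t 83; first by exists 83 => //; lia.
have [h6|h6] := ltnP t 151; first by exists 151 => //; lia.
have [h7|h7] := ltnP t 293; first by exists 293 => //; lia.
have [h8|h8] := ltnP t 577; first by exists 577 => //; lia.
have [h9|h9] := ltnP t 1129; first by exists 1129 => //; lia.
by exists 2251 => //; lia.
Qed.

(** * Searches among words in permutations *)

Section Words.
Implicit Types (s t w : seq nat) (gens fr : seq (seq nat)).

(* A permutation of [{0, .., N - 1}] is the list of its values. The searches below
   use [if] rather than [||] and [&&], so that evaluation stops early under any
   reduction strategy. *)
Definition comp_seq s t := [seq nth 0 t i | i <- s].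

Fixpoint some_in (T : seq nat -> bool) fr :=
  if fr is s :: fr' then if T s then true else some_in T fr' else false.

(** Started from the generators, depth [d] covers the words of length 1 to [d + 1], level by level
    and without removing repetitions. *)
Fixpoint search (T : seq nat -> bool) gens d fr :=
  if some_in T fr then true
  else if d is d'.+1 then search T gens d' (flatten [seq [seq comp_seq a g | g <- gens] | a <- fr])
  else false.

Definition reaches T gens d := search T gens d gens.

(** The power [e] removes the cycles whose length divides [e]. With [q = 3] and [e = 4], a word made
    of one 3-cycle and of cycles of length 1, 2 or 4 is accepted. *)
Definition is_cycle_power q e w :=
  let id := iota 0 (size w) in
  let v := iter e (comp_seq w) id in
  if count (fun i => nth 0 v i != i) id == q then iter q (comp_seq v) id == id else false.

(** For [q] prime this means a cycle of length exactly [q], so that [q] divides the order of the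
    permutation. *)
Definition has_orbit q w :=
  has (fun i => if nth 0 w i == i then false else iter q (nth 0 w) i == i) (iota 0 (size w)).

Fixpoint closure_seq gens d fr acc :=
  if d is d'.+1 then
    let new := foldr (fun s l => if (s \in acc) then l else if s \in l then l else s :: l) [::]
       (flatten [seq [seq comp_seq a g | g <- gens] | a <- fr]) in
    closure_seq gens d' new (new ++ acc)
  else acc.

(** Locked, so that the factorially long list is unfolded only on request. *)
Definition candidates (pre mid suf : seq nat) :=
  locked [seq pre ++ h ++ suf | h <- permutations mid].

Definition generated_seq gens d := closure_seq gens d gens gens.

(** What the searches know of a group: the set of value lists of its elements, for some labelling of
    the points (see [codes_closed]). Decidability allows asking whether one of the listed candidates
    belongs to the group. *)
Record perm_closed N (P : seq nat -> Prop) : Prop := PermClosed {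
  pc_comp : forall s t, P s -> P t -> P (comp_seq s t);
  pc_div : forall s t, P s -> P t -> exists2 h, P h & s = comp_seq h t;
  pc_perm : forall s, P s -> perm_eq s (iota 0 N);
  pc_dec : forall s, P s \/ ~ P s }.

Lemma some_inP T fr : some_in T fr -> exists2 w, w \in fr & T w.
Proof.
elim: fr => //= s fr IH; case: ifP => [Ts _|_ /IH[w fw Tw]].
  by exists s; rewrite ?mem_head.
by exists w; rewrite ?inE ?fw ?orbT.
Qed.

Section Closed.
Variables (N : nat) (P : seq nat -> Prop) (cP : perm_closed N P).

Lemma reaches_ind T gens d : (forall g, g \in gens -> P g) ->
  reaches T gens d -> exists2 w, P w & T w.
Proof.
move=> Pg; rewrite /reaches.
have : forall g, g \in gens -> P g := Pg; move: {1 3}gens; elim: d => [|d IH] fr Pfr /=.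
  by case: ifP => // /some_inP[w fw Tw] _; exists w; rewrite //; apply: Pfr.
case: ifP => [/some_inP[w fw Tw] _|_]; first by exists w; rewrite //; apply: Pfr.
apply: IH => w /flatten_mapP[a fa /mapP[g gg ->]].
by apply: (pc_comp cP); [apply: Pfr | apply: Pg].
Qed.

Lemma reaches_eq t gens d : (forall g, g \in gens -> P g) -> reaches (pred1 t) gens d -> P t.
Proof. by move=> Pg /(reaches_ind Pg)[w Pw /eqP<-]. Qed.

Lemma generated_seqP gens d : (forall g, g \in gens -> P g) ->
  forall s, s \in generated_seq gens d -> P s.
Proof.
move=> Pg; rewrite /generated_seq.
suff clos_ind d' fr acc : (forall s, s \in fr -> P s) -> (forall s, s \in acc -> P s) ->
    forall s, s \in closure_seq gens d' fr acc -> P s by exact: (clos_ind d gens gens Pg Pg).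
elim: d' fr acc => [|d' IH] fr acc Pfr Pacc //=.
set new := foldr _ _ _.
have Pn s : s \in new -> P s.
  have : forall s, s \in flatten [seq [seq comp_seq a g | g <- gens] | a <- fr] -> P s.
    move=> w /flatten_mapP[a fa /mapP[g gg ->]].
    by apply: (pc_comp cP); [apply: Pfr | apply: Pg].
  rewrite /new; elim: (flatten _) => [//|u l IHl] /= Pl.
  have {}IHl := IHl (fun w wl => Pl w (mem_behead (s := u :: l) wl)).
  case: ifP => // _; case: ifP => // _; rewrite inE => /orP[/eqP->|//].
  by apply: Pl; rewrite mem_head.
by apply: IH => // s; rewrite mem_cat => /orP[/Pn|/Pacc].
Qed.

Lemma pc_size s : P s -> size s = N.
Proof. by move/(pc_perm cP)/perm_size; rewrite size_iota. Qed.

Lemma perm_candidate pre mid suf s : P s -> perm_eq (pre ++ mid ++ suf) (iota 0 N) ->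
    (forall i, i < size pre -> nth 0 s i = nth 0 pre i) ->
    (forall i, i < size suf -> nth 0 s (size pre + size mid + i) = nth 0 suf i) ->
  s \in candidates pre mid suf.
Proof.
move=> Ps pm Epre Esuf; have sz := pc_size Ps.
have szN : size pre + (size mid + size suf) = N.
  by move/perm_size: (pm); rewrite !size_cat size_iota.
have E : s = pre ++ take (size mid) (drop (size pre) s) ++ suf.
  have sd : size (drop (size pre) s) = size mid + size suf.
    by rewrite size_drop sz -szN addKn.
  rewrite -[LHS](cat_take_drop (size pre)); congr (_ ++ _).
    have st : size (take (size pre) s) = size pre.
      by rewrite size_takel // sz -szN leq_addr.
    apply: (@eq_from_nth _ 0) => //; rewrite st => i lti.
    by rewrite nth_take // Epre.
  rewrite -[LHS](cat_take_drop (size mid)); congr (_ ++ _).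
  apply: (@eq_from_nth _ 0); first by rewrite size_drop sd addKn.
  by rewrite size_drop sd addKn => i lti; rewrite !nth_drop addnA Esuf.
rewrite /candidates -lock; apply/mapP; exists (take (size mid) (drop (size pre) s)) => //.
rewrite mem_permutations; have := pc_perm cP Ps; rewrite {1}E.
by rewrite perm_sym -(permPl pm) perm_cat2l perm_cat2r perm_sym.
Qed.

Lemma pc_uniq s : P s -> uniq s.
Proof. by move=> Ps; rewrite (perm_uniq (pc_perm cP Ps)) iota_uniq. Qed.

Lemma pc_nth_neq s i j : P s -> i < N -> j < N -> i != j -> nth 0 s i != nth 0 s j.
Proof. by move=> Ps li lj; rewrite nth_uniq ?pc_size // pc_uniq. Qed.

Lemma pc_dec_seq (L : seq (seq nat)) (b : pred (seq nat)) :
  (exists2 h, h \in L & P h /\ ~~ b h) \/ (forall h, h \in L -> P h -> b h).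
Proof.
elim: L => [|h L [[w wL [Pw bw]]|IH]]; [by right| |].
  by left; exists w; rewrite // inE wL orbT.
have [Ph|nPh] := pc_dec cP h; last first.
  by right=> w; rewrite inE => /orP[/eqP->|]; [move/nPh | apply: IH].
have [bh|bh] := boolP (b h); last by left; exists h; rewrite ?mem_head.
by right=> w; rewrite inE => /orP[/eqP->|]; [ | apply: IH].
Qed.

Lemma pc_mem_permutations s : P s -> s \in permutations (iota 0 N).
Proof. by move=> Ps; rewrite mem_permutations (pc_perm cP Ps). Qed.

End Closed.

End Words.

(* Otherwise unification unfolds the searches. *)
Opaque reaches is_cycle_power has_orbit generated_seq permutations.

Definition has_word (P : seq nat -> Prop) T := exists2 w : seq nat, P w & T w.

(** Triple transitivity, tested from a single base triple. *)
Definition covers3 (L : seq (seq nat)) a b c n :=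
  all (fun i => all (fun j => all (fun k => uniq [:: i; j; k] ==>
    has (fun t => if nth 0 t a == i then if nth 0 t b == j then nth 0 t c == k else false else false) L)
  (iota 0 n)) (iota 0 n)) (iota 0 n).

Lemma covers3P L a b c n i j k : covers3 L a b c n -> i < n -> j < n -> k < n ->
    uniq [:: i; j; k] ->
  exists2 t, t \in L & [/\ nth 0 t a = i, nth 0 t b = j & nth 0 t c = k].
Proof.
move=> tr li lj lk ijk; have mi l : l < n -> l \in iota 0 n by rewrite mem_iota.
have := allP (allP (allP tr _ (mi i li)) _ (mi j lj)) _ (mi k lk).
rewrite ijk implyTb => /hasP[t tL].
by case: ifP => // /eqP E0; case: ifP => // /eqP E1 /eqP E2; exists t.
Qed.

Opaque covers3.

(** On the projective line over the field of 5 elements, with 5 as infinity, these are [x + 1],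
    [-1/x], [2x] and [-x]. The first two generate PSL(2,5); as 2 is not a square, [dbl6] enlarges it
    to PGL(2,5). *)
Definition aff6 := [:: 1; 2; 3; 4; 0; 5].
Definition inv6 := [:: 5; 4; 2; 3; 1; 0].
Definition dbl6 := [:: 0; 2; 4; 1; 3; 5].
Definition neg6 := [:: 0; 4; 3; 2; 1; 5].
Definition agl15_seq := locked (generated_seq [:: aff6; dbl6] 8).
Definition pgl25_seq := locked (generated_seq [:: aff6; inv6; dbl6] 12).

Lemma agl15_seqP P t : perm_closed 6 P -> P aff6 -> P dbl6 -> t \in agl15_seq -> P t.
Proof.
move=> cP Pa Pi; rewrite /agl15_seq /pgl25_seq -lock; apply: (generated_seqP cP) => x.
by rewrite !inE => /orP[/eqP->|/eqP->].
Qed.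

Lemma pgl25_seqP P t : perm_closed 6 P -> P aff6 -> P inv6 -> P dbl6 -> t \in pgl25_seq -> P t.
Proof.
move=> cP Pa Pi Pd; rewrite /agl15_seq /pgl25_seq -lock; apply: (generated_seqP cP) => x.
by rewrite !inE => /or3P[/eqP->|/eqP->|/eqP->].
Qed.

(* [relabel10] exchanges 0 and infinity, the two fixed points of [scal10]. *)
Definition trans10 := [:: 1; 0; 3; 2; 5; 4; 7; 6; 8; 9].
Definition scal10 := [:: 0; 2; 4; 6; 3; 1; 7; 5; 8; 9].
Definition inv10 := [:: 8; 1; 5; 6; 7; 2; 3; 4; 0; 9].
Definition frob10 := [:: 0; 1; 4; 5; 6; 7; 2; 3; 8; 9].
Definition swap10 := [:: 8; 1; 2; 3; 4; 5; 6; 7; 0; 9].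
Definition relabel10 s := comp_seq swap10 (comp_seq s swap10).

Ltac compute_seq :=
  rewrite /candidates /agl15_seq /pgl25_seq -?lock; vm_compute; exact: isT.

(** * Searches in degrees 5, 6, 7 and 9 *)

Section Degree6.
Variables (P : seq nat -> Prop) (cP : perm_closed 6 P).
Hypothesis Pc : P aff6.
Let T3 := is_cycle_power 3 4.

Let Pgens2 x y : P x -> P y -> forall g, g \in [:: x; y] -> P g.
Proof. by move=> Px Py g; rewrite !inE => /orP[/eqP->|/eqP->]. Qed.

Let Pgens3 x y z : P x -> P y -> P z -> forall g, g \in [:: x; y; z] -> P g.
Proof. by move=> Px Py Pz g; rewrite !inE => /or3P[/eqP->|/eqP->|/eqP->]. Qed.

(** Double transitivity provides a [g] exchanging 0 and infinity. Each of the 24 possibilities,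
    together with the 5-cycle, yields a 3-cycle or the standard PSL(2,5). *)
Lemma degree6_swap g : P g -> nth 0 g 0 = 5 -> nth 0 g 5 = 0 -> has_word P T3 \/ P inv6.
Proof.
move=> Pg g0 g5.
have gC : g \in candidates [:: 5] [:: 1; 2; 3; 4] [:: 0].
  by apply: (perm_candidate cP Pg) => [|[]|[]].
have chk : all (fun g => if reaches T3 [:: aff6; g] 9 then true
            else reaches (pred1 inv6) [:: aff6; g] 8)
         (candidates [:: 5] [:: 1; 2; 3; 4] [:: 0]) by compute_seq.
have := allP chk _ gC; case: ifP => [w _|_ w].
  by left; apply: (reaches_ind cP (Pgens2 Pc Pg) w).
by right; apply: (reaches_eq cP (Pgens2 Pc Pg) w).
Qed.

(** As -1 is a square modulo 5, [x -> -x] lies in PSL(2,5); with the identity it forms the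
    stabiliser there of 0 and infinity. *)
Lemma degree6_neg : P inv6 -> P neg6.
Proof.
move=> Pi; apply: (reaches_eq cP (Pgens2 Pc Pi) (_ : reaches (pred1 neg6) [:: aff6; inv6] 10)).
by vm_compute.
Qed.

(** A group containing PSL(2,5) is controlled by its elements fixing 0 and infinity. Besides [1] and
    [-x], either [h] or [h ^ 3] is [x -> 2x], or a 3-cycle appears. *)
Lemma degree6_stab h : P inv6 -> P h -> nth 0 h 0 = 0 -> nth 0 h 5 = 5 ->
  [\/ has_word P T3, P dbl6 | h \in [:: iota 0 6; neg6]].
Proof.
move=> Pi Ph h0 h5.
have hC : h \in candidates [:: 0] [:: 1; 2; 3; 4] [:: 5].
  by apply: (perm_candidate cP Ph); [vm_compute | case=> [_|//] | case=> [_|//]].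
have chk : all (fun h => if h \in [:: iota 0 6; neg6] then true else
     if reaches (pred1 dbl6) [:: h; h] 2 then true else reaches T3 [:: aff6; inv6; h] 5)
   (candidates [:: 0] [:: 1; 2; 3; 4] [:: 5]) by compute_seq.
have := allP chk _ hC; case: ifP => [hL _|_]; first by constructor 3.
case: ifP => [w _|_ w].
  by constructor 2; apply: (reaches_eq cP (Pgens2 Ph Ph) w).
by constructor 1; apply: (reaches_ind cP (Pgens3 Pc Pi Ph) w).
Qed.

Lemma degree6_pgl25_trans i j k : P inv6 -> P dbl6 -> i < 6 -> j < 6 -> k < 6 -> uniq [:: i; j; k] ->
  exists2 s, P s & [/\ nth 0 s 0 = i, nth 0 s 1 = j & nth 0 s 2 = k].
Proof.
move=> Pi Pd li lj lk Uijk.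
have tr : covers3 pgl25_seq 0 1 2 6 by compute_seq.
have [t tL Et] := covers3P tr li lj lk Uijk.
by exists t; first exact: (pgl25_seqP cP).
Qed.

(* The synthemes {01|23|45} and {01|35|24} lie in different orbits of PGL(2,5). *)
Lemma degree6_syntheme s : P inv6 -> P s ->
    (forall i, i \in [:: 0; 2; 4] -> (nth 0 s i, nth 0 s i.+1) \in
      [:: (0, 1); (1, 0); (3, 5); (5, 3); (2, 4); (4, 2)]) ->
  has_word P T3.
Proof.
move=> Pi Ps syn.
have chk : all (fun s => if all (fun i => (nth 0 s i, nth 0 s i.+1) \in
      [:: (0, 1); (1, 0); (3, 5); (5, 3); (2, 4); (4, 2)]) [:: 0; 2; 4] then
    reaches T3 [:: aff6; inv6; s] 5 else true) (permutations (iota 0 6)) by compute_seq.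
have := allP chk _ (pc_mem_permutations cP Ps); case: ifP => [_ w|/allP[]].
  exact: (reaches_ind cP (Pgens3 Pc Pi Ps) w).
exact: syn.
Qed.

Hypothesis fix5 : forall s, P s -> nth 0 s 5 = 5.

Let agl_candidate s : P s -> s \in candidates [::] [:: 0; 1; 2; 3; 4] [:: 5].
Proof.
move=> Ps; apply: (perm_candidate cP Ps); [by vm_compute | by [] |].
by case=> [_|//]; apply: fix5.
Qed.

(** The dihedral group of order 10 preserves differences up to sign, so it has no element taking
    [{0, 1}] to [{0, 2}]: such a [g] leads to AGL(1,5) or to an element of order divisible by 3, and
    so does any further element outside AGL(1,5). *)
Lemma degree5_agl15 g : P g -> perm_eq [:: nth 0 g 0; nth 0 g 1] [:: 0; 2] ->
  has_word P (has_orbit 3) \/ (P dbl6 /\ forall s, P s -> s \in agl15_seq).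
Proof.
move=> Pg g01.
have chk : all (fun g => if perm_eq [:: nth 0 g 0; nth 0 g 1] [:: 0; 2] then
     if reaches (has_orbit 3) [:: aff6; g] 6 then true else reaches (pred1 dbl6) [:: aff6; g] 6
     else true) (candidates [::] [:: 0; 1; 2; 3; 4] [:: 5]) by compute_seq.
have := allP chk _ (agl_candidate Pg); rewrite g01; case: ifP => [w _|_ w].
  by left; apply: (reaches_ind cP (Pgens2 Pc Pg) w).
have Pd : P dbl6 by apply: (reaches_eq cP (Pgens2 Pc Pg) w).
have chk2 : all (fun h => if reaches (has_orbit 3) [:: aff6; dbl6; h] 5 then true else h \in agl15_seq)
    (candidates [::] [:: 0; 1; 2; 3; 4] [:: 5]) by compute_seq.
have [[h hC [Ph hn]]|good] := pc_dec_seq cP (candidates [::] [:: 0; 1; 2; 3; 4] [:: 5]) (mem agl15_seq).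
  have := allP chk2 _ hC; case: ifP => [w' _|_ /(elimN idP hn)//].
  by left; apply: (reaches_ind cP (Pgens3 Pc Pd Ph) w').
by right; split=> // s Ps; apply: good (agl_candidate Ps) Ps.
Qed.

End Degree6.

(** Labels 0 to 4 form the 5-cycle, 5 and 6 are the other two points, 7 lies outside the action.
    Triple transitivity provides [u] and [g]; all 24 * 24 possibilities produce a 3-cycle. *)
Lemma degree7_3cycle P u g : perm_closed 8 P -> P [:: 1; 2; 3; 4; 0; 5; 6; 7] -> P u -> P g ->
    [/\ nth 0 u 0 = 0, nth 0 u 5 = 6, nth 0 u 6 = 5 & nth 0 u 7 = 7] ->
    [/\ nth 0 g 0 = 5, nth 0 g 5 = 0, nth 0 g 6 = 6 & nth 0 g 7 = 7] ->
  has_word P (is_cycle_power 3 4).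
Proof.
move=> cP Pc Pu Pg [u0 u5 u6 u7] [g0 g5 g6 g7].
have uC : u \in candidates [:: 0] [:: 1; 2; 3; 4] [:: 6; 5; 7].
  by apply: (perm_candidate cP Pu); [vm_compute | case=> [_|//] | case=> [_|[_|[_|//]]]].
have gC : g \in candidates [:: 5] [:: 1; 2; 3; 4] [:: 0; 6; 7].
  by apply: (perm_candidate cP Pg); [vm_compute | case=> [_|//] | case=> [_|[_|[_|//]]]].
have chk : all (fun u => all (fun g => reaches (is_cycle_power 3 4)
       [:: [:: 1; 2; 3; 4; 0; 5; 6; 7]; u; g] 5)
    (candidates [:: 5] [:: 1; 2; 3; 4] [:: 0; 6; 7]))
    (candidates [:: 0] [:: 1; 2; 3; 4] [:: 6; 5; 7]) by compute_seq.
apply: (reaches_ind cP _ (allP (allP chk _ uC) _ gC)) => x.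
by rewrite !inE => /or3P[/eqP->|/eqP->|/eqP->].
Qed.

Section Degree9.
Variables (P : seq nat -> Prop) (cP : perm_closed 10 P).
Hypotheses (Pw : P scal10) (fix9 : forall s, P s -> nth 0 s 9 = 9).
Let T5 := has_orbit 5.

Let Pgens2 x y : P x -> P y -> forall g, g \in [:: x; y] -> P g.
Proof. by move=> Px Py g; rewrite !inE => /orP[/eqP->|/eqP->]. Qed.

Let Pgens3 x y z : P x -> P y -> P z -> forall g, g \in [:: x; y; z] -> P g.
Proof. by move=> Px Py Pz g; rewrite !inE => /or3P[/eqP->|/eqP->|/eqP->]. Qed.

(** The element [g] imitates [x + 1], which exchanges 0 and 1 and fixes infinity. The third outcome
    is unavoidable: [swap10] commutes with [scal10] and [inv10], so these two also lie in the
    conjugate of PSL(2,8) by it. The orders 504 of PSL(2,8) and 1512 of PGammaL(2,8) are prime to 5,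
    so a cycle of length 5 shows that the group is larger. *)
Lemma degree9_generators g : P inv10 -> P g ->
    nth 0 g 0 = 1 -> nth 0 g 1 = 0 -> nth 0 g 8 = 8 ->
  [\/ has_word P T5, P trans10 | P (relabel10 trans10)].
Proof.
move=> Pi Pg g0 g1 g8; have g9 := fix9 Pg.
have gC : g \in candidates [:: 1; 0] [:: 2; 3; 4; 5; 6; 7] [:: 8; 9].
  by apply: (perm_candidate cP Pg); [vm_compute | case=> [_|[_|//]] | case=> [_|[_|//]]].
(* The deeper search for a 5-cycle comes last, since the number of words triples at each level. *)
have chk : all (fun g => if reaches T5 [:: scal10; inv10; g] 6 then true else
      if reaches (pred1 trans10) [:: scal10; inv10; g] 4 then true else
      if reaches (pred1 (relabel10 trans10)) [:: scal10; inv10; g] 6 then true else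
      reaches T5 [:: scal10; inv10; g] 8)
    (candidates [:: 1; 0] [:: 2; 3; 4; 5; 6; 7] [:: 8; 9]) by compute_seq.
have := allP chk _ gC; case: ifP => [w _|_].
  by constructor 1; apply: (reaches_ind cP (Pgens3 Pw Pi Pg) w).
case: ifP => [w _|_].
  by constructor 2; apply: (reaches_eq cP (Pgens3 Pw Pi Pg) w).
case: ifP => [w _|_ w].
  by constructor 3; apply: (reaches_eq cP (Pgens3 Pw Pi Pg) w).
by constructor 1; apply: (reaches_ind cP (Pgens3 Pw Pi Pg) w).
Qed.

(** In PGammaL(2,8) the stabiliser of 0, 1 and infinity is generated by the Frobenius map, of order
    3; any other [h] leads to order 5. *)
Lemma degree9_stab h : P trans10 -> P inv10 -> P h ->
    nth 0 h 0 = 0 -> nth 0 h 1 = 1 -> nth 0 h 8 = 8 ->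
  [\/ has_word P T5, h = iota 0 10 | P frob10 /\ h \in [:: frob10; comp_seq frob10 frob10]].
Proof.
move=> Pt Pi Ph h0 h1 h8; have h9 := fix9 Ph.
have hC : h \in candidates [:: 0; 1] [:: 2; 3; 4; 5; 6; 7] [:: 8; 9].
  by apply: (perm_candidate cP Ph); [vm_compute | case=> [_|[_|//]] | case=> [_|[_|//]]].
have chk : all (fun h => if h == iota 0 10 then true else
     if h \in [:: frob10; comp_seq frob10 frob10] then reaches (pred1 frob10) [:: h; h] 2
     else reaches T5 [:: scal10; trans10; inv10; h] 5)
   (candidates [:: 0; 1] [:: 2; 3; 4; 5; 6; 7] [:: 8; 9]) by compute_seq.
have Pgens4 x : x \in [:: scal10; trans10; inv10; h] -> P x.
  by rewrite !inE => /or4P[] /eqP->.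
have := allP chk _ hC; case: ifP => [/eqP-> _|_]; first by constructor 2.
case: ifP => [hf w|_ w].
  by constructor 3; split=> //; apply: (reaches_eq cP (Pgens2 Ph Ph) w).
by constructor 1; apply: (reaches_ind cP Pgens4 w).
Qed.

End Degree9.

Transparent reaches is_cycle_power has_orbit generated_seq permutations.

Local Open Scope group_scope.

(** * Jordan's theorem *)

Section PointwiseStabiliser.
Variable T : finType.
Implicit Types (G H K : {group {perm T}}) (X Y D : {set T}) (g h c s : {perm T}).

Lemma astabCP Y g : reflect (forall x, x \notin Y -> g x = x) (g \in 'C(~: Y | 'P)).
Proof.
apply: (iffP idP) => [/astabP gY x nYx | gY]; first by apply: gY; rewrite inE.
by apply/astabP => x; rewrite inE; apply: gY.
Qed.

Lemma astabC_sub Y X : Y \subset X -> 'C(~: Y | 'P) \subset 'C(~: X | 'P).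
Proof. by move=> sYX; apply: astabS; rewrite setCS. Qed.

Lemma astabC_mem Y g x : g \in 'C(~: Y | 'P) -> (g x \in Y) = (x \in Y).
Proof.
move=> Cg; have : g \in 'N(Y | 'P) by rewrite -astabsC (subsetP (astab_sub _ _)).
by move/astabs_act; apply.
Qed.

Lemma astabC_imset Y g : g \in 'C(~: Y | 'P) -> g @: Y = Y.
Proof.
move=> Cg; apply/setP => x; rewrite -[x](permKV g) (mem_imset _ _ (@perm_inj _ g)).
by rewrite (astabC_mem _ Cg).
Qed.

Lemma astabCJ Y g h : h \in 'C(~: Y | 'P) -> h ^ g \in 'C(~: (g @: Y) | 'P).
Proof.
move=> Ch; apply/astabCP => x; rewrite -[x](permKV g) => nYx.
rewrite permJ (astabCP _ _ Ch) //; apply: contra nYx => Yx.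
exact: imset_f.
Qed.

Lemma astabC_atransI Y G x : G \subset 'C(~: Y | 'P) -> x \in Y ->
  (forall y, y \in Y -> exists2 g, g \in G & g x = y) -> [transitive G, on Y | 'P].
Proof.
move=> sGY Yx trG; apply/imsetP; exists x => //; apply/setP => y; apply/idP/imsetP.
  by case/trG => g Gg <-; exists g.
by case=> g Gg ->; rewrite astabC_mem // (subsetP sGY).
Qed.

Lemma imsetM g h D : (g * h) @: D = h @: (g @: D).
Proof. by rewrite -imset_comp; apply: eq_imset => x /=; rewrite permM. Qed.

Lemma imset_permK g D : g^-1 @: (g @: D) = D.
Proof. by rewrite -imsetM mulgV imset_perm1. Qed.

Lemma imset_permKV g D : g @: (g^-1 @: D) = D.
Proof. by rewrite -imsetM mulVg imset_perm1. Qed.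

Lemma card_imset_perm g D : #|g @: D| = #|D|.
Proof. by rewrite card_imset //; apply: perm_inj. Qed.

Lemma imset_permD g D Y : g @: (D :\: Y) = g @: D :\: g @: Y.
Proof.
apply/setP => x; rewrite -[x](permKV g) inE !(mem_imset _ _ (@perm_inj _ g)).
by rewrite inE.
Qed.

(* [D] is not a block of imprimitivity, as witnessed by [g]. *)
Definition moves_across (g : {perm T}) (D : {set T}) :=
  (g @: D != D) && ~~ [disjoint g @: D & D].

(** Primitivity, with transitivity left out. *)
Definition blockless (H : {set {perm T}}) (Y : {set T}) :=
  forall D, D \subset Y -> 1 < #|D| -> D != Y -> exists2 h, h \in H & moves_across h D.

(** Double transitivity gives primitivity: some element fixes a point [d1] of [D] and takes another
    point [d2] of [D] to a point [e] outside. It is a conjugate of an element of the stabiliser of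
    [x]. *)
Lemma blockless2 H K Y x : K \subset H -> [transitive H, on Y | 'P] ->
  x \in Y -> [transitive K, on Y :\ x | 'P] -> K \subset 'C[x | 'P] -> blockless H Y.
Proof.
move=> sKH trH Yx trK Kx D sDY /card_gt1P[d1 [d2 [Dd1 Dd2 d12]]] nDY.
have [e Ye nDe] : exists2 e, e \in Y & e \notin D.
  by apply/subsetPn; apply: contra nDY => sYD; rewrite eqEsubset sDY.
have Yd1 := subsetP sDY _ Dd1; have Yd2 := subsetP sDY _ Dd2.
have [k Hk Ek] := atransP2 trH Yd1 Yx.
have actH := actsP (atrans_acts trH).
have inYx y : y \in Y -> y != d1 -> aperm y k \in Y :\ x.
  move=> Yy yd1; rewrite !inE (actH _ Hk) Yy andbT Ek /aperm.
  by rewrite (inj_eq perm_inj).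
have [|| l Kl El] := atransP2 trK (x := aperm d2 k) (y := aperm e k).
- by apply: inYx; rewrite // eq_sym.
- by apply: inYx; rewrite //; apply: contraNneq nDe => ->.
have lx : l x = x by have /astab1P := subsetP Kx _ Kl.
exists (k * l * k^-1); first by rewrite !groupM ?groupV // (subsetP sKH).
have f1 : (k * l * k^-1) d1 = d1.
  by rewrite !permM -[k d1]/(aperm d1 k) -Ek lx Ek /aperm permK.
have f2 : (k * l * k^-1) d2 = e.
  by rewrite !permM -[l _]/(aperm (aperm d2 k) l) -El /aperm permK.
apply/andP; split.
  apply: contraNneq nDe => <-; rewrite -f2; exact: imset_f.
by apply/pred0Pn; exists d1; rewrite /= Dd1 andbT -{1}f1; apply: imset_f.
Qed.

(** Choose [g] moving [Y] across itself with the fewest points in [Y] outside the image. If there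
    were two such points, primitivity of the pointwise stabiliser would give a [g] with fewer. So
    the image of [Y] is [Y] with one point replaced by some [x], and [x] can be adjoined to [Y]. *)
Lemma jordan_step G X Y : G \subset 'C(~: X | 'P) -> Y \subset X -> 1 < #|Y| ->
    (exists2 g, g \in G & moves_across g Y) ->
    [transitive 'C_G(~: Y | 'P), on Y | 'P] -> blockless 'C_G(~: Y | 'P) Y ->
  exists2 x, x \in X :\: Y & [transitive 'C_G(~: (x |: Y) | 'P), on x |: Y | 'P].
Proof.
move=> sGX sYX Y1 [g0 Gg0 mg0] trK blK; set K := 'C_G(~: Y | 'P).
have P0 : (g0 \in G) && moves_across g0 Y by rewrite Gg0.
case: (@arg_minnP _ g0 (fun g => (g \in G) && moves_across g Y)
        (fun g => #|Y :\: g @: Y|) P0) => g /andP[Gg /andP[gY meet]] gmin.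
set D := Y :\: g @: Y in gmin.
have Kact h : h \in K -> h @: Y = Y by case/setIP=> _; apply: astabC_imset.
have D0 : D != set0.
  apply: contra gY; rewrite setD_eq0 => sYg.
  by rewrite eq_sym eqEcard sYg card_imset_perm leqnn.
have sDY : D \subset Y by apply: subsetDl.
have nDY : D != Y.
  by apply: contra meet => /eqP/setDidPl; rewrite disjoint_sym.
have D1 : #|D| = 1%N.
  apply/eqP; rewrite eqn_leq card_gt0 D0 andbT leqNgt; apply/negP => D1.
  have [h Kh /andP[hD mh]] := blK D sDY D1 nDY.
  have [Gh Ch] := setIP Kh.
  (* A point of the left side lies in [Y], since [h] fixes all others; its preimage under [h] is
     then in [D], while it is not itself in [D]. *)
  have lt : #|g @: Y :\: h @: (g @: Y)| < #|D|.
    apply: leq_ltn_trans (_ : #|h @: D :\: D| < _).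
      apply: subset_leq_card; apply/subsetP => x /setDP[gYx nhx].
      have Yx : x \in Y.
        apply: contraR nhx => nYx; rewrite -(astabCP _ _ Ch x nYx).
        exact: imset_f.
      rewrite !inE gYx Yx /= -[x](permKV h) (mem_imset _ _ (@perm_inj _ h)) !inE.
      rewrite -(astabC_mem _ Ch) permKV Yx andbT.
      by apply: contra nhx => ?; rewrite -[x](permKV h) imset_f.
    rewrite -(card_imset_perm h D); apply: proper_card; rewrite properEneq subsetDl.
    by rewrite andbT; apply: contra mh => /eqP/setDidPl.
  (* Pulling the pair of [g @: Y] and its image under [h] back by [g] compares [Y] itself with a
     translate. *)
  pose g' := g * h * g^-1.
  have c' : #|Y :\: g' @: Y| = #|g @: Y :\: h @: (g @: Y)|.
    rewrite -(card_imset_perm g) imset_permD.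
    by rewrite /g' !imsetM imset_permKV.
  have /gmin : (g' \in G) && moves_across g' Y.
    rewrite !groupM ?groupV //=; apply/andP; split.
      apply: contra hD; rewrite /g' !imsetM => /eqP/(congr1 (fun A : {set T} => g @: A)).
      rewrite imset_permKV => E; rewrite /D imset_permD.
      by rewrite E Kact.
    apply: contraL lt; rewrite disjoint_sym => /setDidPl E.
    by rewrite -leqNgt -c' E subset_leq_card.
  by rewrite c' leqNgt lt.
have E1 : #|g @: Y :\: Y| = 1%N.
  have := cardsID Y (g @: Y); have := cardsID (g @: Y) Y.
  rewrite card_imset_perm setIC -/D D1 => <- /eqP.
  by rewrite eqn_add2l => /eqP.
have /cards1P[x Ex] : #|g @: Y :\: Y| == 1%N by rewrite E1.
have /setDP[gYx nYx] : x \in g @: Y :\: Y by rewrite Ex set11.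
have Xx : x \in X.
  case/imsetP: gYx => y Yy ->; rewrite astabC_mem ?(subsetP sYX) //.
  exact: (subsetP sGX).
exists x; first by rewrite !inE nYx.
have sgY : g @: Y \subset x |: Y by rewrite setUC -subDset Ex sub1set set11.
have [e /andP[/= gYe Ye]] := pred0Pn meet.
(* The conjugate by [g] of the pointwise stabiliser is transitive on [g @: Y], which contains [x]
   and also a point [e] of [Y]. *)
have xorb : exists2 l, l \in 'C_G(~: (x |: Y) | 'P) & l x = e.
  case/imsetP: gYx gYe => y Yy Exy /imsetP[z Yz ->].
  have [k Kk Ek] := atransP2 trK Yy Yz.
  have [Gk Ck] := setIP Kk.
  exists (k ^ g); last by rewrite Exy permJ Ek.
  by apply/setIP; split; [exact: groupJ | apply: (subsetP (astabC_sub sgY)); exact: astabCJ].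
apply: (@astabC_atransI _ _ e); first exact: subsetIr.
  by rewrite !inE Ye orbT.
move=> y /setU1P[->|Yy].
  have [l Ll <-] := xorb; exists l^-1; first by rewrite groupV.
  by rewrite permK.
have [k /setIP[Gk Ck] ->] := atransP2 trK Ye Yy; exists k => //.
by apply/setIP; split=> //; apply: subsetP Ck; rewrite astabC_sub ?subsetUr.
Qed.

(** Adjoin points one at a time until [Y] becomes [X]. The old pointwise stabiliser is the
    stabiliser of the new point in the new one, so each step raises the degree of transitivity by
    one and preserves primitivity. *)
Lemma jordan_chain G X Y t : G \subset 'C(~: X | 'P) -> Y \subset X -> 1 < #|Y| ->
    (forall Z : {set T}, Y \subset Z -> Z \proper X -> exists2 g, g \in G & moves_across g Z) ->
    blockless 'C_G(~: Y | 'P) Y -> [transitive 'C_G(~: Y | 'P), on Y | 'P] ->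
    [transitive^t 'C_G(~: Y | 'P), on Y | 'P] ->
  [transitive^(#|X :\: Y| + t) G, on X | 'P].
Proof.
move=> sGX; elim: {Y}_.+1 {-2}Y t (ltnSn #|X :\: Y|) => // n IHn Y t lt sYX Y1 nb bl tr trt.
have [eXY|nXY] := eqVneq Y X.
  rewrite eXY setDv cards0 add0n; rewrite eXY in trt.
  by have <- : 'C_G(~: X | 'P) = G by apply/setIidPl.
have pYX : Y \proper X by rewrite properEneq nXY.
have [x XYx trx] := jordan_step sGX sYX Y1 (nb Y (subxx _) pYX) tr bl.
have [Xx nYx] := setDP XYx.
have Yx : x \in x |: Y by rewrite setU11.
have YxD : (x |: Y) :\ x = Y by rewrite setU1K.
have sK : 'C_G(~: Y | 'P) \subset 'C_G(~: (x |: Y) | 'P).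
  by rewrite setIS // astabC_sub // subsetUr.
have fx : 'C_G(~: Y | 'P) \subset 'C[x | 'P].
  by rewrite subIset // orbC astabS // sub1set inE.
have cx : #|X :\: Y| = #|X :\: (x |: Y)|.+1.
  rewrite (cardsD1 x) XYx add1n; congr (#|pred_of_set _|.+1).
  by apply/setP => y; rewrite !inE negb_or andbA.
rewrite cx addSn -addnS; apply: IHn.
- by rewrite -cx.
- by rewrite subUset sub1set Xx.
- by rewrite cardsU1 nYx add1n ltnS ltnW.
- by move=> Z sZ; apply: nb; apply: subset_trans sZ; apply: subsetUr.
- by apply: (blockless2 sK trx Yx) => //; rewrite YxD.
- exact: trx.
apply: (stab_ntransitiveI Yx trx); rewrite YxD.
suff -> : 'C_('C_G(~: (x |: Y) | 'P))[x | 'P] = 'C_G(~: Y | 'P) by [].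
apply/eqP; rewrite eqEsubset [X in _ && X]subsetI sK fx andbT -setIA setIS //.
rewrite -astabU astabS //; apply/subsetP => y; rewrite !inE.
by case: eqP => //= _; rewrite orbF.
Qed.

End PointwiseStabiliser.

Section Jordan.
Variable T : finType.
Implicit Types (G H K : {group {perm T}}) (X Y D : {set T}) (g h c s : {perm T}).

(** Induction on the number of moved points. An even [s] taking [x] to [y != x] is not a
    transposition, so it moves a third point [z]; a 3-cycle on these points sends [y] back to [x]
    and moves no point fixed by [s]. *)
Lemma even_perm_mem G X :
    (forall x y z, x \in X -> y \in X -> z \in X -> uniq [:: x; y; z] ->
      tperm x y * tperm y z \in G) ->
  forall s, s \in 'C(~: X | 'P) -> ~~ odd_perm s -> s \in G.
Proof.
move=> G3 s; elim: {s}_.+1 {-2}s (ltnSn #|[set x | s x != x]|) => // n IHn s lt sX even_s.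
have [->|/eqP/permP s1] := eqVneq s 1; first exact: group1.
have [x sx] : exists x, s x != x.
  apply/existsP/contraT => /existsPn s1'; case: s1 => x.
  by apply/eqP; rewrite perm1 -[_ == _]negbK s1'.
set y := s x in sx.
have sy : s y != y by rewrite (inj_eq perm_inj).
have [z /and3P[sz zx zy]] : exists z, [&& s z != z, z != x & z != y].
  apply/existsP/contraT => /existsPn fixs; case/negP: even_s.
  suff -> : s = tperm x y by rewrite odd_tperm eq_sym.
  have fs z : z != x -> z != y -> s z = z.
    by move=> zx zy; apply/eqP; move: (fixs z); rewrite zx zy !andbT negbK.
  have s_y : s y = x.
    have [//|syx] := eqVneq (s y) x.
    by have /perm_inj E := fs _ syx sy; rewrite E eqxx in sy.
  apply/permP => z; case: tpermP => [->|->|/eqP zx /eqP zy]; [by []|by []|].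
  exact: fs.
have inX u : s u != u -> u \in X by apply: contraR => nXu; rewrite (astabCP _ _ sX).
pose c := tperm z x * tperm x y.
have Gc : c \in G.
  apply: G3; [exact: inX | exact: inX | exact: inX |].
  by rewrite /= !inE negb_or zx zy eq_sym sx.
have cE u : u != x -> u != y -> u != z -> c u = u.
  by move=> ux uy uz; rewrite permM !tpermD //; rewrite eq_sym.
have cy : c y = x by rewrite permM (tpermD zy) ?tpermR // eq_sym.
rewrite -[s](mulgK c) groupMr ?groupV //; apply: IHn.
- rewrite -ltnS; apply: leq_trans lt; rewrite ltnS; apply: proper_card; apply/properP; split.
    apply/subsetP => u; rewrite !inE permM; apply: contra => /eqP su.
    rewrite su cE //; apply: contraNneq sx => ux.
    + by rewrite /y -ux su.
    + by move: sy; rewrite -ux su eqxx.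
    + by move: sz; rewrite -ux su eqxx.
  by exists x; rewrite !inE ?sx // negbK permM -/y cy.
- apply: groupM => //; apply/astabCP => u nXu; apply: cE; apply: contraNneq nXu => ->; exact: inX.
- by rewrite odd_permM (negPf even_s) odd_permM !odd_tperm zx (eq_sym x) sx.
Qed.

Lemma prime_cycle_atrans Y c : prime #|Y| -> c \in 'C(~: Y | 'P) -> #[c] = #|Y| ->
  [transitive <[c]>, on Y | 'P].
Proof.
move=> pY cY oc.
have c1 : c != 1 by rewrite -order_eq1 oc neq_ltn prime_gt1 ?orbT.
have [y cy] : exists y, c y != y.
  apply/existsP; apply: contraR c1 => /existsPn c1.
  by apply/eqP/permP => x; rewrite perm1; apply/eqP; rewrite -[_ == _]negbK c1.
have Yy : y \in Y by apply: contraR cy => nYy; rewrite (astabCP _ _ cY).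
have scY : <[c]> \subset 'C(~: Y | 'P) by rewrite cycle_subG.
have sOY : orbit 'P <[c]> y \subset Y.
  by apply/subsetP => x /imsetP[g cg ->]; rewrite astabC_mem // (subsetP scY).
apply/imsetP; exists y => //; apply/esym/eqP; rewrite eqEcard sOY /=.
have := dvdn_orbit 'P <[c]> y; rewrite -orderE oc; case/primeP: pY => _ /[apply].
case/orP => [/eqP/card_orbit1/setP/(_ (c y))|/eqP-> //].
by rewrite inE (negPf cy) (mem_orbit 'P) ?cycle_id.
Qed.

(** A power of [c] that preserves [D] and moves a point of [D] generates the whole cyclic group, so
    [D] contains the orbit of that point, which is [Y]. *)
Lemma prime_cycle_blockless Y c : prime #|Y| -> c \in 'C(~: Y | 'P) -> #[c] = #|Y| ->
  blockless <[c]> Y.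
Proof.
move=> pY cY oc D sDY /card_gt1P[d1 [d2 [Dd1 Dd2 d12]]] nDY.
have trc := prime_cycle_atrans pY cY oc.
have [h ch Eh] := atransP2 trc (subsetP sDY _ Dd1) (subsetP sDY _ Dd2).
exists h => //; apply/andP; split; last first.
  by apply/pred0Pn; exists d2; rewrite /= Dd2 andbT Eh; apply: imset_f.
apply: contra nDY => /eqP hD; rewrite eqEsubset sDY /=.
have h1 : h != 1 by apply: contraNneq d12 => h1; rewrite Eh h1 act1.
have -> : Y = orbit 'P <[h]> d1.
  suff -> : <[h]> = <[c]> by rewrite (atransP trc) ?(subsetP sDY).
  apply/eqP; rewrite eqEcard cycle_subG ch /= -!orderE.
  have := order_dvdG ch; rewrite -orderE oc; case/primeP: pY => _ /[apply].
  by rewrite order_eq1 (negPf h1) => /eqP->.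
apply/subsetP => x /imsetP[_ /cycleP[i ->] ->]; rewrite /= /aperm.
elim: i => [|i IHi]; first by rewrite perm1.
by rewrite expgSr permM -hD imset_f.
Qed.

Lemma prime_cycle_ntransitive G X Y c : G \subset 'C(~: X | 'P) -> Y \subset X ->
    prime #|Y| -> c \in 'C_G(~: Y | 'P) -> #[c] = #|Y| ->
    (forall Z : {set T}, Y \subset Z -> Z \proper X -> exists2 g, g \in G & moves_across g Z) ->
  [transitive^(#|X :\: Y|.+1) G, on X | 'P].
Proof.
move=> sGX sYX pY Kc oc nb; have [Gc cY] := setIP Kc.
have trc := prime_cycle_atrans pY cY oc.
have sK : <[c]> \subset 'C_G(~: Y | 'P) by rewrite cycle_subG.
have trK : [transitive 'C_G(~: Y | 'P), on Y | 'P].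
  have [y Yy _] := imsetP trc; apply: (@astabC_atransI _ _ _ y) => //; first exact: subsetIr.
  move=> z Yz; have [g cg ->] := atransP2 trc Yy Yz.
  by exists g => //; apply: (subsetP sK).
rewrite -addn1; apply: jordan_chain => //; first exact: prime_gt1.
  move=> D sDY D1 nDY; have [h ch mh] := prime_cycle_blockless pY cY oc sDY D1 nDY.
  by exists h => //; apply: (subsetP sK).
have [y Yy _] := imsetP trK; apply: stab_ntransitiveI Yy trK _.
exact: ntransitive0.
Qed.

Lemma ntransitive2_blockless G X : [transitive^2 G, on X | 'P] -> blockless G X.
Proof.
move=> tr2; have tr1 := ntransitive1 (ltn0Sn _) tr2; have [x Xx _] := imsetP tr1.
apply: (blockless2 (K := 'C_G[x | 'P]%G) _ tr1 Xx); rewrite ?subsetIl ?subsetIr //.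
exact: (ntransitive1 (ltn0Sn 0) (stab_ntransitive (ltn0Sn 0) Xx tr2)).
Qed.

Lemma dtuple_enum X : enum_tuple (mem X) \in #|X|.-dtuple(X).
Proof.
by rewrite inE enum_uniq; apply/subsetP => x; rewrite mem_enum.
Qed.

(* The [#|Y|]-fold transitivity is used on an enumeration of [Y], so the
   prescribed map is realised on the whole of [Y] at once. *)
Lemma ntransitive_perm G X Y h : [transitive^(#|Y|) G, on X | 'P] -> Y \subset X ->
  h \in 'C(~: X | 'P) -> exists2 g, g \in G & forall x, x \in Y -> g x = h x.
Proof.
move=> tr sYX hX.
have d1 : enum_tuple (mem Y) \in #|Y|.-dtuple(X) by apply: dtuple_on_subset (dtuple_enum Y).
have d2 : n_act 'P (enum_tuple (mem Y)) h \in #|Y|.-dtuple(X).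
  apply: n_act_dtuple d1; rewrite -astabsC; exact: subsetP (astab_sub _ _) _ hX.
have [g Gg /(congr1 val)/= E] := atransP2 tr d1 d2; exists g => // x Yx.
by have /eq_in_map/(_ x) := E; rewrite mem_enum Yx => /(_ isT).
Qed.

(** The left factor acts first, so [tperm x y * tperm y z] sends [x] to [z]; hence the inverse. *)
Lemma card3_cycle d (x y z : T) : uniq [:: x; y; z] -> d \in 'C(~: [set x; y; z] | 'P) ->
  d x = y -> d z != z -> d^-1 = tperm x y * tperm y z.
Proof.
move=> U dC dx dz; move: U; rewrite /= !inE negb_or andbT => /andP[/andP[xy xz] yz].
have dz' : d z = x.
  have := astabC_mem z dC; rewrite !inE eqxx !orbT => /orP[/orP[/eqP-> //|/eqP E]|E].
    by move: xz; rewrite -(inj_eq (@perm_inj _ d)) dx E eqxx.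
  by rewrite E in dz.
have dy : d y = z.
  have := astabC_mem y dC; rewrite !inE eqxx !orbT => /orP[/orP[/eqP E|/eqP E]|/eqP //].
    by move: yz; rewrite -(inj_eq (@perm_inj _ d)) dz' E eqxx.
  by move: xy; rewrite -(inj_eq (@perm_inj _ d)) dx E eqxx.
apply: (mulgI d); rewrite mulgV; apply/permP => u; rewrite perm1 !permM.
have [->|ux] := eqVneq u x; first by rewrite dx tpermR tpermD //; rewrite eq_sym.
have [->|uy] := eqVneq u y; first by rewrite dy (tpermD xz yz) tpermR.
have [->|uz] := eqVneq u z; first by rewrite dz' tpermL tpermL.
by rewrite (astabCP _ _ dC) ?inE ?negb_or ?ux ?uy ?uz // !tpermD //; rewrite eq_sym.
Qed.

(** The transitivity carries the complement of [Y] onto that of any three-point set [S], hence [Y]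
    onto [S]. The conjugate of [c] is then one of the two 3-cycles on [S], and a group contains both
    with either. *)
Lemma jordan_3cycle G X Y c : G \subset 'C(~: X | 'P) -> Y \subset X ->
    #|Y| = 3 -> c \in 'C_G(~: Y | 'P) -> #[c] = 3 ->
    (forall Z : {set T}, Y \subset Z -> Z \proper X -> exists2 g, g \in G & moves_across g Z) ->
  forall s, s \in 'C(~: X | 'P) -> ~~ odd_perm s -> s \in G.
Proof.
move=> sGX sYX Y3 Kc oc nb; apply: even_perm_mem => x y z Xx Xy Xz Uxyz.
have [Gc cY] := setIP Kc; have pY : prime #|Y| by rewrite Y3.
have oc' : #[c] = #|Y| by rewrite oc.
have trG := prime_cycle_ntransitive sGX sYX pY Kc oc' nb.
have trc := prime_cycle_atrans pY cY oc'.
set S := [set x; y; z].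
have S3 : #|S| = 3.
  move: Uxyz; rewrite /= !inE negb_or andbT => /andP[/andP[xy xz] yz].
  by rewrite /S setUC cardsU1 !inE negb_or (eq_sym z) xz (eq_sym z) yz cards2 xy.
have sSX : S \subset X by rewrite !subUset !sub1set Xx Xy Xz.
have cX : #|X :\: S| = #|X :\: Y|.
  by rewrite !cardsD (setIidPr sSX) (setIidPr sYX) S3 Y3.
have [g Gg gS] : exists2 g, g \in G & g @: Y = S.
  have tr0 : [transitive^(#|X :\: Y|) G, on X | 'P] by apply: ntransitive_weak trG.
  have d1 : enum_tuple (mem (X :\: Y)) \in #|X :\: Y|.-dtuple(X).
    exact: dtuple_on_subset (subsetDl _ _) (dtuple_enum _).
  have d2 : tcast cX (enum_tuple (mem (X :\: S))) \in #|X :\: Y|.-dtuple(X).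
    rewrite inE val_tcast enum_uniq; rewrite memtE val_tcast.
    by apply/subsetP => u; rewrite mem_enum => /setDP[].
  have [g Gg E0] := atransP2 tr0 d1 d2.
  have E : enum (mem (X :\: S)) = map g (enum (mem (X :\: Y))).
    by rewrite -[LHS](val_tcast cX (enum_tuple _)) E0.
  exists g => //; apply/eqP; rewrite eqEcard card_imset_perm Y3 S3 leqnn andbT.
  apply/subsetP => _ /imsetP[u Yu ->]; apply: contraT => nSu.
  have : g u \in enum (mem (X :\: S)).
    by rewrite mem_enum inE nSu /= (astabC_mem _ (subsetP sGX _ Gg)) (subsetP sYX).
  rewrite E => /mapP[v]; rewrite mem_enum => /setDP[_ nYv] /perm_inj Euv.
  by rewrite -Euv Yu in nYv.
have nfix u : u \in Y -> c u != u.
  move=> Yu; apply/eqP => cu.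
  have /eqP := atransP trc u Yu; rewrite eqEcard => /andP[_].
  suff -> : orbit 'P <[c]> u = [set u] by rewrite cards1 Y3.
  by apply/orbit1P; rewrite afix_cycle; apply/afix1P.
have Gd : c ^ g \in G by rewrite groupJ.
have dC : c ^ g \in 'C(~: S | 'P) by rewrite -gS astabCJ.
have nfix' u : u \in S -> (c ^ g) u != u.
  by rewrite -gS => /imsetP[v Yv ->]; rewrite permJ (inj_eq perm_inj) nfix.
have [Sx Sy Sz] : [/\ x \in S, y \in S & z \in S] by rewrite !inE !eqxx ?orbT.
have [xy|xy] := eqVneq ((c ^ g) x) y.
  by rewrite -(card3_cycle Uxyz dC xy (nfix' z Sz)) groupV.
rewrite -(card3_cycle (d := (c ^ g)^-1) Uxyz) ?groupV //.
- have dx : (c ^ g) x = z.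
    have := astabC_mem x dC; rewrite Sx /S !inE -orbA (negPf (nfix' x Sx)) (negPf xy).
    by move=> /eqP.
  have dy : (c ^ g) y = x.
    have := astabC_mem y dC; rewrite Sy /S !inE -orbA (negPf (nfix' y Sy)) /= => /orP[/eqP //|].
    move: Uxyz; rewrite /= !inE negb_or => /andP[/andP[xy' _] _].
    by rewrite -dx (inj_eq perm_inj) eq_sym (negPf xy').
  by rewrite -dy permK.
- by rewrite -(inj_eq (@perm_inj _ (c ^ g))) permKV eq_sym nfix'.
Qed.

(** An element commuting with a transitive cycle acts on it as one of its powers. *)
Lemma commute_cycle_expg Y c w : prime #|Y| -> c \in 'C(~: Y | 'P) -> #[c] = #|Y| ->
  commute c w -> forall y, y \in Y -> (w ^+ #|Y|) y = y.
Proof.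
move=> pY cY oc cw y Yy; have trc := prime_cycle_atrans pY cY oc.
have nfix u : u \in Y -> c u != u.
  move=> Yu; apply/eqP => cu.
  have /eqP := atransP trc u Yu; rewrite eqEcard => /andP[_].
  suff -> : orbit 'P <[c]> u = [set u] by rewrite cards1 leqNgt prime_gt1.
  by apply/orbit1P; rewrite afix_cycle; apply/afix1P.
have Ywy : w y \in Y.
  apply: contraR (nfix y Yy) => nY.
  by rewrite -(inj_eq (@perm_inj _ w)) -permM cw permM (astabCP _ _ cY).
have [_ /cycleP[i ->] Ei] := atransP2 trc Yy Ywy.
have Ej j : (w ^+ j) y = (c ^+ (i * j)) y.
  elim: j => [|j IHj]; first by rewrite muln0 !expg0.
  rewrite expgSr permM IHj -permM -(commuteX (i * j) (commute_sym cw)).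
  by rewrite permM Ei /aperm -permM -expgD mulnS.
by rewrite Ej -oc mulnC expgM expg_order expg1n perm1.
Qed.

(* Witt: [<[c]>] is a Sylow subgroup of the pointwise stabiliser of [X :\: Y]. *)
Lemma prime_cycle_normaliser G X Y c h : G \subset 'C(~: X | 'P) -> Y \subset X ->
    prime #|Y| -> c \in 'C_G(~: Y | 'P) -> #[c] = #|Y| ->
    [transitive^(#|X :\: Y|) G, on X | 'P] -> h \in 'C(~: (X :\: Y) | 'P) ->
  exists2 u, u \in 'N_G(<[c]>) & forall x, x \in X :\: Y -> u x = h x.
Proof.
move=> sGX sYX pY Kc oc tr hF; have [Gc cY] := setIP Kc.
set F := X :\: Y in tr hF *; pose K := 'C_G(~: Y | 'P)%G.
have [g Gg gh] := ntransitive_perm tr (subsetDl _ _)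
  (subsetP (astabC_sub (subsetDl X Y)) _ hF).
have sylP (P : {group {perm T}}) : P \subset K -> #|P| = #|Y| -> #|Y|.-Sylow(K) P.
  move=> sPK oP; rewrite pHallE sPK oP p_part /=.
  suff -> : logn #|Y| #|K| = 1%N by rewrite expn1.
  apply/eqP; rewrite eqn_leq; apply/andP; split; last first.
    by rewrite -pfactor_dvdn ?cardG_gt0 // expn1 -oc order_dvdG.
  (* [K] consists of permutations of [Y], and [p!] has only one factor [p]: by Wilson's theorem [p]
     does not divide [(p - 1)!]. *)
  have : logn #|Y| #|K| <= logn #|Y| #|Y|`!.
    apply: dvdn_leq_log; rewrite ?fact_gt0 // -perm.card_Sym SymE cardSg //.
    exact: subsetIr.
  move/leq_trans; apply; rewrite -(prednK (prime_gt0 pY)) factS prednK ?prime_gt0 //.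
  rewrite lognM ?fact_gt0 ?prime_gt0 //.
  rewrite (logn_prime _ pY) eqxx.
  rewrite lognE pY fact_gt0 /=; case: ifP => // pF.
  have := Wilson (prime_gt1 pY); rewrite pY -addn1 dvdn_addr // dvdn1.
  by move=> /esym/eqP E; have := prime_gt1 pY; rewrite E.
(* On [F] the element [g] agrees with [h], which preserves [F]; so the conjugate still fixes [F]
   pointwise. *)
have gC u : u \notin Y -> (c ^ g) u = u.
  move=> nYu; rewrite -[u](permKV g) permJ; congr (g _).
  have [Xu|nXu] := boolP (u \in X); last first.
    by rewrite (astabCP _ _ (subsetP (astabC_sub sYX) _ cY)) // astabC_mem // groupV (subsetP sGX).
  have Fu : u \in F by rewrite inE nYu.
  have Fv : h^-1 u \in F by rewrite astabC_mem ?groupV.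
  have -> : g^-1 u = h^-1 u by rewrite -[in LHS](permKV h u) -gh // permK.
  by rewrite (astabCP _ _ cY) //; case/setDP: Fv.
have sPK : <[c]> \subset K by rewrite cycle_subG.
have sPgK : <[c]> :^ g \subset K.
  rewrite -cycleJ cycle_subG; apply/setIP; split; first exact: groupJ.
  exact/astabCP.
have sy : #|Y|.-Sylow(K) <[c]>%G by apply: sylP.
(* Sylow's theorem brings the conjugate back to [<[c]>] by an element that is trivial on [F], so the
   action on [F] is unchanged. *)
have [k Kk sPgk] := Sylow_Jsub (Q := (<[c]> :^ g)%G) sy sPgK
  (pHall_pgroup (sylP (<[c]> :^ g)%G sPgK (etrans (cardJg _ _) oc))).
have [Gk kY] := setIP Kk.
exists (g * k).
  apply/setIP; split; first exact: groupM.
  by apply/normP/eqP; rewrite conjsgM eqEcard sPgk !cardJg leqnn.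
move=> x Fx; rewrite permM gh // (astabCP _ _ kY) //.
by have /setDP[_] : h x \in F by rewrite (astabC_mem _ hF).
Qed.

(** Let [u] and [v] normalise [<[c]>] and act on [F] as two overlapping transpositions. Their
    commutator acts on [F] as a 3-cycle and centralises [c], because the automorphisms of a cyclic
    group commute. Its power [#|Y|] is trivial on [Y] and, as this prime is not 3, remains a 3-cycle
    on [F]. *)
Theorem jordan_prime_cycle G X Y c : G \subset 'C(~: X | 'P) -> Y \subset X ->
    prime #|Y| -> c \in 'C_G(~: Y | 'P) -> #[c] = #|Y| ->
    (forall Z : {set T}, Y \subset Z -> Z \proper X -> exists2 g, g \in G & moves_across g Z) ->
    (#|Y| == 3) || (#|Y| + 3 <= #|X|) ->
  forall s, s \in 'C(~: X | 'P) -> ~~ odd_perm s -> s \in G.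
Proof.
move=> sGX sYX pY Kc oc nb; have [Gc cY] := setIP Kc.
have [Y3 _|Y3 /=] := eqVneq #|Y| 3.
  by apply: (jordan_3cycle sGX sYX Y3 Kc _ nb); rewrite oc.
move=> leX; have trG := prime_cycle_ntransitive sGX sYX pY Kc oc nb.
set F := X :\: Y in trG.
have F3 : 2 < #|F| by rewrite /F cardsD (setIidPr sYX) ltn_subRL -addnS.
have /card_gt2P[x [y [z [[Fx Fy Fz] [xy yz zx]]]]] := F3.
have trF : [transitive^(#|F|) G, on X | 'P] by apply: ntransitive_weak trG.
have tpF u v : u \in F -> v \in F -> tperm u v \in 'C(~: F | 'P).
  by move=> Fu Fv; apply/astabCP => w; case: tpermP => // -> /negP.
have [u /setIP[Gu nu] uF] := prime_cycle_normaliser sGX sYX pY Kc oc trF (tpF _ _ Fx Fy).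
have [v /setIP[Gv nv] vF] := prime_cycle_normaliser sGX sYX pY Kc oc trF (tpF _ _ Fy Fz).
pose w := [~ u, v].
have Gw : w \in G by rewrite groupR.
have cw : commute c w.
  have comm_uv d : d \in <[c]> -> d ^ (u * v) = d ^ (v * u).
    have cu : c ^ u \in <[c]> by rewrite memJ_norm ?cycle_id.
    have cv : c ^ v \in <[c]> by rewrite memJ_norm ?cycle_id.
    case/cycleP: cu => i Eu; case/cycleP: cv => j Ev; case/cycleP => n ->.
    rewrite !conjgM !conjXg Eu Ev !conjXg Eu Ev -!expgM; congr (c ^+ _).
    exact: mulnCA.
  apply/commgP/conjg_fixP.
  have -> : w = (v * u)^-1 * (u * v) by rewrite /w commgEl conjgE invMg !mulgA.
  rewrite conjgM comm_uv; first by rewrite -conjgM mulVg conjg1.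
  by rewrite memJ_norm ?cycle_id // groupV groupM.
have uVF q : q \in F -> u^-1 q = tperm x y q.
  move=> Fq; apply: (canLR (permK u)); rewrite uF ?tpermK //.
  by rewrite astabC_mem ?tpF.
have vVF q : q \in F -> v^-1 q = tperm y z q.
  move=> Fq; apply: (canLR (permK v)); rewrite vF ?tpermK //.
  by rewrite astabC_mem ?tpF.
have wF q : q \in F -> w q = tperm y z (tperm x y (tperm y z (tperm x y q))).
  move=> Fq; rewrite /w commgEl conjgE !permM uVF // vVF ?astabC_mem ?tpF //.
  by rewrite uF ?vF ?astabC_mem ?tpF.
have [yx zy xz] : [/\ y != x, z != y & x != z] by split; rewrite eq_sym.
have wx : w x = y by rewrite wF // tpermL tpermL (tpermD xz yz) tpermR.
have wy : w y = z by rewrite wF // tpermR (tpermD yx zx) tpermL tpermL.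
have wz : w z = x by rewrite wF // (tpermD xz yz) tpermR tpermR (tpermD yx zx).
have w3 q : q \in [set x; y; z] -> (w ^+ 3) q = q.
  by rewrite !inE -orbA => /or3P[] /eqP->; rewrite permX /= ?wx ?wy ?wz ?wx ?wy ?wz.
have wo q : q \in F -> q \notin [set x; y; z] -> w q = q.
  move=> Fq; rewrite !inE !negb_or -andbA => /and3P[qx qy qz].
  by rewrite wF // !tpermD //; rewrite eq_sym.
have wG q : q \notin X -> w q = q by move=> nXq; rewrite (astabCP _ _ (subsetP sGX _ Gw)).
have wY q : q \in Y -> (w ^+ #|Y|) q = q by apply: (commute_cycle_expg pY cY oc cw).
have FY q : q \in X -> (q \in Y) || (q \in F) by move=> Xq; rewrite inE Xq andbT orbN.
have dC : w ^+ #|Y| \in 'C(~: [set x; y; z] | 'P).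
  apply/astabCP => q nq; have [Xq|nXq] := boolP (q \in X).
    by case/orP: (FY q Xq) => [/wY //|Fq]; rewrite permX_fix ?wo.
  by rewrite permX_fix ?wG.
apply: (jordan_3cycle (Y := [set x; y; z]) (c := w ^+ #|Y|) sGX).
- rewrite !subUset !sub1set; do !(apply/andP; split); by case/setDP: Fx Fy Fz => ? _ /setDP[? _] /setDP[? _].
- by rewrite setUC cardsU1 !inE negb_or zx zy cards2 xy.
- by apply/setIP; rewrite groupX.
- apply: nt_prime_order => //.
    apply/permP => q; rewrite perm1; have [q3|nq] := boolP (q \in [set x; y; z]).
      by rewrite expgAC permX_fix ?w3.
    by rewrite permX_fix // (astabCP _ _ dC).
  apply/eqP => /permP/(_ x); rewrite perm1 (divn_eq #|Y| 3) expgD mulnC expgM permM.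
  have -> : (w ^+ 3 ^+ (#|Y| %/ 3)) x = x by rewrite permX_fix // w3 // !inE eqxx.
  have := ltn_pmod #|Y| (isT : 0 < 3); case E: (#|Y| %% 3) => [|[|[|]]] // _.
  + have := dvdn_prime2 (isT : prime 3) pY; rewrite /dvdn E eq_sym (negPf Y3).
    by [].
  + by rewrite ?permX /= wx => /eqP; rewrite (negPf yx).
  + by rewrite ?permX /= wx wy => /eqP; rewrite (negPf zx).
move=> Z sZ pZ; apply: (ntransitive2_blockless (ntransitive_weak _ trG)) => //.
- by rewrite ltnS; apply: ltn_trans F3.
- exact: proper_sub.
- apply: leq_trans (subset_leq_card sZ).
  by rewrite setUC cardsU1 !inE negb_or zx zy cards2 xy.
- by case/properP: pZ => _ [a Xa nZa]; apply: contraNneq nZa => ->.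
Qed.

End Jordan.

(** * Permutations of labelled points as lists *)

Section Codes.
Variables (T : finType) (x0 : T).
Implicit Types (lab : seq T) (g h : {perm T}) (G : {group {perm T}}) (X Y : {set T}).

Definition code lab g := [seq index (g x) lab | x <- lab].

Definition codes lab (G : {set {perm T}}) s := exists2 g, g \in G & code lab g = s.

Definition labelling lab := uniq lab /\ forall x, x \in lab.

Section Labelled.
Variables (lab : seq T) (Hlab : labelling lab).
Let Ulab := proj1 Hlab.
Let Alab := proj2 Hlab.

Lemma size_code g : size (code lab g) = size lab. Proof. by rewrite size_map. Qed.

Lemma nth_code g i : i < size lab -> nth 0 (code lab g) i = index (g (nth x0 lab i)) lab.
Proof. by move=> lti; rewrite (nth_map x0). Qed.

Lemma nth_code_lt g i : i < size lab -> nth 0 (code lab g) i < size lab.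
Proof. by move=> lti; rewrite nth_code // index_mem. Qed.

Lemma nth_lab_code g i : i < size lab -> nth x0 lab (nth 0 (code lab g) i) = g (nth x0 lab i).
Proof. by move=> lti; rewrite nth_code // nth_index. Qed.

Lemma nth_code_eq g i j : i < size lab -> j < size lab -> g (nth x0 lab i) = nth x0 lab j ->
  nth 0 (code lab g) i = j.
Proof. by move=> lti ltj E; rewrite nth_code // E index_uniq. Qed.

Lemma code_comp g h : code lab (g * h) = comp_seq (code lab g) (code lab h).
Proof.
rewrite /comp_seq -map_comp; apply: eq_map => x /=.
by rewrite permM (nth_map x0) ?index_mem // nth_index.
Qed.

Lemma code1 : code lab 1 = iota 0 (size lab).
Proof.
apply: (@eq_from_nth _ 0); rewrite size_code ?size_iota // => i lti.
by rewrite nth_iota // add0n; apply: nth_code_eq; rewrite ?perm1.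
Qed.

Lemma code_inj g h : code lab g = code lab h -> g = h.
Proof.
move=> E; apply/permP => x; have lx : index x lab < size lab by rewrite index_mem.
by rewrite -[x](nth_index x0 (Alab x)) -!nth_lab_code ?E.
Qed.

Lemma code_expg g n : code lab (g ^+ n) = iter n (comp_seq (code lab g)) (iota 0 (size lab)).
Proof. by elim: n => [|n IHn]; rewrite ?expg0 ?code1 // expgS code_comp IHn. Qed.

Lemma iter_code g n i : i < size lab ->
  nth x0 lab (iter n (nth 0 (code lab g)) i) = (g ^+ n) (nth x0 lab i) /\
  iter n (nth 0 (code lab g)) i < size lab.
Proof.
move=> lti; elim: n => [|n [E lt]]; first by rewrite expg0 perm1.
by rewrite /= nth_lab_code // E expgSr permM nth_code_lt.
Qed.

Lemma codes_closed G : perm_closed (size lab) (codes lab G).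
Proof.
split.
- by move=> _ _ [g Gg <-] [h Gh <-]; exists (g * h); rewrite ?groupM ?code_comp.
- move=> _ _ [g Gg <-] [h Gh <-]; exists (code lab (g * h^-1)).
    by exists (g * h^-1); rewrite ?groupM ?groupV.
  by rewrite -code_comp mulgKV.
- move=> _ [g Gg <-].
  have E1 : iota 0 (size lab) = map (index^~ lab) lab.
    by rewrite -code1; apply: eq_map => x; rewrite perm1.
  rewrite E1 /code (map_comp (index^~ lab) g); apply: perm_map; apply: uniq_perm => //.
    by rewrite map_inj_uniq //; apply: perm_inj.
  by move=> x; rewrite Alab; apply/mapP; exists (g^-1 x); rewrite // permKV.
move=> s; have [/exists_inP[g Gg /eqP E]|nex] := boolP [exists g in G, code lab g == s].
  by left; exists g.
by right=> -[g Gg E]; case/exists_inP: nex; exists g; rewrite ?E.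
Qed.

Lemma card_moved g : #|[set x | g x != x]| = count (fun i => nth 0 (code lab g) i != i) (iota 0 (size lab)).
Proof.
have pl : perm_eq lab (enum T).
  by apply: uniq_perm; rewrite ?enum_uniq // => x; rewrite Alab mem_enum.
have -> : #|[set x | g x != x]| = count (fun x => g x != x) lab.
  rewrite (seq.permP pl) cardsE cardE -size_filter; congr (size _).
  by rewrite enumT [LHS]/enum_mem; apply: eq_filter.
rewrite -{1}[lab](mkseq_nth x0) /mkseq count_map; apply: eq_in_count => i.
rewrite mem_iota /= => lti; rewrite -(inj_in_eq (f := nth x0 lab) (D := [pred i | i < size lab])) ?nth_lab_code //.
  by move=> j k lj lk /eqP; rewrite nth_uniq // => /eqP.
by rewrite inE nth_code_lt.
Qed.

Lemma codes_cycle_power G q e : has_word (codes lab G) (is_cycle_power q e) ->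
  exists2 h, h \in G & #|[set x | h x != x]| = q /\ h ^+ q = 1.
Proof.
case=> _ [g Gg <-]; rewrite /is_cycle_power size_code -!code_expg.
case: ifP => // /eqP Eq /eqP E1; exists (g ^+ e); first exact: groupX.
rewrite card_moved; split=> //; apply: code_inj.
by rewrite E1 code1.
Qed.

(** If [q] were prime to the order of [g], then [g] would be a power of [g ^+ q] and fix every point
    that the latter fixes. *)
Lemma codes_orbit G q : prime q -> has_word (codes lab G) (has_orbit q) -> q %| #|G|.
Proof.
move=> pq [_ [g Gg <-]] /hasP[i]; rewrite size_code mem_iota /= => lti.
case: ifP => // nfix /eqP Eq; apply: dvdn_trans (order_dvdG Gg).
apply: contraFT nfix; rewrite -prime_coprime // coprime_sym => co.
have : g \in <[g ^+ q]> by have := generator_coprime g q; rewrite co => /eqP <-; apply: cycle_id.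
case/cycleP => j Ej; apply/eqP/nth_code_eq => //.
rewrite Ej permX_fix //.
by have [<- _] := iter_code g q lti; rewrite Eq.
Qed.

Lemma gen_codes_ind (P : seq nat -> Prop) (A : {set {perm T}}) :
    perm_closed (size lab) P -> P (iota 0 (size lab)) -> {in A, forall g, P (code lab g)} ->
  {in <<A>>, forall g, P (code lab g)}.
Proof.
move=> cP P1 PA _ /gen_prodgP[n [c Ac ->]].
apply: (big_ind (fun g => P (code lab g))) => [|g h Pg Ph|i _]; first by rewrite code1.
  by rewrite code_comp; apply: (pc_comp cP).
exact: PA.
Qed.

(** Renumbering the points conjugates every code by [sigma]; this passes from the order along a
    cycle to the numbering of a field. *)
Lemma relabelling (sigma : seq nat) : perm_eq sigma (iota 0 (size lab)) ->
  let lab' := [seq nth x0 lab i | i <- sigma] in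
  [/\ labelling lab', size lab' = size lab &
   forall g, code lab' g = [seq index (nth 0 (code lab g) i) sigma | i <- sigma]].
Proof.
move=> ps lab'; have szs : size sigma = size lab by rewrite (perm_size ps) size_iota.
have us : uniq sigma by rewrite (perm_uniq ps) iota_uniq.
have ms i : (i \in sigma) = (i < size lab) by rewrite (perm_mem ps) mem_iota.
have ul : uniq lab'.
  rewrite map_inj_in_uniq // => i j; rewrite !ms => li lj /eqP.
  by rewrite nth_uniq // => /eqP.
have sz : size lab' = size lab by rewrite size_map.
split=> //; first split=> // x.
  apply/mapP; exists (index x lab); rewrite ?nth_index // ms index_mem; exact: Alab.
move=> g; rewrite /code -map_comp; apply/eq_in_map => i; rewrite ms => lti /=.
rewrite -nth_lab_code //; set j := nth 0 _ _.
have ltj : j < size lab by apply: nth_code_lt.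
have -> : nth x0 lab j = nth x0 lab' (index j sigma).
  by rewrite (nth_map 0) ?index_mem ?ms // nth_index ?ms.
by rewrite index_uniq // sz -szs index_mem ms.
Qed.

End Labelled.

(** Numbering [Y] along the cycle turns [c] into [i -> i + 1] modulo the prime; its fixed points
    follow in the order of [F]. *)
Lemma cycle_labelling (c : {perm T}) Y (F : seq T) : prime #|Y| -> c \in 'C(~: Y | 'P) ->
    #[c] = #|Y| -> uniq F -> F =i ~: Y ->
  exists lab, [/\ labelling lab, size lab = #|Y| + size F, drop #|Y| lab = F &
    code lab c = rcons (iota 1 #|Y|.-1) 0 ++ iota #|Y| (size F)].
Proof.
move=> pY cY oc uF mF; have trc := prime_cycle_atrans pY cY oc.
have [x Yx Eorb] := imsetP trc; have p0 := prime_gt0 pY.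
have Epo : porbit c x = Y by rewrite porbitE -Eorb.
set p := #|Y| in pY oc p0 *.
have ut : uniq (traject c x p) by rewrite /p -Epo uniq_traject_porbit.
have mt : traject c x p =i Y by move=> y; rewrite /p -{1}Epo -porbit_traject Epo.
pose lab := traject c x p ++ F.
have szt : size (traject c x p) = p by rewrite size_traject.
have Hlab : labelling lab.
  split=> [|y]; last by rewrite mem_cat mt mF inE orbN.
  rewrite cat_uniq ut uF andbT /=; apply/hasPn => y; rewrite mF inE => nYy.
  by rewrite /= mt.
have sl : size lab = p + size F by rewrite size_cat szt.
exists lab; split=> //; first by rewrite drop_size_cat.
apply: (@eq_from_nth _ 0).
  by rewrite size_code size_cat size_rcons !size_iota prednK.
rewrite size_code sl => i lti; apply: (nth_code_eq Hlab); rewrite ?sl //.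
  rewrite nth_cat size_rcons size_iota prednK // nth_rcons size_iota.
  case: (ltnP i p) => ltp.
    case: (ltnP i p.-1) => ltp1; last by case: ifP => _; rewrite ltn_addr.
    by rewrite nth_iota // add1n ltn_addr // -(prednK p0) ltnS.
  by rewrite nth_iota ?subnKC // -(ltn_add2l p) subnKC.
rewrite [in RHS]nth_cat size_rcons size_iota prednK // nth_rcons size_iota.
case: (ltnP i p) => ltp; last first.
  have ltiF : i - p < size F by rewrite -(ltn_add2l p) subnKC.
  rewrite nth_iota // subnKC //; apply: (astabCP _ _ cY).
  rewrite nth_cat szt ltnNge ltp /=.
  by have := mem_nth x0 ltiF; rewrite mF inE.
have tE j : j < p -> nth x0 lab j = iter j c x.
  by move=> ltj; rewrite nth_cat szt ltj (set_nth_default x) ?szt // nth_traject.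
rewrite (tE i ltp); case: (ltnP i p.-1) => ltp1.
  by rewrite nth_iota // add1n tE // -(prednK p0) ltnS.
have -> : i = p.-1 by apply/eqP; rewrite eqn_leq ltp1 -ltnS prednK // ltp.
by rewrite eqxx tE // -iterS prednK // /p -Epo iter_porbit.
Qed.

End Codes.

Lemma code_seqperm d s : perm_eq s (iota 0 d.+1) -> code (enum 'I_d.+1) (seqperm d s) = s.
Proof.
move=> ps; have sz : size s = d.+1 by rewrite (perm_size ps) size_iota.
have lts i : i < d.+1 -> nth 0 s i < d.+1.
  move=> lti; have : nth 0 s i \in iota 0 d.+1; last by rewrite mem_iota.
  by rewrite -(perm_mem ps) mem_nth ?sz.
have inj : injectiveb ([ffun x : 'I_d.+1 => (inord (nth 0 s x) : 'I_d.+1)] : {ffun 'I_d.+1 -> 'I_d.+1}).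
  apply/injectiveP => x y; rewrite !ffunE => /(congr1 val) /=; rewrite !inordK ?lts // => /eqP.
  by rewrite nth_uniq ?sz ?(perm_uniq ps) ?iota_uniq // => /eqP/val_inj.
have E x : seqperm d s x = inord (nth 0 s x).
  by rewrite -pvalE /seqperm val_insubd inj ffunE.
apply: (@eq_from_nth _ 0); first by rewrite size_code size_enum_ord sz.
rewrite size_code size_enum_ord => i lti.
rewrite (nth_map ord0) ?size_enum_ord // E index_enum_ord inordK ?lts //.
all: by rewrite ?nth_enum_ord // lts // nth_enum_ord.
Qed.

Lemma labelling_enum d : labelling (enum 'I_d).
Proof. by split=> [|x]; rewrite ?enum_uniq ?mem_enum. Qed.

(** Equal codes mean that the two groups differ only by the bijection from the standard numbering to
    [lab]. *)
Lemma codes_perm_isomorphic n (H : {set {perm 'I_n.+1}}) (G : {group {perm 'I_n.+1}}) lab :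
    labelling lab -> (forall s, codes (enum 'I_n.+1) H s <-> codes lab G s) ->
  perm_isomorphic H G.
Proof.
move=> Hlab HG; have [Ulab Alab] := Hlab.
have szl : size lab = n.+1.
  have /perm_size : perm_eq lab (enum 'I_n.+1).
    by apply: uniq_perm; rewrite ?enum_uniq // => x; rewrite Alab mem_enum.
  by rewrite size_enum_ord.
exists (fun i : 'I_n.+1 => nth ord0 lab i); split.
  apply: injF_bij => i j /eqP; rewrite nth_uniq ?szl // => /eqP; exact: val_inj.
have EH h (i : 'I_n.+1) : nth 0 (code (enum 'I_n.+1) h) i = h i.
  by rewrite (nth_code ord0) ?size_enum_ord // nth_ord_enum index_enum_ord.
move=> g; split=> [Gg|[h Hh E]].
  have [h Hh Eh] : codes (enum 'I_n.+1) H (code lab g) by apply/HG; exists g.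
  by exists h => // x; rewrite -EH Eh (nth_lab_code ord0 Hlab) ?szl.
have [g' Gg' Eg'] : codes lab G (code (enum 'I_n.+1) h) by apply/HG; exists h.
suff <- : g' = g by [].
apply: (code_inj ord0 Hlab); rewrite Eg'.
apply: (@eq_from_nth _ 0); first by rewrite !size_code size_enum_ord szl.
rewrite size_code size_enum_ord => i lti; rewrite -[i]/(val (Ordinal lti)) EH; apply/esym.
by apply: (nth_code_eq (x0 := ord0) Hlab); [rewrite szl | rewrite szl ltn_ord | exact: E].
Qed.

(** * Recognising the alternating group *)

Section AltIn.
Variable T : finType.
Implicit Types (G H K : {group {perm T}}) (X Y D : {set T}) (g h c s : {perm T}).

(* A group acting on [X] only is a subgroup of ['C(~: X | 'P)], the permutations
   of [T] that fix every point outside [X]. *)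
Definition contains_alt (G : {set {perm T}}) X :=
  forall s, s \in 'C(~: X | 'P) -> ~~ odd_perm s -> s \in G.

Definition moved g := [set x | g x != x].

Lemma astabC_moved g : g \in 'C(~: moved g | 'P).
Proof. by apply/astabCP => x; rewrite inE negbK => /eqP. Qed.

Lemma moved_sub g X : g \in 'C(~: X | 'P) -> moved g \subset X.
Proof.
by move=> gX; apply/subsetP => x; rewrite inE; apply: contraR => /(astabCP _ _ gX)->.
Qed.

Lemma mem_astabC_moved G g : g \in G -> g \in 'C_G(~: moved g | 'P).
Proof. by move=> Gg; apply/setIP; split; last exact: astabC_moved. Qed.

(** A set with more than half of the points of [X] meets each of its translates. *)
Lemma moves_half G X Y : [transitive G, on X | 'P] -> Y \subset X -> #|X| < #|Y|.*2 ->
  forall Z : {set T}, Y \subset Z -> Z \proper X -> exists2 g, g \in G & moves_across g Z.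
Proof.
move=> tr sYX ltXY Z sYZ pZ; have [sZX [x Xx nZx]] := properP pZ.
have Z0 : 0 < #|Z|.
  by apply: leq_trans (subset_leq_card sYZ); rewrite -double_gt0; apply: leq_trans ltXY.
have /card_gt0P[z Zz] := Z0.
have [g Gg Ex] := atransP2 tr (subsetP sZX _ Zz) Xx; exists g => //; apply/andP; split.
  by apply: contraNneq nZx => <-; rewrite Ex; apply: imset_f.
have sgX : g @: Z \subset X.
  apply/subsetP => _ /imsetP[u Zu ->].
  by rewrite -[g u]/('P%act u g) (actsP (atrans_acts tr) g Gg) (subsetP sZX).
apply: contraL ltXY => dis; rewrite -leqNgt.
apply: leq_trans (_ : #|g @: Z| + #|Z| <= _).
  by rewrite card_imset_perm addnn leq_double subset_leq_card.
rewrite -cardsUI; have /eqP -> : g @: Z :&: Z == set0 by rewrite setI_eq0.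
by rewrite cards0 addn0 subset_leq_card // subUset sgX.
Qed.

Lemma mem_moved_cycle (g w : {perm T}) x : w \in <[g]> -> (w x \in moved g) = (x \in moved g).
Proof.
case/cycleP => i ->; rewrite !inE -permM -(commuteX i (commute_refl g)) permM.
by rewrite (inj_eq perm_inj).
Qed.

Lemma card_orbit_moved p (g : {perm T}) x : prime p -> #[g] = p -> x \in moved g ->
  #|orbit 'P <[g]> x| = p /\ orbit 'P <[g]> x \subset moved g.
Proof.
move=> pp og mx; split; last first.
  by apply/subsetP => _ /imsetP[w gw ->]; rewrite /= /aperm mem_moved_cycle.
have := dvdn_orbit 'P <[g]> x; rewrite -orderE og; case/primeP: pp => _ /[apply].
case/orP => [/eqP/card_orbit1/setP/(_ (g x))|/eqP //].
by move: mx; rewrite !inE => /negPf->; rewrite (mem_orbit 'P) ?cycle_id.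
Qed.

Lemma prime_cycle_exists G X p : G \subset 'C(~: X | 'P) -> prime p -> #|X| < p.*2 ->
    p %| #|G| ->
  exists2 c, c \in G & #|moved c| = p /\ #[c] = p.
Proof.
move=> sGX pp ltX pG; have [c Gc oc] := Cauchy pp pG; exists c; rewrite // -{2}oc; split=> //.
have c1 : c != 1 by rewrite -order_eq1 oc neq_ltn prime_gt1 ?orbT.
have orb x mx := @card_orbit_moved p c x pp oc mx.
have [x mx] : exists x, x \in moved c.
  apply/set0Pn; apply: contra c1 => /eqP/setP m0.
  by apply/eqP/permP => x; have := m0 x; rewrite !inE perm1 => /negbFE/eqP.
have [ox sx] := orb x mx.
suff -> : moved c = orbit 'P <[c]> x by [].
apply/eqP; rewrite eqEsubset sx andbT; apply/subsetP => y my; have [oy sy] := orb y my.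
apply: contraLR ltX => nxy; rewrite -leqNgt -addnn -{1}ox -oy -cardsUI.
have -> : orbit 'P <[c]> x :&: orbit 'P <[c]> y = set0.
  apply/setP => z; rewrite inE [RHS]inE; apply/negP => /andP[zx zy]; case/negP: nxy.
  by rewrite orbit_sym; apply: orbit_trans zy; rewrite orbit_sym.
rewrite cards0 addn0 subset_leq_card // subUset.
by rewrite !(subset_trans _ (moved_sub (subsetP sGX _ Gc))).
Qed.

Lemma contains_alt_prime G X p : G \subset 'C(~: X | 'P) -> [transitive G, on X | 'P] ->
    prime p -> #|X| < p.*2 -> (p == 3) || (p + 3 <= #|X|) -> p %| #|G| ->
  contains_alt G X.
Proof.
move=> sGX tr pp ltX p3 pG; have [c Gc [mc oc]] := prime_cycle_exists sGX pp ltX pG.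
have sm : moved c \subset X by apply: moved_sub; apply: subsetP sGX _ Gc.
apply: (jordan_prime_cycle sGX sm _ (mem_astabC_moved Gc)); rewrite ?mc //.
by apply: moves_half; rewrite ?mc.
Qed.

Lemma blockless_moves G X Y : blockless G X -> 1 < #|Y| ->
  forall Z : {set T}, Y \subset Z -> Z \proper X -> exists2 g, g \in G & moves_across g Z.
Proof.
move=> bl Y1 Z sYZ pZ; apply: bl; first exact: proper_sub.
  exact: leq_trans (subset_leq_card sYZ).
by apply: contraTneq pZ => ->; rewrite properxx.
Qed.

Lemma contains_alt_3cycle G X h : G \subset 'C(~: X | 'P) -> [transitive^2 G, on X | 'P] ->
  h \in G -> #|moved h| = 3 -> h ^+ 3 = 1 -> contains_alt G X.
Proof.
move=> sGX tr Gh m3 h3; have sm : moved h \subset X by apply: moved_sub; apply: subsetP sGX _ Gh.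
apply: (jordan_3cycle sGX sm m3 (mem_astabC_moved Gh)).
  apply: nt_prime_order => //; apply/eqP => h1.
  by have /card_gt0P[x] : 0 < #|moved h|; rewrite ?m3 // inE h1 perm1 eqxx.
by apply: blockless_moves (ntransitive2_blockless tr) _; rewrite m3.
Qed.

Lemma ntransitive2P G X x y x' y' : [transitive^2 G, on X | 'P] ->
    [/\ x \in X, y \in X & x != y] -> [/\ x' \in X, y' \in X & x' != y'] ->
  exists2 g, g \in G & g x = x' /\ g y = y'.
Proof.
move=> tr [Xx Xy xy] [Xx' Xy' xy'].
have d2 u v : u \in X -> v \in X -> u != v -> [tuple u; v] \in 2.-dtuple(X).
  by move=> Xu Xv uv; rewrite inE memtE subset_all /= !inE Xu Xv uv.
by have [g Gg [-> ->]] := atransP2 tr (d2 _ _ Xx Xy xy) (d2 _ _ Xx' Xy' xy'); exists g.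
Qed.

Lemma ntransitive3P G X x y z x' y' z' : [transitive^3 G, on X | 'P] ->
    [/\ x \in X, y \in X, z \in X & uniq [:: x; y; z]] ->
    [/\ x' \in X, y' \in X, z' \in X & uniq [:: x'; y'; z']] ->
  exists2 g, g \in G & [/\ g x = x', g y = y' & g z = z'].
Proof.
move=> tr [Xx Xy Xz U] [Xx' Xy' Xz' U'].
have d3 u v w : u \in X -> v \in X -> w \in X -> uniq [:: u; v; w] -> [tuple u; v; w] \in 3.-dtuple(X).
  by move=> Xu Xv Xw uvw; rewrite inE memtE subset_all uvw /= Xu Xv Xw.
by have [g Gg [-> -> ->]] := atransP2 tr (d3 _ _ _ Xx Xy Xz U) (d3 _ _ _ Xx' Xy' Xz' U'); exists g.
Qed.

Lemma contains_alt_tperm G X x y : [transitive^2 G, on X | 'P] ->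
  x \in X -> y \in X -> x != y -> tperm x y \in G -> contains_alt G X.
Proof.
move=> tr Xx Xy xy Gxy; apply: even_perm_mem => u v w Xu Xv Xw.
rewrite /= !inE negb_or andbT => /andP[/andP[uv uw] vw].
have allt a b : a \in X -> b \in X -> a != b -> tperm a b \in G.
  move=> Xa Xb ab.
  have [g Gg [<- <-]] := ntransitive2P tr (And3 Xx Xy xy) (And3 Xa Xb ab).
  by rewrite -tpermJ groupJ.
by rewrite groupM ?allt.
Qed.

End AltIn.

(** * Small degrees *)

Section CodesMore.
Variable T : finType.
Implicit Types (lab : seq T) (g h : {perm T}) (G K : {group {perm T}}) (X Y : {set T}).

Lemma gen_codes_sub (T' : finType) (x0 : T) (x1 : T') lab (lab' : seq T') (A : {set {perm T}})
    (H : {group {perm T'}}) : labelling lab -> labelling lab' -> size lab = size lab' ->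
    {in A, forall g, codes lab' H (code lab g)} ->
  {in <<A>>, forall g, codes lab' H (code lab g)}.
Proof.
move=> Hl Hl' sz HA; apply: (gen_codes_ind x0 Hl) => //.
  by rewrite sz; apply: codes_closed x1 _ Hl' H.
by exists 1; rewrite ?group1 // (code1 x1 Hl') sz.
Qed.

Lemma codes_atrans (x0 : T) K X lab b gens d : labelling lab -> K \subset 'C(~: X | 'P) ->
    b < size lab -> nth x0 lab b \in X -> (forall s, s \in gens -> codes lab K s) ->
    (forall j, j < size lab -> nth x0 lab j \in X -> reaches (fun w => nth 0 w b == j) gens d) ->
  [transitive K, on X | 'P].
Proof.
move=> Hl sKX ltb Xb Kgens tr; apply: (astabC_atransI sKX Xb) => y Xy.
have lty : index y lab < size lab by rewrite index_mem; apply: (proj2 Hl).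
have Ey : nth x0 lab (index y lab) = y by rewrite nth_index //; apply: (proj2 Hl).
have Xy' : nth x0 lab (index y lab) \in X by rewrite Ey.
have [_ [k Kk <-] /eqP Ek] := reaches_ind (codes_closed x0 Hl K) Kgens (tr _ lty Xy').
by exists k => //; rewrite -Ey -Ek (nth_lab_code x0 Hl).
Qed.

Lemma moved2_tperm g : #|moved g| = 2 -> exists x y, [/\ x != y & g = tperm x y].
Proof.
move=> m2; have /cards2P[x [y [xy Em]]] : #|moved g| == 2 by rewrite m2.
have gC := astabC_moved g; exists x, y; split=> //.
have mx : x \in moved g by rewrite Em !inE eqxx.
have my : y \in moved g by rewrite Em !inE eqxx orbT.
have gx : g x = y.
  have := astabC_mem x gC; rewrite mx {1}Em !inE => /orP[/eqP E|/eqP //].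
  by move: mx; rewrite inE E eqxx.
have gy : g y = x.
  have := astabC_mem y gC; rewrite my {1}Em !inE => /orP[/eqP //|/eqP E].
  by move: my; rewrite inE E eqxx.
apply/permP => z; case: tpermP => [->|->|/eqP zx /eqP zy] //.
by apply: (astabCP _ _ gC); rewrite Em !inE negb_or zx.
Qed.

Lemma codes_3cycle_alt (x0 : T) G X lab : labelling lab -> G \subset 'C(~: X | 'P) ->
    [transitive^2 G, on X | 'P] -> has_word (codes lab G) (is_cycle_power 3 4) ->
  contains_alt G X.
Proof.
move=> Hl sGX tr /(codes_cycle_power x0 Hl)[h Gh [m3 h3]].
exact: contains_alt_3cycle Gh m3 h3.
Qed.

(** With [p] equal to 5, 5, 7 and 11, this gives double transitivity in degree 6 and triple
    transitivity in degrees 7, 9 and 13. *)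
Lemma prime_cycle_transitivity G X c p : G \subset 'C(~: X | 'P) -> [transitive G, on X | 'P] ->
    prime p -> #|X| < p.*2 -> c \in G -> #|moved c| = p -> #[c] = p ->
  [transitive^(#|X| - p).+1 G, on X | 'P].
Proof.
move=> sGX tr pp ltX Gc mc oc; have sm : moved c \subset X by apply: moved_sub; apply: subsetP sGX _ Gc.
have <- : #|X :\: moved c| = #|X| - p by rewrite cardsD (setIidPr sm) mc.
apply: (prime_cycle_ntransitive sGX sm _ (mem_astabC_moved Gc)); rewrite ?mc //.
by apply: moves_half; rewrite ?mc.
Qed.

End CodesMore.

(** In degree 7 the prime 5 misses Jordan's bound by one. The group is triply transitive, which
    provides the elements required by [degree7_3cycle]. *)
Lemma degree_8_alt (G : {group {perm 'I_8}}) a : G \subset 'C(~: [set~ a] | 'P) ->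
  [transitive G, on [set~ a] | 'P] -> 5 %| #|G| -> contains_alt G [set~ a].
Proof.
move=> sGX tr G5; have X7 : #|[set~ a]| = 7 by rewrite cardsC1 card_ord.
have ltX : #|[set~ a]| < 5.*2 by rewrite X7.
have [c Gc [mc oc]] := prime_cycle_exists sGX (isT : prime 5) ltX G5.
have := prime_cycle_transitivity sGX tr (isT : prime 5) ltX Gc mc oc; rewrite X7 => tr3.
have sm : moved c \subset [set~ a] by apply: moved_sub; apply: subsetP sGX _ Gc.
have /cards2P[y [z [yz Eyz]]] : #|[set~ a] :\: moved c| == 2.
  by rewrite cardsD (setIidPr sm) mc X7.
have nmem x : x \notin moved c = (x \in [:: y; z; a]).
  have /setP/(_ x) := Eyz; rewrite !inE; case: (eqVneq x a) => [->|_] /=.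
    by move=> _; rewrite !orbT negbK (astabCP _ _ (subsetP sGX _ Gc)) ?eqxx // !inE eqxx.
  by rewrite andbT orbF.
have [/setDP[Xy _] /setDP[Xz _]] : y \in [set~ a] :\: moved c /\ z \in [set~ a] :\: moved c.
  by rewrite Eyz !inE !eqxx orbT.
have pm : prime #|moved c| by rewrite mc.
have [|||lab [Hl sl Fl Cl]] := cycle_labelling ord0 (F := [:: y; z; a]) pm (astabC_moved c).
- by rewrite oc mc.
- by move: Xy Xz; rewrite /= !inE negb_or yz => -> ->.
- by move=> x; rewrite in_setC nmem.
rewrite mc in sl Fl Cl; have {}Cl : code lab c = [:: 1%N; 2; 3; 4; 0; 5; 6; 7] by [].
have l5 : nth ord0 lab 5 = y by have := congr1 (fun s => nth ord0 s 0) Fl; rewrite nth_drop.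
have l6 : nth ord0 lab 6 = z by have := congr1 (fun s => nth ord0 s 1) Fl; rewrite nth_drop.
have l7 : nth ord0 lab 7 = a by have := congr1 (fun s => nth ord0 s 2) Fl; rewrite nth_drop.
have lneq i j : i < 8 -> j < 8 -> i != j -> nth ord0 lab i != nth ord0 lab j.
  by move=> lti ltj; rewrite nth_uniq ?sl //; case: Hl.
have lX i : i < 7 -> nth ord0 lab i \in [set~ a].
  by move=> lti; rewrite !inE -l7 lneq // ?ltn_eqF // ltnW.
have U : uniq [:: nth ord0 lab 0; nth ord0 lab 5; nth ord0 lab 6].
  by rewrite /= !inE !negb_or !lneq.
have [u Gu [u0 u5 u6]] : exists2 u, u \in G & [/\ u (nth ord0 lab 0) = nth ord0 lab 0,
    u (nth ord0 lab 5) = nth ord0 lab 6 & u (nth ord0 lab 6) = nth ord0 lab 5].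
  by apply: (ntransitive3P tr3); split; rewrite ?lX //= !inE !negb_or !lneq.
have [g Gg [g0 g5 g6]] : exists2 u, u \in G & [/\ u (nth ord0 lab 0) = nth ord0 lab 5,
    u (nth ord0 lab 5) = nth ord0 lab 0 & u (nth ord0 lab 6) = nth ord0 lab 6].
  by apply: (ntransitive3P tr3); split; rewrite ?lX //= !inE !negb_or !lneq.
have f7 h : h \in G -> h (nth ord0 lab 7) = nth ord0 lab 7.
  by move=> Gh; rewrite l7 (astabCP _ _ (subsetP sGX _ Gh)) // !inE eqxx.
apply: (codes_3cycle_alt ord0 Hl sGX (ntransitive_weak _ tr3)) => //.
have clo : perm_closed 8 (codes lab G) by have := codes_closed ord0 Hl G; rewrite sl.
apply: (degree7_3cycle (u := code lab u) (g := code lab g) clo).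
- by exists c.
- by exists u.
- by exists g.
- by split; apply: (nth_code_eq (x0 := ord0) Hl); rewrite ?sl ?f7.
- by split; apply: (nth_code_eq (x0 := ord0) Hl); rewrite ?sl ?f7.
Qed.

(** Labels 0 to 4 follow a 5-cycle and 5 is its fixed point, so the cycle reads [x -> x + 1] on the
    projective line. *)
Lemma degree_6_labelling (G : {group {perm 'I_6}}) :
    [transitive G, on [set: 'I_6] | 'P] -> 5 %| #|G| ->
  contains_alt G setT \/ exists2 lab, labelling lab & size lab = 6 /\
    exists2 c, c \in G & [/\ #|moved c| = 5, #[c] = 5, code lab c = aff6 & codes lab G inv6].
Proof.
move=> tr G5; have X6 : #|[set: 'I_6]| = 6 by rewrite cardsT card_ord.
have sGX : G \subset 'C(~: [set: 'I_6] | 'P).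
  by apply/subsetP => g _; apply/astabCP => x; rewrite inE.
have ltX : #|[set: 'I_6]| < 5.*2 by rewrite X6.
have [c Gc [mc oc]] := prime_cycle_exists sGX (isT : prime 5) ltX G5.
have := prime_cycle_transitivity sGX tr (isT : prime 5) ltX Gc mc oc; rewrite X6 => tr2.
have /cards1P[y Ey] : #|~: moved c| == 1%N by rewrite cardsCs setCK card_ord mc.
have pm : prime #|moved c| by rewrite mc.
have [|||lab [Hl sl Fl Cl]] := cycle_labelling ord0 (F := [:: y]) pm (astabC_moved c).
- by rewrite oc mc.
- by [].
- by move=> x; rewrite Ey !inE.
rewrite mc in sl Fl Cl; have {}Cl : code lab c = aff6 by [].
have lneq i j : i < 6 -> j < 6 -> i != j -> nth ord0 lab i != nth ord0 lab j.
  by move=> lti ltj; rewrite nth_uniq ?sl //; case: Hl.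
have [g Gg [g0 g5]] : exists2 u, u \in G & u (nth ord0 lab 0) = nth ord0 lab 5 /\
    u (nth ord0 lab 5) = nth ord0 lab 0.
  by apply: (ntransitive2P tr2); split; rewrite ?inE ?lneq.
have clo : perm_closed 6 (codes lab G) by have := codes_closed ord0 Hl G; rewrite sl.
have Pc : codes lab G aff6 by exists c.
have Pg : codes lab G (code lab g) by exists g.
have [||w|Pi] := degree6_swap clo Pc Pg.
- by apply: (nth_code_eq (x0 := ord0) Hl); rewrite ?sl.
- by apply: (nth_code_eq (x0 := ord0) Hl); rewrite ?sl.
- by left; apply: (codes_3cycle_alt ord0 Hl sGX tr2 w).
by right; exists lab => //; split=> //; exists c.
Qed.

Lemma degree_6_cases (G : {group {perm 'I_6}}) :
    [transitive G, on [set: 'I_6] | 'P] -> 5 %| #|G| ->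
  [\/ contains_alt G setT, perm_isomorphic PSL25 G | [transitive^3 G, on [set: 'I_6] | 'P]].
Proof.
move=> tr G5; have [alt|[lab Hl [sl [c Gc [mc oc Cl Pi]]]]] := degree_6_labelling tr G5.
  by constructor 1.
have X6 : #|[set: 'I_6]| = 6 by rewrite cardsT card_ord.
have sTX (H : {group {perm 'I_6}}) : H \subset 'C(~: [set: 'I_6] | 'P).
  by apply/subsetP => g _; apply/astabCP => x; rewrite inE.
have ltX : #|[set: 'I_6]| < 5.*2 by rewrite X6.
have clo (H : {group {perm 'I_6}}) : perm_closed 6 (codes lab H).
  by have := codes_closed ord0 Hl H; rewrite sl.
have Pc : codes lab G aff6 by exists c.
(* [K] is a copy of PSL(2,5) inside [G], doubly transitive because it is transitive and contains the
   5-cycle. *)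
case: (Pi) => gi Ggi Ci; pose K := <<[set c; gi]>>%G.
have Kc : c \in K by rewrite mem_gen // !inE eqxx.
have Kgi : gi \in K by rewrite mem_gen // !inE eqxx orbT.
have sKG : K \subset G by rewrite gen_subG; apply/subsetP => x; rewrite !inE => /orP[] /eqP->.
have lab_lt x : index x lab < 6.
  by have : index x lab < size lab; [rewrite index_mem; apply: (proj2 Hl) | rewrite sl].
have trK : [transitive K, on [set: 'I_6] | 'P].
  apply: (@codes_atrans _ ord0 K setT lab 0 [:: aff6; inv6] 6 Hl (sTX K)); rewrite ?sl ?inE //.
    by move=> s; rewrite !inE => /orP[] /eqP->; [exists c | exists gi].
  by do 6?[case=> [_ _|]]; [vm_compute.. | move=> j; rewrite !ltnS ltn0].
have := prime_cycle_transitivity (sTX K) trK (isT : prime 5) ltX Kc mc oc; rewrite X6 => tr2K.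
have tr2 : [transitive^2 G, on [set: 'I_6] | 'P].
  by have := prime_cycle_transitivity (sTX G) tr (isT : prime 5) ltX Gc mc oc; rewrite X6.
have lneq i j : i < 6 -> j < 6 -> i != j -> nth ord0 lab i != nth ord0 lab j.
  by move=> lti ltj; rewrite nth_uniq ?sl //; case: Hl.
have [/forall_inP good|] := boolP [forall h in G, (nth 0 (code lab h) 0 == 0) ==>
    (nth 0 (code lab h) 5 == 5) ==> (code lab h \in [:: iota 0 6; neg6])]; last first.
  rewrite negb_forall_in => /exists_inP[h Gh]; rewrite !negb_imply => /and3P[/eqP h0 /eqP h5 nh].
  have Ph : codes lab G (code lab h) by exists h.
  have [w|Pd|] := degree6_stab (clo G) Pc Pi Ph h0 h5; last by rewrite (negPf nh).
    by constructor 1; apply: (codes_3cycle_alt ord0 Hl (sTX G) tr2 w).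
  (* Here [G] contains PGL(2,5), whose triple transitivity from labels 0, 1, 2 is read off the list
     of its elements. *)
  constructor 3; apply/imsetP; exists [tuple nth ord0 lab 0; nth ord0 lab 1; nth ord0 lab 2].
    by rewrite inE memtE subset_all /= !inE !negb_or !lneq.
  apply/setP => t; apply/idP/imsetP => [|[g _ ->]]; last first.
    apply: n_act_dtuple; last by rewrite inE memtE subset_all /= !inE !negb_or !lneq.
    by apply/astabsP => x; rewrite !inE.
  case/tupleP: t => x t; case/tupleP: t => y t; case/tupleP: t => z t; rewrite (tuple0 t).
  rewrite inE => /andP[U _].
  have Ui : uniq [:: index x lab; index y lab; index z lab].
    have inj u v : (index u lab == index v lab) = (u == v).
      apply/eqP/eqP => [E|-> //].
      by rewrite -(nth_index ord0 (proj2 Hl u)) E nth_index //; apply: (proj2 Hl).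
    by move: U; rewrite /= !inE !inj.
  have [_ [g Gg <-] [E0 E1 E2]] := degree6_pgl25_trans (clo G) Pc Pi Pd (lab_lt x) (lab_lt y) (lab_lt z) Ui.
  have gE i u : i < 6 -> nth 0 (code lab g) i = index u lab -> u = g (nth ord0 lab i).
    move=> lti E; rewrite -(nth_lab_code ord0 Hl) ?sl // E nth_index //; exact: (proj2 Hl).
  exists g => //; apply: val_inj => /=; rewrite /aperm.
  by rewrite -(gE 0 x) // -(gE 1%N y) // -(gE 2 z).
constructor 2; apply: (codes_perm_isomorphic Hl); set H := <<[set psl25_t; psl25_s]>>%G.
have cE : labelling (enum 'I_6) := labelling_enum 6.
have cloH : perm_closed 6 (codes (enum 'I_6) H).
  by have := codes_closed ord0 cE H; rewrite size_enum_ord.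
have Ht : codes (enum 'I_6) H aff6.
  by exists psl25_t; [rewrite mem_gen // !inE eqxx | apply: code_seqperm].
have Hs : codes (enum 'I_6) H inv6.
  by exists psl25_s; [rewrite mem_gen // !inE eqxx orbT | apply: code_seqperm].
have Hn := degree6_neg cloH Ht Hs.
move=> s; split=> [[h Hh <-]|[g Gg <-]].
  apply: (gen_codes_sub ord0 ord0 cE Hl _ _ Hh); first by rewrite size_enum_ord.
  by move=> x; rewrite !inE => /orP[] /eqP->; rewrite code_seqperm.
(* Up to a factor in [K], [g] fixes 0 and infinity, so it is [1] or [x -> -x]. *)
have [k Kk [k0 k5]] : exists2 k, k \in K & k (nth ord0 lab 0) = g (nth ord0 lab 0) /\
    k (nth ord0 lab 5) = g (nth ord0 lab 5).
  by apply: (ntransitive2P tr2K); split; rewrite ?inE ?(inj_eq perm_inj) ?lneq.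
have -> : g = (g * k^-1) * k by rewrite mulgKV.
have fixk i : i < 6 -> k (nth ord0 lab i) = g (nth ord0 lab i) -> nth 0 (code lab (g * k^-1)) i = i.
  by move=> lti E; apply: (nth_code_eq (x0 := ord0) Hl); rewrite ?sl // permM -E permK.
rewrite (code_comp ord0 Hl); apply: (pc_comp cloH).
  have Ggk : g * k^-1 \in G by rewrite groupM // groupV (subsetP sKG).
  have := good (g * k^-1) Ggk; rewrite !fixk // => /=; rewrite !inE => /orP[] /eqP->; last exact: Hn.
  by exists 1; rewrite ?group1 // (code1 ord0 cE) size_enum_ord.
apply: (gen_codes_sub ord0 ord0 Hl cE _ _ Kk); first by rewrite size_enum_ord.
by move=> x; rewrite !inE => /orP[] /eqP->; rewrite ?Cl ?Ci.
Qed.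

(** Homogeneity on pairs is what type (3,3) leaves on the five points when the sixth is fixed. *)
Lemma degree_5_cases (G : {group {perm 'I_6}}) a : G \subset 'C(~: [set~ a] | 'P) ->
    [transitive G, on [set~ a] | 'P] ->
    (forall x y z w, x \in [set~ a] -> y \in [set~ a] -> z \in [set~ a] -> w \in [set~ a] ->
       x != y -> z != w -> exists2 g, g \in G & g @: [set x; y] = [set z; w]) ->
  contains_alt G [set~ a] \/ perm_isomorphic AGL15_fix G.
Proof.
move=> sGX tr hom2; have X5 : #|[set~ a]| = 5 by rewrite cardsC1 card_ord.
have ltX : #|[set~ a]| < 5.*2 by rewrite X5.
have G5 : 5 %| #|G| by have := atrans_dvd tr; rewrite X5.
have [c Gc [mc oc]] := prime_cycle_exists sGX (isT : prime 5) ltX G5.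
have sm : moved c \subset [set~ a] by apply: moved_sub; apply: subsetP sGX _ Gc.
have Em : moved c = [set~ a] by apply/eqP; rewrite eqEcard sm mc X5.
have pm : prime #|moved c| by rewrite mc.
have [|||lab [Hl sl Fl Cl]] := cycle_labelling ord0 (F := [:: a]) pm (astabC_moved c).
- by rewrite oc mc.
- by [].
- by move=> x; rewrite Em setCK !inE.
rewrite mc in sl Fl Cl; have {}Cl : code lab c = aff6 by [].
have l5 : nth ord0 lab 5 = a by have := congr1 (fun s => nth ord0 s 0) Fl; rewrite nth_drop.
have lneq i j : i < 6 -> j < 6 -> i != j -> nth ord0 lab i != nth ord0 lab j.
  by move=> lti ltj; rewrite nth_uniq ?sl //; case: Hl.
have lX i : i < 5 -> nth ord0 lab i \in [set~ a].
  by move=> lti; rewrite !inE -l5 lneq // ?ltn_eqF // ltnW.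
have clo : perm_closed 6 (codes lab G) by have := codes_closed ord0 Hl G; rewrite sl.
have Pc : codes lab G aff6 by exists c.
have [g Gg Eg] : exists2 g, g \in G &
    g @: [set nth ord0 lab 0; nth ord0 lab 1] = [set nth ord0 lab 0; nth ord0 lab 2].
  by apply: hom2; rewrite ?lX ?lneq.
have Pg : codes lab G (code lab g) by exists g.
have cg i : i < 2 -> nth 0 (code lab g) i \in [:: 0; 2].
  move=> lti; have lti6 : i < 6 by apply: leq_trans lti _.
  have : g (nth ord0 lab i) \in [set nth ord0 lab 0; nth ord0 lab 2].
    by rewrite -Eg imset_f // !inE; case: i lti {lti6} => [|[|//]] _; rewrite eqxx ?orbT.
  rewrite -(nth_lab_code ord0 Hl) ?sl // !inE.
  have clt : nth 0 (code lab g) i < 6 by have := nth_code_lt ord0 Hl g; rewrite sl; apply.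
  by rewrite !nth_uniq ?sl // (proj1 Hl).
have cneq : nth 0 (code lab g) 0 != nth 0 (code lab g) 1 by apply: (pc_nth_neq clo Pg).
have [||w|[Pd allA]] := degree5_agl15 clo Pc _ Pg.
- move=> _ [h Gh <-]; apply: (nth_code_eq (x0 := ord0) Hl); rewrite ?sl // l5.
  by rewrite (astabCP _ _ (subsetP sGX _ Gh)) // !inE eqxx.
- by move: (cg 0 isT) (cg 1%N isT) cneq; rewrite !inE => /orP[] /eqP-> /orP[] /eqP->.
- left; apply: (contains_alt_prime sGX tr (isT : prime 3)); rewrite ?X5 //.
  exact: (codes_orbit ord0 Hl).
right; apply: (codes_perm_isomorphic Hl); set H := <<[set agl15_a; agl15_m]>>%G.
have cE : labelling (enum 'I_6) := labelling_enum 6.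
have cloH : perm_closed 6 (codes (enum 'I_6) H).
  by have := codes_closed ord0 cE H; rewrite size_enum_ord.
have Ht : codes (enum 'I_6) H aff6.
  by exists agl15_a; [rewrite mem_gen // !inE eqxx | apply: code_seqperm].
have Hs : codes (enum 'I_6) H dbl6.
  by exists agl15_m; [rewrite mem_gen // !inE eqxx orbT | apply: code_seqperm].
move=> s; split=> [[h Hh <-]|/allA]; last exact: agl15_seqP.
apply: (gen_codes_sub ord0 ord0 cE Hl _ _ Hh); first by rewrite size_enum_ord.
by move=> x; rewrite !inE => /orP[] /eqP->; rewrite code_seqperm.
Qed.

(** The generators give a triply transitive copy [K] of PSL(2,8). Modulo [K], an element of [G]
    fixes 0, 1 and infinity, so it is a power of the Frobenius map, unless 5 divides the order; then
    Jordan's theorem applies, as [5 + 3 <= 9 < 10]. *)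
Lemma degree_9_iso (G : {group {perm 'I_10}}) a lab : G \subset 'C(~: [set~ a] | 'P) ->
    [transitive G, on [set~ a] | 'P] -> labelling lab -> size lab = 10 -> nth ord0 lab 9 = a ->
    codes lab G trans10 -> codes lab G scal10 -> codes lab G inv10 ->
  [\/ contains_alt G [set~ a], perm_isomorphic PSL28_fix G | perm_isomorphic PGammaL28_fix G].
Proof.
move=> sGX tr Hl sl l9 Pt Pw Pi.
have X9 : #|[set~ a]| = 9 by rewrite cardsC1 card_ord.
have ltX : #|[set~ a]| < 7.*2 by rewrite X9.
have clo (H : {group {perm 'I_10}}) : perm_closed 10 (codes lab H).
  by have := codes_closed ord0 Hl H; rewrite sl.
case: (Pt) => gt Gt Ct; case: (Pw) => gw Gw Cw; case: (Pi) => gi Gi Ci.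
pose K := <<[set gt; gw; gi]>>%G.
have mK x : x \in [set gt; gw; gi] -> x \in K by move=> xA; apply: mem_gen.
have [Kt Kw Ki] : [/\ gt \in K, gw \in K & gi \in K] by split; apply: mK; rewrite !inE eqxx ?orbT.
have sKG : K \subset G.
  by rewrite gen_subG; apply/subsetP => x; rewrite !inE -orbA => /or3P[] /eqP->.
have sKX : K \subset 'C(~: [set~ a] | 'P) := subset_trans sKG sGX.
have lneq i j : i < 10 -> j < 10 -> i != j -> nth ord0 lab i != nth ord0 lab j.
  by move=> lti ltj; rewrite nth_uniq ?sl //; case: Hl.
have lX i : i < 9 -> nth ord0 lab i \in [set~ a].
  by move=> lti; rewrite !inE -l9 lneq // ?ltn_eqF // ltnW.
have fix9 s : codes lab G s -> nth 0 s 9 = 9.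
  case=> h Gh <-; apply: (nth_code_eq (x0 := ord0) Hl); rewrite ?sl // l9.
  by rewrite (astabCP _ _ (subsetP sGX _ Gh)) // !inE eqxx.
have trK : [transitive K, on [set~ a] | 'P].
  apply: (@codes_atrans _ ord0 K _ lab 1 [:: trans10; scal10; inv10] 6 Hl sKX); rewrite ?sl ?lX //.
    by move=> s; rewrite !inE => /or3P[] /eqP->; [exists gt | exists gw | exists gi].
  do 9?[case=> [_ _|]]; [by vm_compute.. |].
  by case=> [_|//]; rewrite l9 !inE eqxx.
have mw : #|moved gw| = 7 by rewrite /moved (card_moved ord0 Hl) Cw sl.
have ow : #[gw] = 7.
  apply: nt_prime_order => //; first by apply: (code_inj ord0 Hl); rewrite (code_expg ord0 Hl) Cw (code1 ord0 Hl) sl.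
  by apply/eqP => w1; move: Cw; rewrite w1 (code1 ord0 Hl) sl.
have := prime_cycle_transitivity sKX trK (isT : prime 7) ltX Kw mw ow; rewrite X9 => tr3K.
have quot g : g \in G -> exists h k, [/\ h \in G, k \in K, g = h * k,
    nth 0 (code lab h) 0 = 0 & nth 0 (code lab h) 1 = 1%N /\ nth 0 (code lab h) 8 = 8].
  move=> Gg; have gX i : i < 9 -> g (nth ord0 lab i) \in [set~ a].
    by move=> lti; rewrite (astabC_mem _ (subsetP sGX _ Gg)) lX.
  have [k Kk [k0 k1 k8]] : exists2 k, k \in K & [/\ k (nth ord0 lab 0) = g (nth ord0 lab 0),
      k (nth ord0 lab 1) = g (nth ord0 lab 1) & k (nth ord0 lab 8) = g (nth ord0 lab 8)].
    apply: (ntransitive3P tr3K); first by split; rewrite ?lX //= !inE !negb_or !lneq.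
    by split; rewrite ?gX //= !inE !negb_or !(inj_eq perm_inj) !lneq.
  have fixk i : i < 10 -> k (nth ord0 lab i) = g (nth ord0 lab i) -> nth 0 (code lab (g * k^-1)) i = i.
    by move=> lti E; apply: (nth_code_eq (x0 := ord0) Hl); rewrite ?sl // permM -E permK.
  exists (g * k^-1), k; split=> //.
  - by rewrite groupM // groupV (subsetP sKG).
  - by rewrite mulgKV.
  - exact: fixk.
  by split; apply: fixk.
have stab h : h \in G -> nth 0 (code lab h) 0 = 0 -> nth 0 (code lab h) 1 = 1%N -> nth 0 (code lab h) 8 = 8 ->
  [\/ has_word (codes lab G) (has_orbit 5), code lab h = iota 0 10 | codes lab G frob10 /\
   code lab h \in [:: frob10; comp_seq frob10 frob10]].
  by move=> Gh; apply: (degree9_stab (clo G) Pw fix9 Pt Pi); exists h.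
have alt5 : has_word (codes lab G) (has_orbit 5) -> contains_alt G [set~ a].
  move=> w; apply: (contains_alt_prime sGX tr (isT : prime 5)); rewrite ?X9 //.
  exact: (codes_orbit ord0 Hl).
have cE : labelling (enum 'I_10) := labelling_enum 10.
have gE (A : {set {perm 'I_10}}) g s : g \in A -> code (enum 'I_10) g = s -> codes (enum 'I_10) <<A>> s.
  by move=> Ag E; exists g => //; apply: mem_gen.
have cloH (A : {set {perm 'I_10}}) : perm_closed 10 (codes (enum 'I_10) <<A>>).
  by have := codes_closed ord0 cE <<A>>%G; rewrite size_enum_ord.
have KH (A : {set {perm 'I_10}}) : [set psl28_t; psl28_w; psl28_s] \subset A ->
    {in K, forall k, codes (enum 'I_10) <<A>> (code lab k)}.
  rewrite !subUset !sub1set -andbA => /and3P[At Aw As].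
  apply: (gen_codes_sub ord0 ord0 (H := <<A>>%G) Hl cE); first by rewrite size_enum_ord.
  move=> x; rewrite !inE -orbA => /or3P[] /eqP->; rewrite ?Ct ?Cw ?Ci.
  - by apply: gE At _; apply: code_seqperm.
  - by apply: gE Aw _; apply: code_seqperm.
  - by apply: gE As _; apply: code_seqperm.
have c1 (A : {set {perm 'I_10}}) : codes (enum 'I_10) <<A>> (iota 0 10).
  by exists 1; rewrite ?group1 // (code1 ord0 cE) size_enum_ord.
have [/exists_inP[f Gf /eqP Cf]|nf] := boolP [exists f in G, code lab f == frob10].
  have Pf : codes lab G frob10 by exists f.
  have [/exists_inP[h Gh /and4P[/eqP h0 /eqP h1 /eqP h8 nh]]|] := boolP [exists h in G,
      [&& nth 0 (code lab h) 0 == 0, nth 0 (code lab h) 1 == 1%N, nth 0 (code lab h) 8 == 8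
        & code lab h \notin [:: iota 0 10; frob10; comp_seq frob10 frob10]]].
    have [|E|[_ E]] := stab h Gh h0 h1 h8; first by move/alt5; constructor 1.
      by move: nh; rewrite E inE eqxx.
    by move: nh; rewrite inE E orbT.
  rewrite negb_exists_in => /forall_inP good.
  constructor 3; apply: (codes_perm_isomorphic Hl); set A := [set psl28_t; psl28_w; psl28_s; pgl28_f].
  have Hf : codes (enum 'I_10) <<A>> frob10.
    by apply: (gE A pgl28_f); [rewrite !inE eqxx ?orbT | apply: code_seqperm].
  move=> s; split=> [[h Hh <-]|[g Gg <-]].
    apply: (gen_codes_sub ord0 ord0 cE Hl _ _ Hh); first by rewrite size_enum_ord.
    by move=> x; rewrite !inE -!orbA => /or4P[] /eqP->; rewrite code_seqperm.
  have [h [k [Gh Kk -> h0 [h1 h8]]]] := quot g Gg.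
  rewrite (code_comp ord0 Hl); apply: (pc_comp (cloH A)); last first.
    by apply: KH Kk; apply: subsetUl.
  have := good h Gh; rewrite h0 h1 h8 /= negbK !inE => /or3P[] /eqP->; [exact: c1 | exact: Hf |].
  exact: (pc_comp (cloH A) Hf Hf).
have [/exists_inP[h Gh /and4P[/eqP h0 /eqP h1 /eqP h8 nh]]|] := boolP [exists h in G,
      [&& nth 0 (code lab h) 0 == 0, nth 0 (code lab h) 1 == 1%N, nth 0 (code lab h) 8 == 8
        & code lab h != iota 0 10]].
  have [|E|[[f Gf Cf] _]] := stab h Gh h0 h1 h8; first by move/alt5; constructor 1.
    by rewrite E eqxx in nh.
  by case/exists_inP: nf; exists f; rewrite ?Cf.
rewrite negb_exists_in => /forall_inP good.
constructor 2; apply: (codes_perm_isomorphic Hl) => s; split=> [[h Hh <-]|[g Gg <-]].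
  apply: (gen_codes_sub ord0 ord0 cE Hl _ _ Hh); first by rewrite size_enum_ord.
  by move=> x; rewrite !inE -!orbA => /or3P[] /eqP->; rewrite code_seqperm.
have [h [k [Gh Kk -> h0 [h1 h8]]]] := quot g Gg.
rewrite (code_comp ord0 Hl); apply: (pc_comp (cloH _)); last by apply: KH Kk.
by have := good h Gh; rewrite h0 h1 h8 /= negbK => /eqP->; apply: c1.
Qed.

Lemma degree_9_cases (G : {group {perm 'I_10}}) a : G \subset 'C(~: [set~ a] | 'P) ->
    [transitive G, on [set~ a] | 'P] -> 7 %| #|G| ->
  [\/ contains_alt G [set~ a], perm_isomorphic PSL28_fix G | perm_isomorphic PGammaL28_fix G].
Proof.
move=> sGX tr G7; have X9 : #|[set~ a]| = 9 by rewrite cardsC1 card_ord.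
have ltX : #|[set~ a]| < 7.*2 by rewrite X9.
have [c Gc [mc oc]] := prime_cycle_exists sGX (isT : prime 7) ltX G7.
have := prime_cycle_transitivity sGX tr (isT : prime 7) ltX Gc mc oc; rewrite X9 => tr3.
have sm : moved c \subset [set~ a] by apply: moved_sub; apply: subsetP sGX _ Gc.
have card_F : #|[set~ a] :\: moved c| = 2 by rewrite cardsD (setIidPr sm) mc X9.
have /cards2P[y [z [yz Eyz]]] : #|[set~ a] :\: moved c| == 2 by rewrite card_F.
have nmem x : x \notin moved c = (x \in [:: y; z; a]).
  have /setP/(_ x) := Eyz; rewrite !inE; case: (eqVneq x a) => [->|_] /=.
    by move=> _; rewrite !orbT negbK (astabCP _ _ (subsetP sGX _ Gc)) ?eqxx // !inE eqxx.
  by rewrite andbT orbF.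
have [/setDP[Xy ny] /setDP[Xz nz]] : y \in [set~ a] :\: moved c /\ z \in [set~ a] :\: moved c.
  by rewrite Eyz !inE !eqxx orbT.
have pm : prime #|moved c| by rewrite mc.
have [|||lab0 [Hl0 sl0 Fl0 Cl0]] := cycle_labelling ord0 (F := [:: y; z; a]) pm (astabC_moved c).
- by rewrite oc mc.
- by move: Xy Xz; rewrite /= !inE negb_or yz => -> ->.
- by move=> x; rewrite in_setC nmem.
rewrite mc in sl0 Fl0 Cl0; have {}Cl0 : code lab0 c = [:: 1%N; 2; 3; 4; 5; 6; 0; 7; 8; 9] by [].
have m7 : nth ord0 lab0 7 = y by have := congr1 (fun s => nth ord0 s 0) Fl0; rewrite nth_drop.
have m8 : nth ord0 lab0 8 = z by have := congr1 (fun s => nth ord0 s 1) Fl0; rewrite nth_drop.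
have m9 : nth ord0 lab0 9 = a by have := congr1 (fun s => nth ord0 s 2) Fl0; rewrite nth_drop.
set x := nth ord0 lab0 0.
have mi i : i < 7 -> nth ord0 lab0 i = (c ^+ i) x.
  elim: i => [|i IHi] lti; first by rewrite expg0 perm1.
  rewrite expgSr permM -IHi; last exact: ltnW.
  have lti10 : i < 10 by apply: leq_trans (ltnW lti) _.
  rewrite -(nth_lab_code ord0 Hl0) ?sl0 // Cl0; congr (nth _ _ _).
  by move: i lti {IHi lti10}; do 6?[case=> [_|] //].
have nXa h : h \in G -> h a = a.
  by move=> Gh; rewrite (astabCP _ _ (subsetP sGX _ Gh)) // !inE eqxx.
have Kc := mem_astabC_moved Gc.
have tF : tperm y z \in 'C(~: ([set~ a] :\: moved c) | 'P).
  by apply/astabCP => w; rewrite Eyz !inE negb_or => /andP[wy wz]; rewrite tpermD // eq_sym.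
have trF : [transitive^(#|[set~ a] :\: moved c|) G, on [set~ a] | 'P].
  by rewrite card_F; apply: ntransitive_weak tr3.
have oc' : #[c] = #|moved c| by rewrite mc.
have [u0 /setIP[Gu0 nu0] u0F] := prime_cycle_normaliser sGX sm pm Kc oc' trF tF.
have u0y : u0 y = z by rewrite u0F ?tpermL // Eyz !inE eqxx.
have u0z : u0 z = y by rewrite u0F ?tpermR // Eyz !inE eqxx orbT.
have cy : c y = y by apply: (astabCP _ _ (astabC_moved c)).
have cz : c z = z by apply: (astabCP _ _ (astabC_moved c)).
have trc := prime_cycle_atrans pm (astabC_moved c) oc'.
have mx : x \in moved c.
  rewrite inE -(nth_lab_code ord0 Hl0) ?sl0 // Cl0 nth_uniq ?sl0 //; by case: Hl0.
have mu0 : u0 x \in moved c.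
  rewrite -[_ \in _]negbK nmem !inE; apply/negP => /or3P[] /eqP E.
  - by move: ny; rewrite -u0z in E; rewrite (perm_inj E) in mx; rewrite mx in nz.
  - by rewrite -u0y in E; rewrite (perm_inj E) in mx; rewrite mx in ny.
  by rewrite -(nXa _ Gu0) in E; rewrite (perm_inj E) !inE nXa ?eqxx in mx.
have [_ /cycleP[i0 ->] Ei0] := atransP2 trc mu0 mx.
(* Correcting by a power of [c] makes [u] fix the base point [x], so that on the cycle it is
   multiplication of the exponents by [e]. *)
pose u := u0 * c ^+ i0.
have Gu : u \in G by rewrite groupM ?groupX.
have ux : u x = x by rewrite permM [RHS]Ei0.
have uy : u y = z by rewrite permM u0y permX_fix.
have uz : u z = y by rewrite permM u0z permX_fix.
have nu : u \in 'N(<[c]>) by rewrite groupM // (subsetP (normG _)) // groupX ?cycle_id.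
have : c ^ u \in <[c]> by rewrite memJ_norm ?cycle_id.
case/cyclePmin => e; rewrite oc => lte Ee.
have codeu : code lab0 u = [seq (e * i) %% 7 | i <- iota 0 7] ++ [:: 8; 7; 9].
  apply: (@eq_from_nth _ 0); first by rewrite size_code sl0.
  rewrite size_code sl0 => i lti; apply: (nth_code_eq (x0 := ord0) Hl0); rewrite ?sl0 //.
    rewrite nth_cat size_map size_iota; case: (ltnP i 7) => lt7; last first.
      by move: i lti lt7; do 10?[case=> //].
    rewrite (nth_map 0) ?size_iota //; apply: leq_trans (ltn_pmod _ (isT : 0 < 7)) _; by [].
  rewrite nth_cat size_map size_iota; case: (ltnP i 7) => lt7; last first.
    by move: i lti lt7; do 7?[case=> [//|]]; do 3?[case=> [_ _|]]; rewrite /= ?m7 ?m8 ?m9 ?nXa.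
  rewrite (nth_map 0) ?size_iota // nth_iota // add0n mi //.
  rewrite mi ?ltn_pmod // -(permJ (c ^+ i) u x) ux conjXg Ee -expgM.
  by rewrite -(expg_mod_order c (e * i)) oc.
have e0 : e != 0.
  apply: contraTneq (mx) => E; rewrite inE negbK; move: Ee; rewrite E expg0 => /eqP.
  by rewrite conjg_eq1 => /eqP->; rewrite perm1.
(* Entry [j], for [j] from 1 to 7, is the discrete logarithm of the field element [j] to base [w];
   the fixed points of [c] in the action become 0 and infinity. Thus [c] becomes [x -> w x]. *)
have sigma_perm : perm_eq [:: 7; 0; 1%N; 3; 2; 6; 4; 5; 8; 9] (iota 0 (size lab0)) by rewrite sl0.
have := relabelling ord0 Hl0 sigma_perm; set lab := [seq _ | i <- _]; case=> Hl sl Cl.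
rewrite sl0 in sl.
have l9 : nth ord0 lab 9 = a by rewrite (nth_map 0).
clearbody lab.
have Pw : codes lab G scal10 by exists c; rewrite // Cl Cl0.
have clo : perm_closed 10 (codes lab G) by have := codes_closed ord0 Hl G; rewrite sl.
have Gu3 : u ^+ 3 \in G by rewrite groupX.
(* Modulo 7, [e ^ 3] is 1 or -1. As [u ^+ 3] still exchanges 0 and infinity, it is a transposition
   in the first case and [x -> 1/x] in the second. *)
have [Pi|swp] : codes lab G inv10 \/ code lab (u ^+ 3) = swap10.
  have := Cl u; rewrite codeu.
  have E3 : code lab (u ^+ 3) = iter 3 (comp_seq (code lab u)) (iota 0 10).
    by rewrite (code_expg ord0 Hl) sl.
  move: e lte e0 {Ee codeu}; do 7?[case=> [|]] => // _ _ Cu; rewrite {}Cu in E3.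
  - by right.
  - by right.
  - by left; exists (u ^+ 3).
  - by right.
  - by left; exists (u ^+ 3).
  - by left; exists (u ^+ 3).
- have lneq i j : i < 10 -> j < 10 -> i != j -> nth ord0 lab i != nth ord0 lab j.
    by move=> lti ltj; rewrite nth_uniq ?sl //; case: Hl.
  have lX i : i < 9 -> nth ord0 lab i \in [set~ a].
    by move=> lti; rewrite !inE -l9 lneq // ?ltn_eqF // ltnW.
  have fix9 s : codes lab G s -> nth 0 s 9 = 9.
    by case=> h Gh <-; apply: (nth_code_eq (x0 := ord0) Hl); rewrite ?sl // l9 nXa.
  have [g Gg [g0 g1 g8]] : exists2 g, g \in G & [/\ g (nth ord0 lab 0) = nth ord0 lab 1,
      g (nth ord0 lab 1) = nth ord0 lab 0 & g (nth ord0 lab 8) = nth ord0 lab 8].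
    by apply: (ntransitive3P tr3); split; rewrite ?lX //= !inE !negb_or !lneq.
  have Pg : codes lab G (code lab g) by exists g.
  have cg i j : i < 10 -> j < 10 -> g (nth ord0 lab i) = nth ord0 lab j -> nth 0 (code lab g) i = j.
    by move=> lti ltj; apply: nth_code_eq; rewrite ?sl.
  have [w|Pt|] := degree9_generators clo Pw fix9 Pi Pg (cg 0 1%N isT isT g0) (cg 1%N 0 isT isT g1) (cg 8 8 isT isT g8).
  + constructor 1; apply: (contains_alt_prime sGX tr (isT : prime 5)); rewrite ?X9 //.
    exact: (codes_orbit ord0 Hl).
  + exact: degree_9_iso Pt Pw Pi.
  (* Exchanging the labels of 0 and infinity turns this case into the preceding one and leaves
     [scal10] and [inv10] unchanged. *)
  case=> t Gt Ct.
  have swap_perm : perm_eq swap10 (iota 0 (size lab)) by rewrite sl.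
  have := relabelling ord0 Hl swap_perm; set lab2 := [seq _ | i <- swap10]; case=> Hl2 sl2 Cl2.
  apply: (degree_9_iso sGX tr Hl2); rewrite ?sl2 //.
  + by exists t; rewrite // Cl2 Ct; vm_compute.
  + by case: Pw => w Gw Cw; exists w; rewrite // Cl2 Cw.
  + by case: Pi => w Gw Cw; exists w; rewrite // Cl2 Cw.
have m2 : #|moved (u ^+ 3)| = 2 by rewrite /moved (card_moved ord0 Hl) swp sl.
have [p [q [pq E]]] := moved2_tperm m2.
have mp w : w \in [:: p; q] -> w \in [set~ a].
  rewrite !inE => wpq; apply: contraNneq pq => wa; apply/eqP.
  have := nXa _ Gu3; rewrite E -wa; case/orP: wpq => /eqP->; rewrite ?tpermL ?tpermR => ->; by [].
constructor 1; apply: (contains_alt_tperm (ntransitive_weak _ tr3) (x := p) (y := q)) => //.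
- by apply: mp; rewrite !inE eqxx.
- by apply: mp; rewrite !inE eqxx orbT.
by rewrite -E.
Qed.

(** * Uniform partitions *)

Lemma imset_permI (T : finType) (g : {perm T}) (A B : {set T}) :
  g @: (A :&: B) = g @: A :&: g @: B.
Proof.
apply/setP => x; rewrite -[x](permKV g) inE !(mem_imset _ _ (@perm_inj _ g)).
by rewrite inE.
Qed.

(** Convexity: the sum of squares grows when the larger number gains what the smaller loses. The
    sizes are [p + 1] and [q] before the exchange, [p] and [q + 1] after it; [r] collects the other
    blocks. *)
Lemma swap_squares (p q r : nat) : p < q -> (p ^ 2 + (q.+1 ^ 2 + r))%N = (p.+1 ^ 2 + (q ^ 2 + r))%N -> False.
Proof. rewrite -!mulnn; nia. Qed.

Section UniformPartitions.
Variables (n k m : nat) (hk : 1 < k) (hn : n = (k * m)%N).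
Implicit Types (P Q : {set {set 'I_n}}) (G : {group {perm 'I_n}}) (g s : {perm 'I_n}).

Definition uniform_partition P := partition P [set: 'I_n] && [forall A in P, #|A| == k].

Definition image_partition g P := [set g @: (A : {set 'I_n}) | A in P].

Lemma uniform_partition_card P : uniform_partition P -> #|P| = m.
Proof.
case/andP => pP /forall_inP uP; have := card_uniform_partition (n := k) (P := P) (D := setT).
have -> : #|[set: 'I_n]| = (k * m)%N by rewrite cardsT card_ord.
move/(_ _ pP) => H; have {}H : (k * m = #|P| * k)%N by apply: H => A /uP/eqP.
by apply/eqP; rewrite -(@eqn_pmul2l k) ?(ltnW hk) // H mulnC.
Qed.

Lemma uniform_partition_block P A : uniform_partition P -> A \in P -> #|A| = k.
Proof. by case/andP => _ /forall_inP uP /uP/eqP. Qed.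

Lemma uniform_partition_cover P x : uniform_partition P -> exists2 A, A \in P & x \in A.
Proof.
case/andP => /and3P[/eqP cP _ _] _; have : x \in cover P by rewrite cP inE.
by case/bigcupP => A; exists A.
Qed.

Lemma uniform_partition_eq P A B x : uniform_partition P -> A \in P -> B \in P ->
  x \in A -> x \in B -> A = B.
Proof.
case/andP => /and3P[_ /trivIsetP tP _] _ PA PB Ax Bx; apply/eqP; apply: contraTT Ax => AB.
by apply/negP => Ax; have /pred0P/(_ x) := tP A B PA PB AB; rewrite /= Ax Bx.
Qed.

Lemma ordered_partition_set (A : 'I_m -> {set 'I_n}) : ordered_partition_of_type k A ->
  uniform_partition [set A i | i : 'I_m] /\ injective A.
Proof.
case=> [cA [dA coA]]; split; last first.
  move=> i j Eij; apply/eqP; apply: contraT => /dA; rewrite Eij -setI_eq0 setIid => /eqP E.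
  by have := cA j; rewrite E cards0 => E0; have := hk; rewrite -E0.
apply/andP; split; last by apply/forall_inP => _ /imsetP[i _ ->]; rewrite cA.
apply/and3P; split.
- by rewrite /cover big_imset_idem /= ?coA // => U; rewrite ?setUid // coA.
- apply/trivIsetP => _ _ /imsetP[i _ ->] /imsetP[j _ ->] nij; apply: dA.
  by apply: contraNneq nij => ->.
apply/imsetP => -[i _ E]; have := cA i; rewrite -E cards0 => E0.
by have := hk; rewrite -E0.
Qed.

Lemma uniform_partition_ordered P : uniform_partition P ->
  exists2 A : 'I_m -> {set 'I_n}, ordered_partition_of_type k A & P = [set A i | i : 'I_m].
Proof.
move=> uP; have cP := uniform_partition_card uP.
pose A (i : 'I_m) : {set 'I_n} := enum_val (cast_ord (esym cP) i).
have PA i : A i \in P by apply: enum_valP.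
have EP : P = [set A i | i : 'I_m].
  apply/setP => B; apply/idP/imsetP => [PB|[i _ ->] //].
  exists (cast_ord cP (enum_rank_in PB B)) => //.
  by rewrite /A cast_ordK enum_rankK_in.
exists A => //; split; first by move=> i; apply: uniform_partition_block (PA i).
split=> [i j ij|].
  have /andP[/and3P[_ /trivIsetP tP _] _] := uP; apply: tP => //.
  by apply: contraNneq ij => /enum_val_inj/cast_ord_inj ->.
apply/setP => x; rewrite [RHS]inE; have [B] := uniform_partition_cover x uP.
by rewrite {1}EP => /imsetP[i _ ->] Aix; apply/bigcupP; exists i.
Qed.

Lemma uniform_partition_image P g : uniform_partition P -> uniform_partition (image_partition g P).
Proof.
move=> uP; have /andP[/and3P[_ /trivIsetP tP _] _] := uP; apply/andP; split; last first.
  apply/forall_inP => _ /imsetP[A PA ->]; rewrite card_imset_perm.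
  by rewrite (uniform_partition_block uP PA).
apply/and3P; split.
- rewrite eqEsubset subsetT; apply/subsetP => x _; have [A PA Ax] := uniform_partition_cover (g^-1 x) uP.
  apply/bigcupP; exists (g @: A); first exact: imset_f.
  by apply/imsetP; exists (g^-1 x); rewrite ?permKV.
- apply/trivIsetP => _ _ /imsetP[A PA ->] /imsetP[B PB ->] nAB.
  have nAB' : A != B by apply: contraNneq nAB => ->.
  have := tP A B PA PB nAB'; rewrite -!setI_eq0 -imset_permI => /eqP->.
  by rewrite imset0.
apply/imsetP => -[A PA E]; have := uniform_partition_block uP PA.
by rewrite -(card_imset_perm g) -E cards0 => E0; have := hk; rewrite -E0.
Qed.

Lemma uniform_partition_exists : exists P, uniform_partition P.
Proof.
pose A (i : 'I_m) := [set x : 'I_n | x %/ k == i :> nat].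
have k0 : 0 < k := ltnW hk.
suff oA : ordered_partition_of_type k A.
  by exists [set A i | i : 'I_m]; case: (ordered_partition_set oA).
split; last split.
- move=> i; have lt (j : 'I_k) : (i * k + j < n)%N.
    rewrite hn [X in (_ < X)%N]mulnC; apply: leq_trans (_ : (i.+1 * k <= _)%N).
      by rewrite mulSn addnC ltn_add2r ltn_ord.
    by rewrite leq_mul2r ltn_ord orbT.
  have -> : A i = [set Ordinal (lt j) | j : 'I_k].
    apply/setP => x; rewrite inE; apply/eqP/imsetP => [E|[j _ ->] /=].
      exists (Ordinal (ltn_pmod x k0)) => //; apply: val_inj => /=.
      by rewrite -E -divn_eq.
    by rewrite divnMDl // divn_small ?addn0.
  rewrite card_imset ?card_ord // => j1 j2 /(congr1 val)/= /addnI; exact: val_inj.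
- move=> i j ij; rewrite -setI_eq0; apply/eqP/setP => x; rewrite !inE.
  by apply/negP => /andP[/eqP-> /eqP/val_inj E]; rewrite E eqxx in ij.
apply/setP => x; rewrite inE; apply/bigcupP.
have lt : (x %/ k < m)%N by rewrite ltn_divLR // mulnC -hn ltn_ord.
by exists (Ordinal lt); rewrite ?inE.
Qed.

Definition partition_transitive G := forall P Q, uniform_partition P -> uniform_partition Q ->
  exists2 g, g \in G & image_partition g P = Q.

Lemma homogeneous_partition_transitive G : lambda_homogeneous k m G -> partition_transitive G.
Proof.
move=> homG P Q /uniform_partition_ordered[A oA ->] /uniform_partition_ordered[B oB ->].
have [g Gg E] := homG A B oA oB; exists g => //.
by rewrite -E /image_partition -imset_comp.
Qed.

Lemma homogeneous_invariant G (D : {set 'I_n}) : 1 < m -> partition_transitive G ->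
    (forall g, g \in G -> g @: D = D) ->
  (#|D| <= 1) || (#|~: D| <= 1).
Proof.
move=> hm ptG invD; apply: contraT; rewrite negb_or -!ltnNge => /andP[/card_gt1P[x [y [Dx Dy xy]]]].
case/card_gt1P => z [w [Dz Dw zw]].
(* [phi] is constant on uniform partitions, but exchanging a point of [D] with a
   point outside [D] between two blocks changes it. *)
pose phi P := \sum_(A in P) #|A :&: D| ^ 2.
have im_inj g : injective (fun A : {set 'I_n} => g @: A).
  exact: (imset_inj (@perm_inj _ g)).
have phi_im g P : phi (image_partition g P) = \sum_(A in P) #|g @: A :&: D| ^ 2.
  by rewrite /phi big_imset //= => A B _ _ /im_inj.
have phiG P Q : uniform_partition P -> uniform_partition Q -> phi P = phi Q.
  move=> uP uQ; have [g Gg <-] := ptG P Q uP uQ; rewrite phi_im; apply: eq_bigr => A _.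
  have -> : g @: A :&: D = g @: (A :&: D) by rewrite imset_permI invD.
  by rewrite card_imset_perm.
(* The symmetric group is 4-transitive, so some uniform partition puts a point of [D] and a point
   outside [D] into each of two blocks. An exchange is then possible in either direction. *)
have [P [uP [A1 [A2 [[PA1 PA2 A12] [x1 z1 y2 w2]]]]]] : exists P, uniform_partition P /\
    exists A1 A2, [/\ A1 \in P, A2 \in P & A1 != A2] /\ [/\ x \in A1, z \in A1, y \in A2 & w \in A2].
  have [P0 uP0] := uniform_partition_exists.
  have /card_gt1P[B1 [B2 [PB1 PB2 B12]]] : 1 < #|P0| by rewrite uniform_partition_card.
  have /card_gt1P[p1 [p2 [Bp1 Bp2 p12]]] : 1 < #|B1| by rewrite (uniform_partition_block uP0).
  have /card_gt1P[q1 [q2 [Bq1 Bq2 q12]]] : 1 < #|B2| by rewrite (uniform_partition_block uP0).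
  have pq p q : p \in B1 -> q \in B2 -> p != q.
    move=> Bp Bq; apply: contraNneq B12 => E; rewrite E in Bp.
    by rewrite (uniform_partition_eq uP0 PB1 PB2 Bp Bq).
  have DnD u v : u \in D -> v \in ~: D -> u != v.
    by move=> Du; rewrite inE; apply: contraNneq => <-.
  have tr4 : [transitive^4 'Sym_('I_n), on [set: 'I_n] | 'P].
    apply: ntransitive_weak (Sym_trans _); rewrite card_ord hn.
    by apply: (@leq_trans (2 * 2)); rewrite // leq_mul.
  have d4 (a b c d : 'I_n) : uniq [:: a; b; c; d] -> [tuple a; b; c; d] \in 4.-dtuple([set: 'I_n]).
    by move=> U; rewrite inE U; apply/subsetP => ?; rewrite inE.
  have U1 : uniq [:: p1; p2; q1; q2].
    by rewrite /= !inE !negb_or p12 q12 !pq.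
  have U2 : uniq [:: x; z; y; w].
    have zy : z != y by rewrite eq_sym DnD.
    by rewrite /= !inE !negb_or xy zw zy (DnD x z) // (DnD x w) // (DnD y w).
  have [s _ [Ex Ez Ey Ew]] := atransP2 tr4 (d4 _ _ _ _ U1) (d4 _ _ _ _ U2).
  exists (image_partition s P0); split; first exact: uniform_partition_image.
  exists (s @: B1), (s @: B2); split; last first.
    by rewrite Ex Ey Ez Ew; split; apply: imset_f.
  by rewrite !imset_f // (inj_eq (@im_inj s)).
(* The point of [D] goes from the block meeting [D] in no more points to the other one, so the sum
   of squares strictly increases. *)
have swap (x' w' : 'I_n) A B : A \in P -> B \in P -> A != B -> x' \in A -> w' \in B ->
    x' \in D -> w' \notin D -> #|A :&: D| <= #|B :&: D| -> False.
  move=> PA PB nAB Ax Bw Dx' nDw le; pose t := tperm x' w'.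
  have := phiG (image_partition t P) P (uniform_partition_image _ uP) uP.
  rewrite phi_im /phi (bigD1 A) //= (bigD1 B) ?PB 1?eq_sym //= [RHS](bigD1 A) //= [in RHS](bigD1 B) ?PB 1?eq_sym //=.
  have nBx : x' \notin B.
    by apply: contra nAB => Bx; rewrite (uniform_partition_eq uP PA PB Ax Bx).
  have nAw : w' \notin A.
    by apply: contra nAB => Aw; rewrite (uniform_partition_eq uP PA PB Aw Bw).
  have mt (C : {set 'I_n}) u : (u \in t @: C) = (t u \in C).
    by rewrite -{1}[u](tpermK x' w') mem_imset //; apply: perm_inj.
  have -> : t @: A :&: D = (A :&: D) :\ x'.
    apply/setP => u; rewrite !inE mt; case: tpermP => [->|->|/eqP ux /eqP uw].
    - by rewrite (negPf nAw) eqxx.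
    - by rewrite (negPf nDw) !andbF.
    - by rewrite ux.
  have -> : t @: B :&: D = x' |: (B :&: D).
    apply/setP => u; rewrite !inE mt; case: tpermP => [->|->|/eqP ux /eqP uw].
    - by rewrite Bw Dx' eqxx.
    - by rewrite (negPf nDw) !andbF orbF; apply/esym/negP => /eqP E; rewrite E Dx' in nDw.
    - by rewrite (negPf ux).
  rewrite (eq_bigr (fun C : {set 'I_n} => (#|C :&: D| ^ 2)%N)) => [|C /andP[/andP[PC CA] CB]]; last first.
    suff -> : t @: C = C by [].
    apply/setP => u; rewrite mt; case: tpermP => [->|->|//].
    - apply/idP/idP => [Cw|Cx].
        by rewrite (uniform_partition_eq uP PC PB Cw Bw) eqxx in CB.
      by rewrite (uniform_partition_eq uP PC PA Cx Ax) eqxx in CA.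
    - apply/idP/idP => [Cx|Cw].
        by rewrite (uniform_partition_eq uP PC PA Cx Ax) eqxx in CA.
      by rewrite (uniform_partition_eq uP PC PB Cw Bw) eqxx in CB.
  rewrite cardsU1 !inE (negPf nBx) /= add1n.
  have := cardsD1 x' (A :&: D); rewrite !inE Ax Dx' /= add1n => Ec.
  by move: le; rewrite Ec; apply: swap_squares.
have [le|lt] := leqP #|A1 :&: D| #|A2 :&: D|.
  by case: (swap x w A1 A2) => //; move: Dw; rewrite inE.
case: (swap y z A2 A1) => //; rewrite ?(eq_sym A2) // 1?ltnW //.
by move: Dz; rewrite inE.
Qed.

(** Orbits are invariant sets, so each has at most one point or misses at most one. *)
Lemma homogeneous_transitive G : 1 < m -> partition_transitive G ->
  [transitive G, on [set: 'I_n] | 'P] \/ exists a, G \subset 'C(~: [set~ a] | 'P) /\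
    [transitive G, on [set~ a] | 'P].
Proof.
move=> hm ptG.
have n4 : 4 <= n by rewrite hn (@leq_trans (2 * 2)) // leq_mul.
have orb x g : g \in G -> g @: orbit 'P G x = orbit 'P G x.
  move=> Gg; apply/eqP; rewrite eqEcard card_imset_perm leqnn andbT.
  by apply/subsetP => _ /imsetP[y yx ->]; rewrite -[g y]/('P%act y g) orbit_actr.
have trorb x : [transitive G, on orbit 'P G x | 'P] by apply: atrans_orbit.
have fixC x : orbit 'P G x = [set x] -> G \subset 'C(~: [set~ x] | 'P).
  move=> E; apply/subsetP => g Gg; apply/astabCP => y; rewrite !inE negbK => /eqP->.
  by have : g x \in orbit 'P G x; [apply: (mem_orbit 'P) | rewrite E => /set1P].
have n0 : 0 < n by apply: leq_trans n4.
pose x0 := Ordinal n0; have := homogeneous_invariant hm ptG (orb x0); case/orP => le.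
  have Ex0 : orbit 'P G x0 = [set x0].
    by apply/eqP; rewrite eq_sym eqEcard sub1set orbit_refl cards1.
  right; exists x0; split; first exact: fixC.
  have n1 : 1 < n by apply: leq_trans n4.
  pose y0 := Ordinal n1; have := homogeneous_invariant hm ptG (orb y0); case/orP => ley.
    have Ey0 : orbit 'P G y0 = [set y0].
      by apply/eqP; rewrite eq_sym eqEcard sub1set orbit_refl cards1.
    (* Two fixed points would form an invariant pair whose complement has at least two points, as
       [n >= 4]. *)
    have U2 : #|[set x0; y0]| = 2 by rewrite cards2.
    have := cardsC [set x0; y0]; rewrite U2 card_ord => EC.
    have invU g : g \in G -> g @: [set x0; y0] = [set x0; y0].
      move=> Gg; rewrite imsetU !imset_set1.
      rewrite (astabCP _ _ (subsetP (fixC _ Ex0) _ Gg)) ?inE ?eqxx //.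
      by rewrite (astabCP _ _ (subsetP (fixC _ Ey0) _ Gg)) ?inE ?eqxx.
    have := homogeneous_invariant hm ptG invU; rewrite U2 /= => bad.
    have : 2 + #|~: [set x0; y0]| <= 3 by rewrite (leq_add2l 2 _ 1).
    by rewrite EC leqNgt n4.
  suff <- : orbit 'P G y0 = [set~ x0] by [].
  apply/eqP; rewrite eqEsubset; apply/andP; split.
    apply/subsetP => y; rewrite orbit_sym !inE => yy; apply: contraTneq yy => ->.
    by rewrite -orbit_sym orbit_sym Ex0 inE.
  apply/subsetP => y; rewrite !inE => yx; apply: contraT => ny.
  suff : 1 < #|~: orbit 'P G y0| by rewrite ltnNge ley.
  apply/card_gt1P; exists x0, y; rewrite !inE ny eq_sym yx; split=> //.
  by rewrite orbit_sym Ex0 inE.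
have [E|[a na]] : orbit 'P G x0 = setT \/ exists a, a \notin orbit 'P G x0.
  have [sT|/subsetPn[a _ na]] := boolP (setT \subset orbit 'P G x0); last by right; exists a.
  by left; apply/eqP; rewrite -subTset.
- by left; rewrite -E.
right; exists a.
have EC : ~: orbit 'P G x0 = [set a].
  by apply/eqP; rewrite eq_sym eqEcard sub1set inE na cards1.
have EO : orbit 'P G x0 = [set~ a] by rewrite -EC setCK.
split; last by rewrite -EO.
apply/subsetP => g Gg; apply/astabCP => y; rewrite !inE negbK => /eqP->.
have : g a \notin orbit 'P G x0.
  by rewrite -[g a]/('P%act a g) orbit_sym orbit_act // orbit_sym.
by rewrite EO !inE negbK => /eqP.
Qed.

(* The orbit of a partition under [G] is its orbit under the symmetric group of
   [X], and no [p]-element of the latter fixes a partition: it would fix every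
   block, and then every point. *)
Lemma homogeneous_prime_dvd G X p : partition_transitive G -> G \subset 'C(~: X | 'P) -> prime p ->
    k < p -> p <= #|X| -> (m < p) \/ (exists2 a, X = [set~ a] & m <= p) ->
  p %| #|G|.
Proof.
move=> ptG sGX pp ltk leX hmp; have [P uP] := uniform_partition_exists.
pose S := 'C(~: X | 'P)%G; pose to := ('P^*^*)%act : action [set: {perm 'I_n}] {set {set 'I_n}}.
have toE Q g : to Q g = image_partition g Q.
  by [].
have oGS : orbit to G P = orbit to S P.
  apply/eqP; rewrite eqEsubset imsetS //=; apply/subsetP => _ /imsetP[s _ ->].
  rewrite toE; have [g Gg <-] := ptG P _ uP (uniform_partition_image s uP).
  by rewrite -toE; apply: mem_orbit.
apply: dvdn_trans (dvdn_orbit to G P); rewrite oGS.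
have pS : p %| #|S| by rewrite /S /= -SymE perm.card_Sym dvdn_fact // prime_gt0.
have := card_orbit_stab to S P; rewrite -/S => E; move: pS; rewrite -E Euclid_dvdM //.
case/orP => // /(Cauchy pp)[s /setIP[Ss /astab1P]]; rewrite toE => sP os.
have s1 : s != 1 by rewrite -order_eq1 os neq_ltn prime_gt1 ?orbT.
have dvd_p (rT : finType) (act : {action {perm 'I_n} &-> rT}) (x : rT) : act x s != x -> #|orbit act <[s]> x| = p.
  move=> sx; have := dvdn_orbit act <[s]> x; rewrite -orderE os; case/primeP: pp => _ /[apply].
  case/orP => [/eqP/card_orbit1/setP/(_ (act x s))|/eqP //].
  by rewrite inE (negPf sx) (mem_orbit act) ?cycle_id.
have blk A : A \in P -> s @: A \in P by move=> PA; rewrite -sP; apply: imset_f.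
have blki A i : A \in P -> ('P^*)%act A (s ^+ i) \in P.
  move=> PA; elim: i => [|i IHi]; first by rewrite expg0 act1.
  by rewrite expgSr actM; apply: blk IHi.
have sA A : A \in P -> s @: A = A.
  move=> PA; apply/eqP; apply: contraT => nA.
  have nA' : ('P^*)%act A s != A := nA.
  have oP : orbit ('P^*)%act <[s]> A \subset P by apply/subsetP => _ /imsetP[_ /cycleP[i ->] ->]; apply: blki.
  have := subset_leq_card oP; rewrite (dvd_p _ ('P^*)%act) // (uniform_partition_card uP).
  (* When [X] omits [a], the block containing [a] is fixed, and an orbit of [p] blocks would have to
     fit into the other [m - 1]; this admits [m = p]. *)
  case: hmp => [lt|[a EX lem]]; first by rewrite leqNgt lt.
  have [B PB Ba] := uniform_partition_cover a uP.
  have sa : s a = a by apply: (astabCP _ _ Ss); rewrite EX !inE eqxx.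
  have sB : s @: B = B.
    apply: (uniform_partition_eq (x := a) uP) => //; first exact: blk.
    by rewrite -sa imset_f.
  move=> _; have : orbit ('P^*)%act <[s]> A \subset P :\ B.
    rewrite subsetD1 oP; apply: contra nA => /imsetP[_ /cycleP[i ->] E'].
    have fixB : ('P^*)%act B s = B := sB.
    have fixBi j : ('P^*)%act B (s ^+ j) = B.
      by elim: j => [|j IHj]; rewrite ?expg0 ?act1 // expgSr actM IHj.
    suff -> : A = B by rewrite sB.
    by apply: (act_inj ('P^*)%act (s ^+ i)); rewrite -E' fixBi.
  move/subset_leq_card; rewrite (dvd_p _ ('P^*)%act) //.
  have := cardsD1 B P; rewrite PB (uniform_partition_card uP) add1n => Em.
  by rewrite Em in lem; move/(leq_trans lem); rewrite ltnn.
case/eqP: s1; apply/permP => x; rewrite perm1; apply/eqP; apply: contraT => sx.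
have [A PA Ax] := uniform_partition_cover x uP.
have : orbit 'P <[s]> x \subset A.
  apply/subsetP => _ /imsetP[_ /cycleP[i ->] ->]; rewrite /= /aperm.
  elim: i => [|i IHi]; first by rewrite expg0 perm1.
  by rewrite expgSr permM -(sA A PA) imset_f.
move/subset_leq_card; rewrite (dvd_p _ 'P%act) // (uniform_partition_block uP PA).
by rewrite leqNgt ltk.
Qed.

(** Some permutation maps the blocks as required; a transposition inside a block, available since
    [k > 1], corrects its parity. *)
Lemma contains_alt_transitive G : 0 < m -> contains_alt G [set: 'I_n] -> lambda_transitive k m G.
Proof.
move=> hm altG A B oA oB.
have [cA [dA coA]] := oA; have [cB [dB coB]] := oB.
have n0 : 0 < n by rewrite hn muln_gt0 (ltnW hk).
pose x0 := Ordinal n0; pose F (C : 'I_m -> {set 'I_n}) (u : 'I_m * 'I_k) := nth x0 (enum (C u.1)) u.2.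
have memF C (u : 'I_m * 'I_k) : ordered_partition_of_type k C -> F C u \in C u.1.
  by case=> cC _; rewrite -mem_enum mem_nth // -cardE cC.
have injF C : ordered_partition_of_type k C -> injective (F C).
  move=> oC [i j] [i' j'] E; have [cC [dC _]] := oC.
  have Ei : i = i'.
    apply/eqP; apply: contraT => /dC /pred0P/(_ (F C (i, j))).
    by rewrite /= {2}E !memF.
  rewrite -{}Ei in E *; congr (_, _); apply: val_inj; apply/eqP.
  by move/eqP: E; rewrite /F /= nth_uniq ?enum_uniq -?cardE ?cC.
have bijA : bijective (F A).
  by apply: inj_card_bij; [exact: injF | rewrite card_prod !card_ord hn mulnC].
have [FA' FA'K FAK] := bijA.
have inj_s : injective (F B \o FA') by apply: inj_comp; [exact: injF | exact: can_inj FAK].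
pose s := perm inj_s.
have sAB i : s @: A i = B i.
  apply/eqP; rewrite eqEcard card_imset_perm cA cB leqnn andbT.
  apply/subsetP => _ /imsetP[x Aix ->]; rewrite permE /=.
  have := memF A (FA' x) oA; rewrite FAK => Ax.
  have <- : (FA' x).1 = i; last exact: memF.
  by apply/eqP; apply: contraT => /dA /pred0P/(_ x); rewrite /= Aix Ax.
have memT t : t \in 'C(~: [set: 'I_n] | 'P) by apply/astabCP => x; rewrite inE.
have [odd_s|even_s] := boolP (odd_perm s); last by exists s; rewrite // altG.
have /card_gt1P[x [y [Ax Ay xy]]] : 1 < #|A (Ordinal hm)| by rewrite cA.
exists (tperm x y * s); first by rewrite altG // odd_permM odd_tperm xy odd_s.
move=> i; rewrite imsetM.
suff -> : tperm x y @: A i = A i by [].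
have [<-|ni] := eqVneq (Ordinal hm) i.
  apply/eqP; rewrite eqEcard card_imset_perm leqnn andbT.
  by apply/subsetP => _ /imsetP[z Az ->]; case: tpermP => // ->.
have nin z : z \in A (Ordinal hm) -> z \notin A i.
  by move=> Az; apply/negP => Aiz; have /pred0P/(_ z) := dA _ _ ni; rewrite /= Az Aiz.
apply/eqP; rewrite eqEcard card_imset_perm leqnn andbT.
apply/subsetP => _ /imsetP[z Az ->]; rewrite tpermD //.
  by apply: contraTneq Az => <-; apply: nin.
by apply: contraTneq Az => <-; apply: nin.
Qed.

End UniformPartitions.

Lemma contains_alt_fixing n (G : {group {perm 'I_n}}) a : G \subset 'C(~: [set~ a] | 'P) ->
  contains_alt G [set~ a] ->
  G :=: [set g : {perm 'I_n} | g a == a] \/ G :=: [set g : {perm 'I_n} | g a == a] :&: ('Alt_('I_n))%g.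
Proof.
move=> sGX altG.
have fixa (g : {perm 'I_n}) : (g a == a) = (g \in 'C(~: [set~ a] | 'P)).
  apply/eqP/astabCP => [ga x|-> //]; last by rewrite !inE eqxx.
  by rewrite !inE negbK => /eqP->.
have memX (g : {perm 'I_n}) : (g \in [set g : {perm 'I_n} | g a == a]) = (g \in 'C(~: [set~ a] | 'P)).
  by rewrite in_set fixa.
have [sGA|/subsetPn[h Gh oh]] := boolP (G \subset 'Alt_('I_n)); [right|left]; apply/setP => g.
  rewrite in_setI memX; apply/idP/andP => [Gg|[gX gA]].
    by split; [apply: subsetP sGX _ Gg | apply: subsetP sGA _ Gg].
  by apply: altG; rewrite // -Alt_even.
rewrite memX; apply/idP/idP => [/(subsetP sGX) //|gX].
have [og|eg] := boolP (odd_perm g); last exact: altG.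
rewrite -(mulgKV h g) groupMr // altG //.
  by rewrite groupM // groupV (subsetP sGX).
by rewrite odd_permM odd_permV og; move: oh; rewrite Alt_even negbK => ->.
Qed.

(** * The Livingstone-Wagner theorem *)

Fact addn_cross a b p q r s : (a + p = b + q -> a + r = b + s -> r + q = s + p)%N.
Proof. lia. Qed.

Fact ltn_cross a b p q : (a + q = b + p -> a < b -> p < q)%N.
Proof. lia. Qed.

Section SubsetSums.
Variable T : finType.
Implicit Types (X U S : {set T}) (f : {set T} -> nat).

Definition subset_sum f t U := (\sum_(S : {set T} | (S \subset U) && (#|S| == t)) f S)%N.

Lemma ex_subset_card X t : t <= #|X| -> exists2 U : {set T}, U \subset X & #|U| = t.
Proof.
move=> le; have : 0 < #|[set B : {set T} | B \subset X & #|B| == t]| by rewrite cards_draws bin_gt0.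
by case/card_gt0P => U; rewrite inE => /andP[sUX /eqP]; exists U.
Qed.

Lemma subset_sumU1 f t U x : x \notin U ->
  subset_sum f t.+1 (x |: U) = (subset_sum f t.+1 U + subset_sum (fun S => f (x |: S)) t U)%N.
Proof.
move=> nUx; rewrite /subset_sum (bigID (fun S : {set T} => x \in S)) /= addnC; congr (_ + _)%N.
  apply: eq_bigl => S; apply/idP/idP => [/andP[/andP[sS ->] nSx]|/andP[sSU ->]]; rewrite andbT.
    apply/subsetP => y Sy; have := subsetP sS y Sy; rewrite !inE => /orP[/eqP E|//].
    by rewrite -E Sy in nSx.
  rewrite (subset_trans sSU (subsetUr _ _)) /=; by apply: contra nUx => /(subsetP sSU).
rewrite (reindex_onto (fun S => x |: S) (fun S => S :\ x)) /=; last first.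
  by move=> S /andP[_ Sx]; rewrite setD1K.
apply: eq_bigl => S; rewrite setU11 andbT.
have [Sx|nSx] := boolP (x \in S).
  have -> : (S \subset U) = false by apply/negP => /subsetP/(_ x Sx); rewrite (negPf nUx).
  rewrite /=; apply/negP => /andP[_ /eqP E]; move: Sx; rewrite -E !inE eqxx //.
by rewrite setU1K // eqxx andbT cardsU1 nSx add1n eqSS subUset sub1set setU11 /= -subDset setDE
  (setIidPl _) // subsetC sub1set inE.
Qed.

(** Sets of equal size are joined by one-point exchanges, each reducing the difference from the
    target. *)
Lemma exchange_ind X (Q : {set T} -> Prop) :
    (forall S x y, S \subset X -> x \in S -> y \in X -> y \notin S -> Q S -> Q (y |: S :\ x)) ->
  forall S S', S \subset X -> S' \subset X -> #|S| = #|S'| -> Q S -> Q S'.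
Proof.
move=> ex S S'; elim: {S}_.+1 {-2}S (ltnSn #|S' :\: S|) => // d IHd S lt sS sS' cS QS.
have cD : #|S :\: S'| = #|S' :\: S|.
  by apply/eqP; rewrite -(eqn_add2l #|S :&: S'|) cardsID setIC cardsID cS.
have [/eqP|[y]] := set_0Vmem (S' :\: S).
  rewrite setD_eq0 => sS'S; suff -> : S' = S by [].
  by apply/eqP; rewrite eqEcard sS'S cS leqnn.
case/setDP => S'y nSy; have [/eqP|[x]] := set_0Vmem (S :\: S').
  rewrite -cards_eq0 cD cards_eq0 => /eqP/setP/(_ y); by rewrite !inE S'y nSy.
case/setDP => Sx nS'x; have Xy := subsetP sS' _ S'y.
have Qn := ex S x y sS Sx Xy nSy QS.
have nSxy : y \notin S :\ x by rewrite !inE negb_and nSy orbT.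
apply: IHd Qn => //.
- rewrite ltnS in lt; apply: leq_trans lt; apply: proper_card; apply/properP; split.
    apply/subsetP => z; rewrite !inE negb_or negb_and => /andP[/andP[zy /orP[]]].
      by rewrite negbK => /eqP-> S'x; rewrite S'x in nS'x.
    by move=> -> ->.
  by exists y; rewrite !inE ?eqxx ?S'y ?nSy //=.
- rewrite subUset sub1set Xy; apply: subset_trans sS; exact: subsetDl.
by rewrite -cS cardsU1 nSxy (cardsD1 x S) Sx.
Qed.

(* Both sides are natural-valued, which replaces the usual statement that a
   signed function with vanishing sums vanishes. *)
Lemma subset_sum_inj X t s f f' : t <= s -> t + s <= #|X| ->
    (forall U, U \subset X -> #|U| = s -> subset_sum f t U = subset_sum f' t U) ->
  forall S, S \subset X -> #|S| = t -> f S = f' S.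
Proof.
elim: t s X f f' => [|t IHt] s X f f' lets lets' Eff S sSX cS.
  have [|U sUX cU] := @ex_subset_card X s; first by apply: leq_trans lets'; rewrite leq_addl.
  have sum0 h : subset_sum h 0 U = h set0.
    rewrite /subset_sum (big_pred1 set0) // => S'; rewrite cards_eq0 /=.
    by case: eqP => [->|]; rewrite ?sub0set ?andbF.
  by have := Eff U sUX cU; rewrite !sum0 (cards0_eq cS).
case: s lets lets' Eff => // s lets lets' Eff.
(* The difference of [f] and [f'] is the same at [x |: S'] and [y |: S'], written crosswise to avoid
   subtraction. Comparing the sums over [x |: U] and [y |: U], whose common part cancels, reduces
   this to the induction hypothesis on [X] without [x] and [y]. *)
have exch x y S' : S' \subset X -> x \in X -> y \in X -> x \notin S' -> y \notin S' -> x != y ->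
    #|S'| = t -> (f (x |: S') + f' (y |: S') = f' (x |: S') + f (y |: S'))%N.
  move=> sS' Xx Xy nx ny xy cS'.
  have cX : #|X| = #|X :\ x :\ y|.+2 by rewrite (cardsD1 x) Xx (cardsD1 y (X :\ x)) !inE Xy eq_sym xy.
  apply: (IHt s (X :\ x :\ y) (fun S => f (x |: S) + f' (y |: S))%N
     (fun S => f' (x |: S) + f (y |: S))%N) => //.
  - by move: lets'; rewrite cX; lia.
  - move=> U sU cU.
    have [nUx nUy] : x \notin U /\ y \notin U.
      by split; apply/negP => /(subsetP sU); rewrite !inE eqxx ?andbF.
    have sUX : U \subset X by apply: subset_trans sU _; rewrite !subDset; apply/subsetP => z; rewrite !inE => ->; rewrite !orbT.
    have cx : #|x |: U| = s.+1 by rewrite cardsU1 nUx cU.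
    have cy : #|y |: U| = s.+1 by rewrite cardsU1 nUy cU.
    have sx : x |: U \subset X by rewrite subUset sub1set Xx.
    have sy : y |: U \subset X by rewrite subUset sub1set Xy.
    have := Eff _ sx cx; have := Eff _ sy cy; rewrite !subset_sumU1 //.
    have split h h' : subset_sum (fun S => h S + h' S)%N t U = (subset_sum h t U + subset_sum h' t U)%N.
      by rewrite /subset_sum big_split.
    by rewrite !split; apply: addn_cross.
  by apply/subsetP => z S'z; rewrite !inE (subsetP sS') // andbT; apply/andP; split;
    [apply: contraNneq ny | apply: contraNneq nx] => <-.
(* By exchanges, a strict inequality at one set spreads to all sets of that size, which contradicts
   the equal sums. *)
have strict h h' : (forall U, U \subset X -> #|U| = s.+1 -> subset_sum h t.+1 U = subset_sum h' t.+1 U) ->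
    (forall x y S', S' \subset X -> x \in X -> y \in X -> x \notin S' -> y \notin S' -> x != y ->
      #|S'| = t -> (h (x |: S') + h' (y |: S') = h' (x |: S') + h (y |: S'))%N) ->
    ~~ (h S < h' S).
  move=> Ehh ex; apply/negP => lt.
  have [|U sUX cU] := @ex_subset_card X s.+1; first by apply: leq_trans lets'; rewrite leq_addl.
  have all_lt S' : S' \subset U -> #|S'| = t.+1 -> h S' < h' S'.
    move=> sS' cS'; apply: (@exchange_ind X (fun S1 => #|S1| = t.+1 -> h S1 < h' S1) _ S S') => //.
    - move=> S1 x y sS1 S1x Xy nS1y Hlt c1.
      have nxy : y \notin S1 :\ x by rewrite !inE negb_and nS1y orbT.
      have ct : #|S1 :\ x| = t by move: c1; rewrite cardsU1 nxy => -[].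
      have c1' : #|S1| = t.+1 by rewrite (cardsD1 x) S1x ct.
      have xy : x != y by apply: contraNneq nS1y => <-.
      have := ex x y (S1 :\ x) (subset_trans (subsetDl _ _) sS1) (subsetP sS1 _ S1x) Xy _ nxy xy ct.
      rewrite setD1K // setD11 => /(_ isT).
      by move=> /ltn_cross; apply; apply: Hlt.
    - exact: subset_trans sUX.
    - by rewrite cS.
  have [|S0 sS0 cS0] := @ex_subset_card U t.+1; first by rewrite cU.
  have := Ehh U sUX cU; rewrite /subset_sum (bigD1 S0) ?sS0 ?cS0 ?eqxx //= [RHS](bigD1 S0) ?sS0 ?cS0 ?eqxx //=.
  have le : (\sum_(i : {set T} | (i \subset U) && (#|i| == t.+1) && (i != S0)) h i <=
     \sum_(i : {set T} | (i \subset U) && (#|i| == t.+1) && (i != S0)) h' i)%N.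
    by apply: leq_sum => S' /andP[/andP[sS' /eqP cS'] _]; apply: ltnW; apply: all_lt.
  have := all_lt S0 sS0 cS0; move: le; set a := (\sum_(_ | _) _)%N; set b := (\sum_(_ | _) _)%N; lia.
have := strict f f' Eff exch; have := strict f' f _ _; rewrite -!leqNgt => l1 l2.
apply/eqP; rewrite eqn_leq andbC; apply/andP; split; first exact: l2.
apply: l1 => [U sU cU|x y S' *]; first by rewrite Eff.
by rewrite exch.
Qed.

Definition set_homogeneous (G : {set {perm T}}) X t :=
  forall B C : {set T}, B \subset X -> C \subset X -> #|B| = t -> #|C| = t ->
  exists2 g, g \in G & g @: B = C.

(** Let [f] be the indicator of the orbit of [B]. Its sum over the [t]-subsets of an [s]-set is
    constant, so composing [f] with a transposition does not change these sums. By [subset_sum_inj]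
    it does not change [f] either, and exchanges reach every [C]. *)
Lemma livingstone_wagner (G : {group {perm T}}) X t s : G \subset 'C(~: X | 'P) ->
    t <= s -> t + s <= #|X| -> set_homogeneous G X s -> set_homogeneous G X t.
Proof.
move=> sGX lets letsX homs B C sBX sCX cB cC.
pose f (S : {set T}) : nat := [exists g in G, g @: B == S].
have fG g S : g \in G -> f (g @: S) = f S.
  move=> Gg; congr (nat_of_bool _); apply/exists_inP/exists_inP => -[h Gh /eqP E].
    exists (h * g^-1); first by rewrite groupM ?groupV.
    by rewrite imsetM E imset_permK.
  by exists (h * g); rewrite ?groupM // imsetM E.
have im_sum (g : {perm T}) h U : subset_sum h t (g @: U) = subset_sum (fun S => h (g @: S)) t U.
  rewrite /subset_sum (reindex_inj (imset_inj (@perm_inj _ g))) /=; apply: eq_bigl => S.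
  rewrite card_imset_perm; congr (_ && _); apply/idP/idP => [|sSU]; last exact: imsetS.
  by move/(imsetS g^-1); rewrite !imset_permK.
have fsum U U' : U \subset X -> U' \subset X -> #|U| = s -> #|U'| = s ->
    subset_sum f t U = subset_sum f t U'.
  move=> sU sU' cU cU'; have [g Gg <-] := homs U U' sU sU' cU cU'.
  by rewrite im_sum; apply: eq_bigr => S _; rewrite fG.
suff : f C = 1%N by rewrite /f; case: exists_inP => // -[g Gg /eqP]; exists g.
apply: (@exchange_ind X (fun S => #|S| = t -> f S = 1%N) _ B C sBX sCX) => //; first last.
- by move=> _; rewrite /f; case: exists_inP => // -[]; exists 1; rewrite ?group1 ?imset_perm1.
- by rewrite cB.
move=> S x y sSX Sx Xy nSy HS cS'.
have nSxy : y \notin S :\ x by rewrite !inE negb_and nSy orbT.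
have cS : #|S| = t by rewrite -cS' cardsU1 nSxy (cardsD1 x S) Sx.
have mt (D : {set T}) u : (u \in tperm x y @: D) = (tperm x y u \in D).
  by rewrite -{1}[u](tpermK x y) mem_imset //; apply: perm_inj.
have ES : tperm x y @: S = y |: S :\ x.
  apply/setP => u; rewrite !inE mt; case: tpermP => [->|->|/eqP ux /eqP uy].
  - by rewrite (negPf nSy) eqxx /= orbF; apply/esym/negP => /eqP E; rewrite -E Sx in nSy.
  - by rewrite Sx eqxx.
  - by rewrite ux (negPf uy).
rewrite -ES -(HS cS); apply/esym.
apply: (@subset_sum_inj X t s f (fun S => f (tperm x y @: S))) => // U sU cU.
rewrite -im_sum; apply: fsum => //; last by rewrite card_imset_perm.
apply/subsetP => _ /imsetP[u Uu ->]; case: tpermP => [_|_|_ _]; [exact: Xy | exact: (subsetP sSX) | exact: (subsetP sU)].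
Qed.

Lemma commute_orbit_expg (c w : {perm T}) y i : commute c w -> w y = (c ^+ i) y -> (w ^+ #[c]) y = y.
Proof.
move=> cw Ei; have Ej j : (w ^+ j) y = (c ^+ (i * j)) y.
  elim: j => [|j IHj]; first by rewrite muln0 !expg0.
  rewrite expgSr permM IHj -permM -(commuteX (i * j) (commute_sym cw)).
  by rewrite permM Ei -permM -expgD mulnS.
by rewrite Ej mulnC expgM expg_order expg1n perm1.
Qed.

End SubsetSums.

(** A partition into two blocks is determined by the block of [a], and an element fixing [a]
    preserves the role of that block. *)
Lemma two_block_homogeneous n k (G : {group {perm 'I_n}}) a : 1 < k -> n = (k * 2)%N ->
    partition_transitive k G -> G \subset 'C(~: [set~ a] | 'P) ->
  set_homogeneous G [set~ a] k.-1.
Proof.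
move=> hk hn ptG sGX B C sB sC cB cC.
have naB (D : {set 'I_n}) : D \subset [set~ a] -> a \notin D.
  by move=> sD; apply/negP => /(subsetP sD); rewrite !inE eqxx.
have card_a (D : {set 'I_n}) : D \subset [set~ a] -> #|D| = k.-1 -> #|a |: D| = k.
  by move=> sD cD; rewrite cardsU1 naB // cD add1n prednK // ltnW.
have uP (D : {set 'I_n}) : #|D| = k -> uniform_partition k [set D; ~: D].
  move=> cD; have cDC : #|~: D| = k.
    by apply/eqP; rewrite -(eqn_add2l #|D|) cardsC cD card_ord hn muln2 addnn.
  have D0 (E : {set 'I_n}) : #|E| = k -> E != set0.
    by move=> cE; rewrite -cards_eq0 cE -lt0n ltnW.
  apply/andP; split; last by apply/forall_inP => E; rewrite !inE => /orP[] /eqP->; rewrite ?cD ?cDC.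
  apply/and3P; split.
  - rewrite /cover bigcup_setU !big_set1 setUCr //.
  - apply/trivIsetP => E F; rewrite !inE => /orP[] /eqP-> /orP[] /eqP->; rewrite ?eqxx // => _;
      by rewrite -setI_eq0 ?setICr // setIC setICr.
  - by rewrite !inE negb_or !(eq_sym set0) !D0.
have [g Gg E] := ptG _ _ (uP _ (card_a B sB cB)) (uP _ (card_a C sC cC)).
have ga : g a = a by rewrite (astabCP _ _ (subsetP sGX _ Gg)) // !inE eqxx.
have : g @: (a |: B) \in [set a |: C; ~: (a |: C)] by rewrite -E imset_f // !inE eqxx.
have gB : g @: (a |: B) = a |: g @: B by rewrite imsetU imset_set1 ga.
rewrite gB !inE => /orP[/eqP EC|/eqP EC]; exists g => //; last first.
  by have /setP/(_ a) := EC; rewrite !inE eqxx.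
have nagB : a \notin g @: B.
  by apply: contra (naB B sB) => /imsetP[b Bb]; rewrite -{1}ga => /perm_inj ->.
by rewrite -(setU1K nagB) EC setU1K // naB.
Qed.

(** * Degree thirteen *)

Section DegreeThirteen.
Variable T : finType.
Implicit Types (X Y S : {set T}) (G : {group {perm T}}) (p : nat).

Lemma set_homogeneous_dvd G X t : G \subset 'C(~: X | 'P) -> t <= #|X| ->
  set_homogeneous G X t -> 'C(#|X|, t) %| #|G|.
Proof.
move=> sGX letX homt; rewrite -cards_draws.
have [S sSX cS] := ex_subset_card letX.
have <- : orbit 'P^* G S = [set B : {set T} | B \subset X & #|B| == t].
  apply/setP => B; rewrite inE; apply/imsetP/andP => [[g Gg ->] | [sB /eqP cB]].
    rewrite /= /setact /= card_imset_perm cS eqxx; split=> //.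
    by rewrite -(astabC_imset (subsetP sGX _ Gg)) imsetS.
  by have [g Gg <-] := homt _ _ sSX sB cS cB; exists g.
exact: dvdn_orbit.
Qed.

Lemma dvdn_card_moved p (g : {perm T}) : prime p -> #[g] = p -> p %| #|moved g|.
Proof.
move=> pp og; have pg : p.-group <[g]> by rewrite /pgroup -orderE og pnat_id.
have acts_g : [acts <[g]>, on moved g | 'P].
  by apply/subsetP => w gw; apply/astabsP => x; apply: mem_moved_cycle.
have := pgroup_fix_mod pg acts_g; rewrite /dvdn => ->.
suff -> : 'Fix_(moved g | 'P)(<[g]>) = set0 by rewrite cards0 mod0n.
apply/setP => x; rewrite in_set0; apply/negP => /setIP[]; rewrite inE => mx /afixP fx; have /= gx := fx g (cycle_id g).
by move: mx; rewrite -[X in _ != X]gx eqxx.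
Qed.

Lemma moved_norm (g w : {perm T}) : w \in 'N(<[g]>) -> w @: moved g = moved g.
Proof.
move=> nw; apply/eqP; rewrite eqEcard card_imset_perm leqnn andbT.
apply/subsetP => _ /imsetP[x mx ->]; move: mx; rewrite !inE; apply: contraNneq => Eg.
have /cycleP[j ->] : g \in <[g ^ w^-1]>.
  by rewrite cycleJ (normP _) ?groupV ?cycle_id.
rewrite permX; apply/eqP; elim: j => //= j ->; rewrite conjgE invgK !permM Eg permK //.
Qed.

Lemma mem_astabs_imset (g : {perm T}) S : (g \in 'N(S | 'P)) = (g @: S == S).
Proof. by rewrite -astab1_set; apply/astab1P/eqP. Qed.

(* [<[r]>] and its conjugate by [g] are Sylow subgroups of the stabiliser of
   [y |: S], hence conjugate in it. *)
Lemma sylow_cycle_fusion G p (r g : {perm T}) S x y : p.-Sylow(G) <[r]> ->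
    r @: S = S -> S \subset moved r -> x \notin moved r -> y \notin moved r ->
    g \in G -> g @: (x |: S) = y |: S ->
  exists2 w, w \in 'N_('N_G(<[r]>))(S | 'P) & w x = y.
Proof.
move=> syl rS sS mx my Gg gS; have Gr : r \in G.
  by apply: subsetP (pHall_sub syl) _ (cycle_id r).
have fix_r z : z \notin moved r -> r z = z by rewrite inE negbK => /eqP.
have rU z : z \notin moved r -> r @: (z |: S) = z |: S.
  by move=> mz; rewrite imsetU imset_set1 fix_r // rS.
pose K := 'N_G(y |: S | 'P)%G.
have sylK (R : {group {perm T}}) : R \subset K -> p.-Sylow(G) R -> p.-Sylow(K) R.
  by move=> sRK; apply: pHall_subl sRK (subsetIl _ _).
have syl1 : p.-Sylow(K) <[r]>.
  apply: sylK => //; rewrite cycle_subG; apply/setIP; split=> //.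
  by rewrite mem_astabs_imset rU.
have syl2 : p.-Sylow(K) (<[r]> :^ g)%G.
  apply: sylK; last by rewrite pHallJ.
  rewrite /= -cycleJ cycle_subG; apply/setIP; split; first exact: groupJ.
  by rewrite mem_astabs_imset -gS conjgE !imsetM imset_permK rU.
have [h Kh Eg] := Sylow_trans syl1 syl2.
have Eh : <[r]> :^ g = <[r]> :^ h by rewrite -[LHS]/(gval (<[r]> :^ g)%G) Eg.
have [Gh] := setIP Kh; rewrite mem_astabs_imset => /eqP hS.
pose w := g * h^-1; have Gw : w \in G by rewrite groupM ?groupV.
have nw : w \in 'N(<[r]>) by apply/normP; rewrite conjsgM Eh conjsgK.
have wS : w @: (x |: S) = y |: S by rewrite imsetM gS -{1}hS imset_permK.
have wmv z : (w z \in moved r) = (z \in moved r).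
  by rewrite -{1}(moved_norm nw) mem_imset //; apply: perm_inj.
have wx : w x = y.
  have : w x \in y |: S by rewrite -wS imset_f // setU11.
  case/setU1P => // /(subsetP sS); rewrite wmv; by rewrite (negPf mx).
exists w => //; rewrite inE mem_astabs_imset inE Gw nw /=.
have nxS z : z \notin moved r -> z \notin S by apply: contra; apply: subsetP.
by rewrite -(setU1K (nxS x mx)) imset_permD wS imset_set1 wx !setU1K ?nxS.
Qed.

Lemma cards3_enum (F : {set T}) : #|F| = 3 ->
  exists a b c, uniq [:: a; b; c] /\ F = [set a; b; c].
Proof.
move=> cF; have := cF; rewrite cardE; have := enum_uniq F; have := mem_enum F.
case: (enum F) => [|a [|b [|c []]]] // EF U _; exists a, b, c; split=> //.
by apply/setP => z; rewrite -EF !inE orbA.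
Qed.

(** Take [u] from [a] to [b] and [u'] from [b] to [c]. If neither is a rotation, they are two
    different transpositions of the points, and their product is a rotation. *)
Lemma three_point_rotation (W : {group {perm T}}) (F : {set T}) : #|F| = 3 -> W \subset 'N(F | 'P) ->
    (forall x y, x \in F -> y \in F -> exists2 w, w \in W & w x = y) ->
  exists2 v, v \in W & exists a b c, [/\ F = [set a; b; c], uniq [:: a; b; c],
    v a = b, v b = c & v c = a].
Proof.
move=> cF sWF trW.
have Fw w z : w \in W -> (w z \in F) = (z \in F).
  by move=> Ww; have /astabs_act -> := subsetP sWF _ Ww.
have [a [b [c [abc EF]]]] := cards3_enum cF.
have [/andP[ab ac] bc] : (a != b) && (a != c) /\ b != c.
  by move: abc; rewrite /= !inE negb_or andbT => /andP[].
have [Fa Fb Fc] : [/\ a \in F, b \in F & c \in F] by rewrite EF !inE !eqxx !orbT.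
have third w x y z : w \in W -> [/\ x \in F, y \in F & z \in F] -> uniq [:: w x; w y; z] ->
    x != y -> forall t, t \in F -> t != x -> t != y -> w t = z.
  move=> Ww [Fx Fy Fz] U xy t Ft tx ty.
  have E : [set w x; w y; z] = F.
    apply/eqP; rewrite eqEcard cF !subUset !sub1set !Fw // Fx Fy Fz /=.
    have := card_uniqP U; rewrite -[3]/(size [:: w x; w y; z]) => <-.
    by apply/eq_leq/eq_card => s; rewrite !inE orbA.
  have : w t \in F by rewrite Fw.
  by rewrite -E !inE !(inj_eq perm_inj) (negPf tx) (negPf ty) => /eqP.
have [ba ca cb] : [/\ b != a, c != a & c != b] by split; rewrite eq_sym.
pose ne := (ab, ac, bc, ba, ca, cb).
have [u Wu ua] := trW a b Fa Fb; have [u' Wu' u'b] := trW b c Fb Fc.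
have : u b \in [set a; b; c] by rewrite -EF Fw.
have : u b != b by rewrite -{2}ua (inj_eq perm_inj) eq_sym.
rewrite !inE => /negPf-> /=; rewrite orbF => /orP[] /eqP ub; last first.
  exists u => //; exists a, b, c; split=> //; apply: (third u a b a) => //.
  by rewrite ua ub /= !inE !negb_or !ne.
have uc : u c = c.
  by apply: (third u a b c) => //; rewrite ua ub /= !inE !negb_or !ne.
have : u' c \in [set a; b; c] by rewrite -EF Fw.
have : u' c != c by rewrite -{2}u'b (inj_eq perm_inj) eq_sym.
rewrite !inE => /negPf->; rewrite orbF => /orP[] /eqP u'c.
  exists u' => //; exists a, b, c; split=> //; apply: (third u' b c b) => //.
  by rewrite u'b u'c /= !inE !negb_or !ne.
have u'a : u' a = a.
  by apply: (third u' b c a) => //; rewrite u'b u'c /= !inE !negb_or !ne.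
exists (u * u'); rewrite ?groupM //; exists a, c, b; split; rewrite ?permM ?ua ?ub ?uc //.
  by rewrite EF; apply/setP => z; rewrite !inE -!orbA (orbC (z == b)).
by rewrite /= !inE !negb_or !ne.
Qed.

(** Conjugation by [v] raises [r] to some power [i] prime to [p], and [i ^ (p - 1)] is 1 modulo
    [p]. *)
Lemma norm_cycle_commute p (r v : {perm T}) : prime p -> #[r] = p -> v \in 'N(<[r]>) ->
  commute r (v ^+ p.-1).
Proof.
move=> pp oR nv; have /cycleP[i Ei] : r ^ v \in <[r]> by rewrite memJ_norm ?cycle_id.
have Ej j : r ^ (v ^+ j) = r ^+ (i ^ j).
  elim: j => [|j IHj]; first by rewrite expg0 conjg1 expn0 expg1.
  by rewrite expgSr conjgM IHj conjXg Ei -expgM expnS.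
have cop : coprime i p.
  rewrite coprime_sym prime_coprime // -oR order_dvdn -Ei -order_eq1 orderJ oR.
  by rewrite neq_ltn prime_gt1 ?orbT.
have := Euler_exp_totient cop; rewrite totient_prime // => Ep.
have : r ^+ (i ^ p.-1) = r ^+ 1 by apply/eqP; rewrite eq_expg_mod_order oR; apply/eqP.
by rewrite -Ej expg1 => /conjg_fixP/commgP.
Qed.

(* An 11-cycle makes [G] 3-transitive, and 5 divides the number of 4-subsets. If
   no element of order 5 is a 5-cycle, a Sylow 5-subgroup [<[r]>] has order 5
   and fixes a set [F] of three points; fusion gives [v] normalising [<[r]>] and
   permuting [F] cyclically, so that [v ^+ 20] is a 3-cycle. *)
Lemma degree_13_alt G X : #|X| = 13 -> G \subset 'C(~: X | 'P) -> [transitive G, on X | 'P] ->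
  11 %| #|G| -> set_homogeneous G X 6 -> contains_alt G X.
Proof.
move=> X13 sGX tr G11 hom6.
have ltX : #|X| < 11.*2 by rewrite X13.
have [c Gc [mc oc]] := prime_cycle_exists sGX (isT : prime 11) ltX G11.
have := prime_cycle_transitivity sGX tr (isT : prime 11) ltX Gc mc oc; rewrite X13 => tr3.
have tr2 : [transitive^2 G, on X | 'P] by apply: ntransitive_weak tr3.
have fixX g x : g \in G -> x \notin X -> g x = x by move=> Gg; apply/astabCP/(subsetP sGX).
have sm g : g \in G -> moved g \subset X by move=> Gg; apply: moved_sub; apply: subsetP sGX _ Gg.
have [/exists_inP[g Gg /andP[/eqP o5 /eqP m5]]|none] :=
    boolP [exists g in G, (#[g] == 5) && (#|moved g| == 5)].
  apply: (jordan_prime_cycle sGX (sm _ Gg) _ (mem_astabC_moved Gg)); rewrite ?m5 ?X13 //.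
  by apply: blockless_moves (ntransitive2_blockless tr2) _; rewrite m5.
(* The number of moved points is a multiple of 5 from 1 to 13, and 5 is excluded. *)
have five g : g \in G -> #[g] = 5 -> #|moved g| = 10.
  move=> Gg og; have := dvdn_card_moved (isT : prime 5) og.
  have : #|moved g| <= 13 by rewrite -X13 subset_leq_card ?sm.
  have : #|moved g| != 0.
    rewrite cards_eq0; apply: contra_eqN og => /eqP m0; suff -> : g = 1 by rewrite order1.
    by apply/permP => x; have /setP/(_ x) := m0; rewrite !inE perm1 => /negbFE/eqP.
  have : #|moved g| != 5.
    by apply: contraNneq none => m5; apply/exists_inP; exists g; rewrite // og m5.
  by move: #|moved g|; do 14 case=> //.
(* Homogeneity descends from 6-subsets to 4-subsets, whose number is 715. *)
have G5 : 5 %| #|G|.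
  have := set_homogeneous_dvd sGX _ (livingstone_wagner sGX (isT : 4 <= 6) _ hom6).
  by rewrite X13 => /(_ isT isT); apply: dvdn_trans.
have [Q sylQ] := Sylow_exists 5 G; have pQ := pHall_pgroup sylQ; have sQG := pHall_sub sylQ.
have ntQ : Q :!=: 1.
  apply: contraTneq G5 => Q1; have := card_Hall sylQ; rewrite Q1 cards1 => /esym/eqP.
  by rewrite p_part_eq1 mem_primes cardG_gt0.
have Z5 : 5 %| #|'Z(Q)|.
  have [|_ ->] := pgroup_pdiv (pgroupS (center_sub Q) pQ) => //.
  by rewrite (center_nil_eq1 (pgroup_nil pQ)).
have [r Zr oR] := Cauchy (isT : prime 5) Z5.
have /centerP[Qr cQr] := Zr; have Gr := subsetP sQG r Qr; have mr := five r Gr oR.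
have [x mx] : exists x, x \in moved r by apply/card_gt0P; rewrite mr.
set S := orbit 'P <[r]> x.
have [cS sS] : #|S| = 5 /\ S \subset moved r := card_orbit_moved (isT : prime 5) oR mx.
(* An element of order 5 in [Q] fixing [x] would commute with the central [r], hence fix all of [S]
   and move at most 8 points instead of 10. So [Q] acts freely on the orbit of [x], and its order is
   at most 13. *)
have stab1 : #|'C_Q[x | 'P]| = 1%N.
  apply/eqP; rewrite -trivg_card1; apply/idPn => nt.
  have [_ d5 _] := pgroup_pdiv (pgroupS (subsetIl Q 'C[x | 'P]) pQ) nt.
  have [w /setIP[Qw] /astab1P wx ow] := Cauchy (isT : prime 5) d5.
  have Gw := subsetP sQG w Qw.
  have : moved w \subset X :\: S.
    apply/subsetP => y my; rewrite inE (subsetP (sm w Gw)) // andbT; apply: contraTN my.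
    case/imsetP => _ /cycleP[i ->] ->; rewrite inE negbK /= /aperm -permM.
    by rewrite -(commuteX i (commute_sym (cQr w Qw))) permM [w x]wx.
  move/subset_leq_card; rewrite five // cardsD (setIidPr _) ?cS ?X13 //.
  exact: subset_trans sS (sm r Gr).
have cQ : #|Q| = 5.
  have := card_orbit_stab 'P Q x; rewrite stab1 muln1 => cO.
  have : #|Q| <= 13.
    rewrite -cO -X13 subset_leq_card //; apply/subsetP => _ /imsetP[w Qw ->].
    by rewrite /= /aperm (astabC_mem _ (subsetP sGX _ (subsetP sQG w Qw))) (subsetP (sm r Gr)).
  rewrite (card_pgroup pQ); case: (logn 5 #|Q|) (card_pgroup pQ) => [/eqP|[|k]] //.
    by rewrite expn0 -trivg_card1 (negPf ntQ).
  by move=> _ le; have := leq_trans (leq_pexp2l (isT : 0 < 5) (isT : 2 <= k.+2)) le.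
have EQ : Q :=: <[r]>.
  by apply/esym/eqP; rewrite eqEcard cycle_subG Qr -orderE oR cQ.
have sylr : 5.-Sylow(G) <[r]> by rewrite -EQ.
have rS : r @: S = S.
  by apply/eqP; rewrite -mem_astabs_imset (subsetP (acts_orbit _ _ _)) ?cycle_id ?subsetT.
pose F := X :\: moved r.
have cF : #|F| = 3 by rewrite cardsD (setIidPr (sm r Gr)) X13 mr.
pose W := 'N_('N_G(<[r]>))(S | 'P)%G.
have WP w : w \in W -> [/\ w \in G, w \in 'N(<[r]>) & w @: S = S].
  by case/setIP => /setIP[Gw nw]; rewrite mem_astabs_imset => /eqP.
have [||v Wv [a [b [e [EF U va vb ve]]]]] := @three_point_rotation W F cF.
- apply/subsetP => w /WP[Gw nw _]; rewrite mem_astabs_imset imset_permD moved_norm //.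
  by rewrite (astabC_imset (subsetP sGX w Gw)).
- move=> y z /setDP[Xy my] /setDP[Xz mz].
  have nS t : t \notin moved r -> t \notin S by apply: contra; apply: subsetP.
  have sX t : t \in X -> t |: S \subset X.
    by move=> Xt; rewrite subUset sub1set Xt (subset_trans sS) ?sm.
  have c6 t : t \notin moved r -> #|t |: S| = 6 by move=> mt; rewrite cardsU1 nS // cS.
  have [g Gg gS] := hom6 _ _ (sX y Xy) (sX z Xz) (c6 y my) (c6 z mz).
  exact: sylow_cycle_fusion sylr rS sS my mz Gg gS.
have [Gv nv vS] := WP v Wv.
(* As [v ^+ 4] preserves [S], it preserves the other 5-orbit of [r] too. Since it centralises [r],
   it acts on each as a power of [r], and [v ^+ 20] is trivial there. *)
have comm : commute r (v ^+ 4) := norm_cycle_commute (isT : prime 5) oR nv.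
have Wv4 : v ^+ 4 \in W by rewrite groupX.
have [Gv4 nv4 vS4] := WP _ Wv4.
have v4S y : ((v ^+ 4) y \in S) = (y \in S) by rewrite -{1}vS4 mem_imset //; apply: perm_inj.
have v4m y : ((v ^+ 4) y \in moved r) = (y \in moved r).
  by rewrite -{1}(moved_norm nv4) mem_imset //; apply: perm_inj.
have v20 y : y \in moved r -> (v ^+ 20) y = y.
  move=> my; have [cO sO] := card_orbit_moved (isT : prime 5) oR my.
  suff : (v ^+ 4) y \in orbit 'P <[r]> y.
    case/imsetP => _ /cycleP[i ->] /(commute_orbit_expg comm).
    by rewrite oR -expgM.
  have [Sy|nSy] := boolP (y \in S).
    by have /orbit_eqP-> : y \in orbit 'P <[r]> x := Sy; rewrite v4S.
  have dis : [disjoint S & orbit 'P <[r]> y].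
    rewrite -setI_eq0; apply/set0Pn => -[t /setIP[St yt]]; case/negP: nSy.
    have /orbit_eqP E1 : t \in orbit 'P <[r]> y := yt; have /orbit_eqP E2 : t \in orbit 'P <[r]> x := St.
    by rewrite /S -E2 E1 orbit_refl.
  have : S :|: orbit 'P <[r]> y = moved r.
    apply/eqP; rewrite eqEcard subUset sS sO mr cardsU.
    by move: dis; rewrite -setI_eq0 => /eqP->; rewrite cards0 cS cO.
  by move/setP/(_ ((v ^+ 4) y)); rewrite in_setU v4S (negPf nSy) v4m my.
have [ab ae be] : [/\ a != b, a != e & b != e].
  by move: U; rewrite /= !inE negb_or andbT => /andP[/andP[]].
(* As 20 is 2 modulo 3, this is the inverse rotation. *)
have [v20a v20b v20e] : [/\ (v ^+ 20) a = e, (v ^+ 20) b = a & (v ^+ 20) e = b].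
  by rewrite !permX /= !(va, vb, ve).
have v20F y : y \notin F -> (v ^+ 20) y = y.
  rewrite inE negb_and negbK => /orP[/v20 //|]; apply: fixX; exact: groupX.
have Gh : v ^+ 20 \in G by rewrite groupX.
apply: (contains_alt_3cycle sGX tr2 Gh).
  apply: etrans cF; apply: eq_card => y; rewrite [y \in moved _]inE; apply/idP/idP.
    by apply: contraR => /v20F/eqP.
  by rewrite EF !inE -orbA => /or3P[] /eqP->; rewrite ?v20a ?v20b ?v20e // eq_sym.
apply/permP => y; rewrite permX perm1 /=.
have [|/v20F E] := boolP (y \in F); last by rewrite !E.
by rewrite EF !inE -orbA => /or3P[] /eqP->; rewrite !(v20a, v20b, v20e).
Qed.

End DegreeThirteen.

(** * The theorem, type by type *)

Lemma sub_astabC_setT (T : finType) (G : {set {perm T}}) : G \subset 'C(~: [set: T] | 'P).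
Proof. by apply/subsetP => g _; apply/astabCP => x; rewrite inE. Qed.

Lemma one_block_transitive n k (G : {group {perm 'I_n}}) : lambda_transitive k 1 G.
Proof.
move=> A B [_ [_ coA]] [_ [_ coB]]; exists 1; first exact: group1.
by move=> i; rewrite ord1 imset_perm1; move: coA coB; rewrite !big_ord1 => -> ->.
Qed.

Lemma two_blocks_complement n k (A : 'I_2 -> {set 'I_n}) :
  ordered_partition_of_type k A -> A ord_max = ~: A ord0.
Proof.
case=> _ [dA coA]; apply/setP => x; rewrite inE; apply/idP/idP => [A1 | nA0].
  apply/negP => A0; have /pred0P/(_ x) := dA ord0 ord_max isT.
  by rewrite /= A0 A1.
have : x \in \bigcup_(i < 2) A i by rewrite coA inE.
case/bigcupP => -[[|[|//]] lti] _; last by rewrite (val_inj (erefl : val (Ordinal lti) = val ord_max)).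
by rewrite (val_inj (erefl : val (Ordinal lti) = val ord0)) (negPf nA0).
Qed.

Lemma ntransitive3_two_blocks (G : {group {perm 'I_6}}) :
  [transitive^3 G, on [set: 'I_6] | 'P] -> lambda_transitive 3 2 G.
Proof.
move=> tr3 A B oA oB; have [cA _] := oA; have [cB _] := oB.
have [a [b [c [U EA]]]] := cards3_enum (cA ord0).
have [a' [b' [c' [U' EB]]]] := cards3_enum (cB ord0).
have [||g Gg [ga gb gc]] := @ntransitive3P _ G setT a b c a' b' c' tr3; try by split; rewrite ?inE.
have g0 : g @: A ord0 = B ord0 by rewrite EA EB !imsetU !imset_set1 ga gb gc.
exists g => // -[[|[|//]] lti].
  by rewrite (val_inj (erefl : val (Ordinal lti) = val ord0)).
rewrite (val_inj (erefl : val (Ordinal lti) = val ord_max)) (two_blocks_complement oA).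
rewrite (two_blocks_complement oB) -g0 -!setTD imset_permD; congr (_ :\: _).
by apply/setP => x; rewrite inE -[x](permKV g) imset_f.
Qed.

(** Three pairs covering six points are disjoint, by counting. *)
Lemma three_pairs_partition (P : {set {set 'I_6}}) : #|P| <= 3 ->
  (forall A, A \in P -> #|A| = 2) -> cover P = setT -> uniform_partition 2 P.
Proof.
move=> cP uP coP; apply/andP; split; last by apply/forall_inP => A /uP/eqP.
apply/and3P; split; first by rewrite coP.
  rewrite -(leq_card_cover P) eqn_leq (leq_card_cover P) /= coP cardsT card_ord.
  rewrite (eq_bigr (fun=> 2)) // sum_nat_const.
  by rewrite (leq_mul2r 2 #|P| 3).
by apply/negP => /uP; rewrite cards0.
Qed.

(** Unlike (3,3), type (2,2,2) admits neither PSL(2,5) nor PGL(2,5): homogeneity relates two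
    partitions into pairs that lie in different orbits of these groups. *)
Lemma degree_6_two_three (G : {group {perm 'I_6}}) : partition_transitive 2 G ->
  [transitive G, on [set: 'I_6] | 'P] -> 5 %| #|G| -> contains_alt G setT.
Proof.
move=> ptG tr G5; have [//|[lab Hl [sl [c Gc [mc oc Cl Pi]]]]] := degree_6_labelling tr G5.
have Pc : codes lab G aff6 by exists c.
have X6 : #|[set: 'I_6]| = 6 by rewrite cardsT card_ord.
have sGX := sub_astabC_setT G.
have ltX : #|[set: 'I_6]| < 5.*2 by rewrite X6.
have := prime_cycle_transitivity sGX tr (isT : prime 5) ltX Gc mc oc; rewrite X6 => tr2.
pose L i := nth ord0 lab i; have [Ul Al] := Hl.
have LE i j : i < 6 -> j < 6 -> (L i == L j) = (i == j).
  by move=> lti ltj; rewrite nth_uniq ?sl.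
pose blocks a b c d e f := [set [set L a; L b]; [set L c; L d]; [set L e; L f]].
have uB (a b c' d e f : nat) : perm_eq [:: a; b; c'; d; e; f] (iota 0 6) ->
    uniform_partition 2 (blocks a b c' d e f).
  move=> pe; have := perm_uniq pe; rewrite iota_uniq /= !inE !negb_or => U.
  have lt i : i \in [:: a; b; c'; d; e; f] -> i < 6 by rewrite (perm_mem pe) mem_iota.
  apply: three_pairs_partition.
  - apply: leq_trans (leq_card_setU _ _) _; rewrite cards1 cards2; by case: eqP.
  - move: U; move=> /and5P[/and5P[ab _ _ _ _] _ /and3P[cd _ _] _ /andP[ef _]] A.
    by rewrite !inE -orbA => /or3P[] /eqP->; rewrite cards2 LE ?ab ?cd ?ef ?lt // !inE !eqxx ?orbT.
  apply/setP => x; rewrite inE; apply/bigcupP.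
  have Ex : L (index x lab) = x by rewrite /L nth_index.
  have : index x lab \in [:: a; b; c'; d; e; f].
    have : index x lab < size lab by rewrite index_mem.
    by rewrite (perm_mem pe) mem_iota /= add0n sl.
  rewrite !inE; case/or4P => [/eqP E|/eqP E|/eqP E|/or3P[] /eqP E]; rewrite E in Ex; rewrite -Ex.
  - by exists [set L a; L b]; rewrite !inE eqxx ?orbT.
  - by exists [set L a; L b]; rewrite !inE eqxx ?orbT.
  - by exists [set L c'; L d]; rewrite !inE eqxx ?orbT.
  - by exists [set L c'; L d]; rewrite !inE eqxx ?orbT.
  - by exists [set L e; L f]; rewrite !inE eqxx ?orbT.
  - by exists [set L e; L f]; rewrite !inE eqxx ?orbT.
have [g Gg Eg] := ptG _ _ (uB 0 1%N 2 3 4 5 isT) (uB 0 1%N 3 5 2 4 isT).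
have clo := codes_closed ord0 Hl G; rewrite sl in clo.
apply: (codes_3cycle_alt ord0 Hl sGX tr2).
apply: (@degree6_syntheme _ clo Pc (code lab g) Pi); first by exists g.
have lts i : i < 6 -> nth 0 (code lab g) i < 6.
  move=> lti; have lt : index (g (L i)) lab < size lab by rewrite index_mem.
  by rewrite /code (nth_map ord0) ?sl //; rewrite sl in lt.
have pairE a b c' d : a < 6 -> b < 6 -> c' < 6 -> d < 6 -> [set L a; L b] = [set L c'; L d] ->
    (a, b) \in [:: (c', d); (d, c')].
  move=> la lb lc ld /setP E; have := E (L a); have := E (L b); have := E (L c'); have := E (L d).
  rewrite !inE !LE // !eqxx !orbT /= !xpair_eqE.
  move=> /orP Ed /orP Ec /esym/orP Eb /esym/orP Ea; apply/orP.
  by case: Ea => /eqP Ea; [left | right]; rewrite Ea eqxx /=; case: Eb => /eqP Eb;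
    case: Ed => /eqP Ed; case: Ec => /eqP Ec; apply/eqP; congruence.
have gP i : i \in [:: 0; 2; 4] ->
    [set L (nth 0 (code lab g) i); L (nth 0 (code lab g) i.+1)] \in blocks 0 1%N 3 5 2 4.
  move=> i3; have li : i < 5 by move: i3; rewrite !inE => /or3P[] /eqP->.
  rewrite -Eg /L !(nth_lab_code _ Hl) ?sl ?(leqW li) //.
  apply/imsetP; exists [set L i; L i.+1]; last by rewrite imsetU !imset_set1.
  by move: i3; rewrite !inE => /or3P[] /eqP->; rewrite eqxx ?orbT.
move=> i i3; have li : i < 5 by move: i3; rewrite !inE => /or3P[] /eqP->.
have := gP i i3; rewrite /blocks !inE -orbA => /or3P[] /eqP /pairE;
  by move=> /(_ (lts i (leqW li)) (lts i.+1 li) isT isT); rewrite !inE => /orP[] ->; rewrite ?orbT.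
Qed.

Lemma small_uniform_types k m : 1 < k -> 1 < m -> (k * m < 16)%N ->
  (k, m) \in [:: (2, 2); (2, 3); (3, 2); (2, 4); (4, 2); (3, 3); (2, 5); (5, 2);
                 (2, 6); (6, 2); (3, 4); (4, 3); (2, 7); (7, 2); (3, 5); (5, 3)].
Proof.
move=> hk hm lt; have lk : k < 8 by nia.
have lm : m < 8 by nia.
have /allP/(_ k) : all (fun k => all (fun m => [&& 1 < k, 1 < m & (k * m < 16)%N] ==> ((k, m) \in
    [:: (2, 2); (2, 3); (3, 2); (2, 4); (4, 2); (3, 3); (2, 5); (5, 2);
        (2, 6); (6, 2); (3, 4); (4, 3); (2, 7); (7, 2); (3, 5); (5, 3)])) (iota 0 8)) (iota 0 8) by [].
by rewrite mem_iota => /(_ lk)/allP/(_ m); rewrite mem_iota hk hm lt => /(_ lm).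
Qed.

Lemma contains_alt_homogeneous n k m p (G : {group {perm 'I_n}}) X : 1 < k -> n = (k * m)%N ->
    partition_transitive k G -> G \subset 'C(~: X | 'P) -> [transitive G, on X | 'P] ->
    prime p -> k < p -> (m < p) \/ (exists2 a, X = [set~ a] & m <= p) ->
    p <= #|X| < p.*2 -> (p == 3) || (p + 3 <= #|X|) ->
  contains_alt G X.
Proof.
move=> hk hn ptG sGX tr pp ltk hm /andP[leX ltX] p3.
exact: contains_alt_prime sGX tr pp ltX p3 (homogeneous_prime_dvd hk hn ptG sGX pp ltk leX hm).
Qed.

Lemma contains_alt_large n k m (G : {group {perm 'I_n}}) X : 1 < k -> 1 < m -> n = (k * m)%N ->
    16 <= n -> partition_transitive k G -> G \subset 'C(~: X | 'P) -> [transitive G, on X | 'P] ->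
    n <= #|X|.+1 ->
  contains_alt G X.
Proof.
move=> hk hm hn n16 ptG sGX tr leX.
have [p pp /andP[ltp lep]] := @prime_between n./2 ltac:(lia).
have leXn : #|X| <= n by rewrite -[X in _ <= X]card_ord max_card.
have [lk lm] : k <= n./2 /\ m <= n./2.
  by clear -hk hm hn; split; rewrite geq_half_double -muln2 hn; nia.
have [bp bX] : p + 4 <= n /\ n < p.*2 by clear -ltp lep n16; lia.
apply: (contains_alt_homogeneous hk hn ptG sGX tr pp); first exact: leq_ltn_trans ltp.
- by left; apply: leq_ltn_trans ltp.
- by clear -bp bX leX leXn; lia.
by apply/orP; right; clear -bp bX leX leXn; lia.
Qed.

Lemma two_block_pairs n (G : {group {perm 'I_n}}) a : set_homogeneous G [set~ a] 2 ->
  forall x y z w, x \in [set~ a] -> y \in [set~ a] -> z \in [set~ a] -> w \in [set~ a] ->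
    x != y -> z != w -> exists2 g, g \in G & g @: [set x; y] = [set z; w].
Proof.
move=> hom x y z w ax ay az aw xy zw.
by apply: hom; rewrite ?subUset ?sub1set ?ax ?ay ?az ?aw ?cards2 ?xy ?zw.
Qed.

Local Close Scope group_scope.

Theorem theorem4p1 (n k m : nat) (hk : 1 < k) (hm : 0 < m) (hn : n = k * m)
    (G : {group {perm 'I_n}}) :
  lambda_homogeneous k m G ->
  lambda_transitive k m G
  \/ (n = 6 /\ k = 3 /\ (perm_isomorphic PSL25 G \/ perm_isomorphic AGL15_fix G))
  \/ (n = 10 /\ k = 5 /\ (perm_isomorphic PSL28_fix G \/ perm_isomorphic PGammaL28_fix G))
  \/ (exists a : 'I_n,
        G :=: [set g : {perm 'I_n} | g a == a] \/
        G :=: [set g : {perm 'I_n} | g a == a] :&: ('Alt_('I_n))%g).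
Proof.
move=> homG; have ptG := homogeneous_partition_transitive hk hn homG.
have [m1|hm1] : m = 1 \/ 1 < m by move: hm; case: m {hn homG} => [|[|m]]; auto.
  by subst m; left; apply: one_block_transitive.
set goal : Prop := (lambda_transitive _ _ _ \/ _).
have altT : contains_alt G setT -> goal by left; apply: contains_alt_transitive hk hn _ hm _.
have altF a : G \subset 'C(~: [set~ a] | 'P)%g -> contains_alt G [set~ a] -> goal.
  by move=> sGX alt; do 3 right; exists a; apply: contains_alt_fixing.
have cT : #|[set: 'I_n]| = n by rewrite cardsT card_ord.
have cF (a : 'I_n) : #|[set~ a]| = n.-1 by rewrite cardsC1 card_ord.
have viaT p : [transitive G, on setT | 'P] -> prime p -> k < p -> m < p -> p <= n < p.*2 ->
    (p == 3) || (p + 3 <= n) -> goal.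
  move=> tr pp ltk ltm bp p3; apply: altT.
  by apply: (contains_alt_homogeneous hk hn ptG (sub_astabC_setT G) tr pp); rewrite ?cT //; left.
have viaF p a : G \subset 'C(~: [set~ a] | 'P)%g -> [transitive G, on [set~ a] | 'P] ->
    prime p -> k < p -> m <= p -> p <= n.-1 < p.*2 -> (p == 3) || (p + 3 <= n.-1) -> goal.
  move=> sGX tr pp ltk ltm bp p3; apply: (altF a sGX).
  by apply: (contains_alt_homogeneous hk hn ptG sGX tr pp); rewrite ?cF //; right; exists a.
have dvdF p a : G \subset 'C(~: [set~ a] | 'P)%g -> prime p -> k < p -> p <= n.-1 -> m <= p ->
    p %| #|G|.
  move=> sGX pp ltk lep ltm; apply: (homogeneous_prime_dvd hk hn ptG sGX pp ltk); rewrite ?cF //.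
  by right; exists a.
have dvdT p : prime p -> k < p -> p <= n -> m < p -> p %| #|G|.
  move=> pp ltk lep ltm.
  by apply: (homogeneous_prime_dvd hk hn ptG (sub_astabC_setT G) pp ltk); rewrite ?cT //; left.
have trG := homogeneous_transitive hk hn hm1 ptG.
have [n16|n16] := leqP 16 n.
  have [tr|[a [sGX tr]]] := trG.
    by apply/altT/(contains_alt_large hk hm1 hn n16 ptG (sub_astabC_setT G) tr); rewrite cT.
  apply/(altF _ sGX)/(contains_alt_large hk hm1 hn n16 ptG sGX tr); rewrite cF.
  exact: leqSpred.
(* A prime that is small enough for degree [n - 1] and large enough for degree [n] settles both
   actions at once. *)
have viaP p : prime p -> k < p -> m < p -> p <= n.-1 -> n < p.*2 -> (p == 3) || (p + 3 <= n.-1) -> goal.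
  move=> pp ltk ltm lep ltp p3; have len := leq_pred n; have [tr|[a [sGX tr]]] := trG.
    apply: (viaT p tr pp ltk ltm); first by rewrite (leq_trans lep len).
    by case/orP: p3 => [->//|le]; rewrite (leq_trans le len) orbT.
  by apply: (viaF p a sGX tr pp ltk (ltnW ltm) _ p3); rewrite lep (leq_ltn_trans len).
clear homG; have := small_uniform_types hk hm1; rewrite -hn => /(_ n16); rewrite !inE.
case/orP => [/eqP[Ek Em]|]; first by apply: (viaP 3); rewrite ?hn ?Ek ?Em.
case/orP => [/eqP[Ek Em]|].
  have n6 : n = 6 by rewrite hn Ek Em.
  have [tr|[a [sGX tr]]] := trG; last by apply: (viaF 3 a sGX tr); rewrite ?n6 ?Ek ?Em.
  have G5 : 5 %| #|G| by apply: dvdT; rewrite ?n6 ?Ek ?Em.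
  by apply: altT; clear -n6 Ek tr G5 ptG; subst k n; apply: degree_6_two_three.
case/orP => [/eqP[Ek Em]|].
  have n6 : n = 6 by rewrite hn Ek Em.
  have [tr|[a [sGX tr]]] := trG.
    have G5 : 5 %| #|G| by apply: dvdT; rewrite ?n6 ?Ek ?Em.
    rewrite /goal; clear -altT n6 Ek Em tr G5; subst k m n.
    have [/altT //| iso | tr3] := degree_6_cases tr G5; first by right; left; do 2 (split=> //); left.
    by left; apply: ntransitive3_two_blocks.
  rewrite /goal; move: (altF a sGX); clear -ptG n6 Ek Em tr sGX => alt; subst k m n.
  have [/alt //| iso] := degree_5_cases sGX tr
      (two_block_pairs (@two_block_homogeneous 6 3 G a isT erefl ptG sGX)).
  by right; left; do 2 (split=> //); right.
have degree_8 : n = 8 -> k < 5 -> m < 5 -> goal.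
  move=> n8 lk lm; have [tr|[a [sGX tr]]] := trG; first by apply: (viaT 5 tr); rewrite ?n8.
  have G5 : 5 %| #|G| by apply: (dvdF 5 a sGX); rewrite ?n8 // ltnW.
  by apply: (altF a sGX); clear -n8 sGX tr G5; subst n; apply: degree_8_alt.
case/orP => [/eqP[Ek Em]|]; first by apply: degree_8; rewrite ?hn ?Ek ?Em.
case/orP => [/eqP[Ek Em]|]; first by apply: degree_8; rewrite ?hn ?Ek ?Em.
case/orP => [/eqP[Ek Em]|]; first by apply: (viaP 5); rewrite ?hn ?Ek ?Em.
case/orP => [/eqP[Ek Em]|].
  have [tr|[a [sGX tr]]] := trG; first by apply: (viaT 7 tr); rewrite ?hn ?Ek ?Em.
  (* Another case with [p = m]: in degree 9 the prime 7 would exceed Jordan's bound. *)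
  by apply: (viaF 5 a sGX tr); rewrite ?hn ?Ek ?Em.
case/orP => [/eqP[Ek Em]|].
  have n10 : n = 10 by rewrite hn Ek Em.
  have [tr|[a [sGX tr]]] := trG; first by apply: (viaT 7 tr); rewrite ?hn ?Ek ?Em.
  (* The prime must exceed [k = 5], and 7 is beyond Jordan's bound in degree 9. *)
  have G7 : 7 %| #|G| by apply: (dvdF 7 a sGX); rewrite ?n10 ?Ek ?Em.
  rewrite /goal; move: (altF a sGX); clear -G7 n10 Ek Em tr sGX => alt; subst k m n.
  have [/alt //|iso|iso] := degree_9_cases sGX tr G7; right; right; left; do 2 (split=> //).
    by left.
  by right.
do 4 (case/orP => [/eqP[Ek Em]|]; first by apply: (viaP 7); rewrite ?hn ?Ek ?Em).
case/orP => [/eqP[Ek Em]|].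
  have [tr|[a [sGX tr]]] := trG; first by apply: (viaT 11 tr); rewrite ?hn ?Ek ?Em.
  by apply: (viaF 7 a sGX tr); rewrite ?hn ?Ek ?Em.
case/orP => [/eqP[Ek Em]|].
  have n14 : n = 14 by rewrite hn Ek Em.
  have [tr|[a [sGX tr]]] := trG; first by apply: (viaT 11 tr); rewrite ?hn ?Ek ?Em.
  (* Here 7 does not exceed [k], and 11 misses Jordan's bound in degree 13 by one. *)
  have G11 : 11 %| #|G| by apply: (dvdF 11 a sGX); rewrite ?n14 ?Ek ?Em.
  apply: (altF a sGX); apply: degree_13_alt tr G11 _ => //; first by rewrite cF n14.
  have hn2 : n = (k * 2)%N by rewrite hn Em.
  by have := two_block_homogeneous hk hn2 ptG sGX; rewrite Ek.
by case/orP => /eqP[Ek Em]; apply: (viaP 11); rewrite ?hn ?Ek ?Em.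
Qed.
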